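(* Let $q\in[0,1]$ be a constant. Assume: (i) either $L(y,\mu)=\frac12(y-\mu)^2$, or there is a constant $L_u'>0$ such that $|L(y,\mu_1)-L(y,\mu_2)|\le L_u'|\mu_1-\mu_2|$ for all $y\in\mathcal Y$, $\mu_1,\mu_2\in\mathbb R$; (ii) $X_1$ is sub-gaussian with $\|X_1\|_{\psi_2}=K_x$, $\partial_\mu L(Y_1,0)$ is sub-gaussian with $\|\partial_\mu L(Y_1,0)\|_{\psi_2}=K_y$, and $\lambda_{\min}(\mathbf\Sigma)\ge\kappa_l$, where $\mathbf\Sigma$ is the covariance matrix of $X_1$ and $K_x,K_y,\kappa_l$ are positive constants; (iii) $\|\beta^*_{(k)}\|_2\le K_\beta$ for all $k\in[K]$ with a constant $K_\beta>0$; and for each $k\in[K]$ and $\delta\in(0,1)$, with probability at least $1-4\exp(-n\delta^2)$, the bounds $\|\hat\beta_{(k)}-\beta^*_{(k)}\|_2\le T^{(2)}_{n,q}(\delta)$ and $\|\hat\beta_{(k)}-\beta^*_{(k)}\|_1\le T^{(1)}_{n,q}(\delta)$ hold simultaneously; and likewise for each $k\in[K]$, $m\in[J]$, $\delta\in(0,1)$, the same two bounds hold simultaneously for $\hat\beta^{[-m]}_{(k)}-\beta^*_{(k)}$ with probability at least $1-4\exp(-n_{-1}\delta^2)$; (iv) $T_{n,q}\to0$ and $\xi_n^{-1}T_{n,q}\to0$ as $n\to\infty$. Then $$\frac{R(\hat w)-R_{Bayes}}{\inf_{w\in\mathcal W^K}R(w)-R_{Bayes}}=1+O_p(\xi_n^{-1}T_{n,q}).$$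 Furthermore, if $\xi_n^{-1}\sup_{w\in\mathcal W^K}|R(w)-R^*(w)|$ is uniformly integrable, then $$\frac{\bar R(\hat w)-R_{Bayes}}{\inf_{w\in\mathcal W^K}\bar R(w)-R_{Bayes}}=1+o_p(1),$$ where $\bar R(w)=\mathbb E R(w)$.
   Context: Notation: $[N]=\{1,\dots,N\}$; $\|v\|_0$ is the number of nonzero entries, $\|v\|_q=(\sum_j|v_j|^q)^{1/q}$ for $q\in(0,\infty)$; $\partial_\mu L$ is the derivative of $L(y,\mu)$ in $\mu$. For a random variable $u$, $\|u\|_{\psi_2}=\inf\{t>0:\mathbb E\exp(u^2/t^2)\le2\}$; for a random vector $V$, $\|V\|_{\psi_2}=\sup_{\|v\|_2=1}\|\langle V,v\rangle\|_{\psi_2}$. ''Constants'' do not depend on $n$; $p,K$, the index sets and the distribution may depend on $n$, and limits are as $n\to\infty$. Data: $(Y_i,\mathbf x_i)$, $1\le i\le n$, are i.i.d., $\mathbf x_i=(\mathrm x_{i1},\mathrm x_{i2},\dots)^\top$ infinite-dimensional, $Y_i=g(\sum_{j\ge1}\beta_j\mathrm x_{ij},\varepsilon_i)\in\mathcal Y$ with $g$ a known function, $\varepsilon_i$ independent of $\mathbf x_i$, $\boldsymbol\beta=(\beta_1,\beta_2,\dots)^\top$ unknown. $L:\mathcal Y\times\mathbb R\to\mathbb R$ is convex in the second argument, and $\boldsymbol\beta$ minimizes $\mathbb E L(Y_1,\sum_j\theta_j\mathrm x_{1j})$ over $\{\theta\in\mathbb R^{\mathbb N}:\sum_j\theta_j^2<\infty\}$.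 Observed covariates: $X_i=(\mathrm x_{i1},\dots,\mathrm x_{ip})^\top$. Candidate models: index sets $\mathcal A_k\subseteq[p]$, $k\in[K]$. With a coordinatewise-additive regularizer $r_\lambda(\beta)=\sum_{j=1}^pr_\lambda(\beta_j)$ and tuning parameters $\lambda_{n,k}$, $\lambda^{[-m]}_{n,k}$, $$\hat\beta_{(k)}=\operatorname{argmin}_{\beta\in\mathbb R^p,\ \beta_{\mathcal A_k^c}=0}\frac1n\sum_{i=1}^nL(Y_i,\langle\beta,X_i\rangle)+r_{\lambda_{n,k}}(\beta),\quad \hat B=(\hat\beta_{(1)},\dots,\hat\beta_{(K)}).$$ Split $[n]$ into a fixed number $J\ge2$ of folds $\mathcal I_1,\dots,\mathcal I_J$ of equal size $n_1=n/J$, $n_{-1}=n-n_1$, and let $$\hat\beta_{(k)}^{[-m]}=\operatorname{argmin}_{\beta\in\mathbb R^p,\ \beta_{\mathcal A_k^c}=0}\frac1{n_{-1}}\sum_{i\in[n]\setminus\mathcal I_m}L(Y_i,\langle\beta,X_i\rangle)+r_{\lambda^{[-m]}_{n,k}}(\beta),\quad \hat B^{[-m]}=(\hat\beta^{[-m]}_{(1)},\dots,\hat\beta^{[-m]}_{(K)}).$$ $\mathcal W^K=\{w\in[0,1]^K:\sum_kw_k=1\}$, $CV(w)=\sum_{m=1}^J\sum_{i\in\mathcal I_m}L(Y_i,\langle\hat B^{[-m]}w,X_i\rangle)$, and $\hat w\in\operatorname{argmin}_{w\in\mathcal W^K}CV(w)$. Pseudo-true values: $\beta^*_{(k)}=\operatorname{argmin}_{\beta\in\mathbb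 R^p,\beta_{\mathcal A_k^c}=0}\mathbb E L(Y_1,\langle\beta,X_1\rangle)$, $B^*=(\beta^*_{(1)},\dots,\beta^*_{(K)})$. Risks: $(Y_{n+1},\mathbf x_{n+1})$ is a new independent sample with the law of $(Y_1,\mathbf x_1)$, $X_{n+1}=(\mathrm x_{n+1,1},\dots,\mathrm x_{n+1,p})^\top$; $R(w)=\mathbb E[L(Y_{n+1},\langle\hat Bw,X_{n+1}\rangle)\mid\{(Y_i,X_i)\}_{i=1}^n]$, $R^*(w)=\mathbb E L(Y_{n+1},\langle B^*w,X_{n+1}\rangle)$, $R_{Bayes}=\mathbb E L(Y_{n+1},\sum_{j\ge1}\beta_j\mathrm x_{n+1,j})$, $\xi_n=\inf_{w\in\mathcal W^K}R^*(w)-R_{Bayes}$. $\bar R(\hat w)$ denotes the function $\bar R$ evaluated at $\hat w$. Rates: $p_u=\max_k|\mathcal A_k|$, $s_u=\max_k\|\beta^*_{(k)}\|_0$, $h_{q,u}=\max_k\|\beta^*_{(k)}\|_q$. With a positive constant $C_0$: for $q=0$, $T^{(2)}_{n,0}(\delta)=C_0\sqrt{s_u}(\delta+\sqrt{\log p_u/n})$, $T^{(1)}_{n,0}(\delta)=C_0s_u(\delta+\sqrt{\log p_u/n})$; for $q\in(0,1]$, $T^{(2)}_{n,q}(\delta)=C_0h_{q,u}^{q/2}(\delta+\sqrt{\log p_u/n})^{1-q/2}$, $T^{(1)}_{n,q}(\delta)=C_0h_{q,u}^q(\delta+\sqrt{\log p_u/n})^{1-q}$. Also $T_{n,0}=\sqrt{s_u}\sqrt{\log(pK)/n}$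 and $T_{n,q}=h_{q,u}^{q/2}(\log(pK)/n)^{1/2-q/4}$ for $q\in(0,1]$.
   Formalization: The formal theorem additionally assumes log(pK)/n → 0, which T_{n,q} → 0 implies unless s_u = 0 or h_{q,u} → 0; without it the claim fails, e.g. when q = 0, all pseudo-true values vanish and p = K is about exp(n). *)

(* Defs.v *)
From HB Require Import structures.
From mathcomp Require Import all_boot all_order all_algebra.
From mathcomp Require Import all_classical all_reals all_analysis measurable_realfun.

Set Implicit Arguments.
Unset Strict Implicit.
Unset Printing Implicit Defensive.

Import Order.TTheory GRing.Theory Num.Theory.
Import numFieldNormedType.Exports.

Local Open Scope classical_set_scope.
Local Open Scope ring_scope.

Section vectors.
Context {R : realType}.

Definition dotv (m : nat) (u v : 'cV[R]_m) : R := \sum_j u j 0 * v j 0.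

Definition l0norm (m : nat) (v : 'cV[R]_m) : nat := #|[set j | v j 0 != 0]%SET|.

Definition lqnorm (q : R) (m : nat) (v : 'cV[R]_m) : R :=
  (\sum_j `|v j 0| `^ q) `^ q^-1.

Definition supported (m : nat) (A : {set 'I_m}) : set 'cV[R]_m :=
  [set b | forall j, j \notin A -> b j 0 = 0].

Definition simplex (m : nat) : set 'cV[R]_m :=
  [set w | (forall k, 0 <= w k 0 <= 1) /\ \sum_k w k 0 = 1].

Definition lambda_min (m : nat) (S : 'M[R]_m) : R :=
  inf [set a | eigenvalue S a].

Definition is_argmin (T : Type) (D : set T) (f : T -> R) (t : T) : Prop :=
  D t /\ forall u, D u -> f t <= f u.

End vectors.

Section probability.
Context {R : realType} {d : measure_display} {T : measurableType d}.
Variable P : probability T R.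

(* The infimum is taken in the extended reals: it is +oo when u is not
   sub-gaussian. *)
Definition psi2_norm (u : T -> R) : \bar R :=
  ereal_inf [set t%:E | t in
    [set t : R | 0 < t /\
       (\int[P]_w (expR (u w ^+ 2 / t ^+ 2))%:E <= 2%:E)%E]].

Definition psi2_normv (m : nat) (V : T -> 'cV[R]_m) : \bar R :=
  ereal_sup [set psi2_norm (fun w => dotv (V w) v) | v in
    [set v : 'cV[R]_m | lqnorm 2 v = 1]].

Definition covariance_mx (m : nat) (V : T -> 'cV[R]_m) : 'M[R]_m :=
  \matrix_(j, l) fine (covariance P (fun w => V w j 0) (fun w => V w l 0)).

(* The expectation of f exists in [-oo, +oo]. *)
Definition has_mean (f : T -> R) : Prop :=
  (\int[P]_w ((fun v => (f v)%:E)^\+ w) < +oo \/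
   \int[P]_w ((fun v => (f v)%:E)^\- w) < +oo)%E.

(* t minimizes the expected value of f over D, the minimum being finite;
   parameters at which the expectation is undefined do not compete. *)
Definition is_mean_argmin (S : Type) (D : set S) (f : S -> T -> R) (t : S) :
    Prop :=
  [/\ D t, P.-integrable setT (EFin \o f t) &
      forall u, D u -> has_mean (f u) -> ('E_P[f t] <= 'E_P[f u])%E].

Definition cvg_in_prob (u : nat -> T -> R) (v : T -> R) : Prop :=
  forall e : R, 0 < e ->
    (fun N => P [set w | e <= `|u N w - v w|]) @ \oo --> 0%E.

(* v is (a version of) the random variable \sum_j theta_j x_j; the series is
   only required to converge in probability, the weakest of the usual modes. *)
Definition is_series (x : nat -> T -> R) (theta : nat -> R) (v : T -> R) :
    Prop :=
  measurable_fun setT v /\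
  cvg_in_prob (fun N w => \sum_(0 <= j < N) theta j * x j w) v.

Definition independent_family (I : finType) (F : I -> set_system T) : Prop :=
  forall (J : {set I}) (A : I -> set T), (forall i, i \in J -> F i (A i)) ->
    P (\bigcap_(i in [set` J]) A i) = (\prod_(i in J) P (A i))%E.

Definition independent2 (F G : set_system T) : Prop :=
  forall A B, F A -> G B -> P (A `&` B) = (P A * P B)%E.

(* g is a version of the conditional expectation of the integrable variable f
   given the sigma-algebra G. *)
Definition is_cond_exp (G : set_system T) (f g : T -> R) : Prop :=
  [/\ forall B, measurable B -> G (g @^-1` B),
      P.-integrable setT (EFin \o g) &
      forall A, G A -> (\int[P]_(w in A) (f w)%:E = \int[P]_(w in A) (g w)%:E)%E].

(* E contains an event of probability at least c (for an event E this is
   c <= P E). *)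
Definition prob_ge (c : R) (E : set T) : Prop :=
  exists B, [/\ measurable B, B `<=` E & (c%:E <= P B)%E].

End probability.

Section freezing.
Context {R : realType} {d d1 d2 : measure_display}.
Context {T : measurableType d} {T1 : measurableType d1} {T2 : measurableType d2}.
Variables (P : probability T R) (D : {mfun T >-> T1}) (Z : {mfun T >-> T2}).
Hypothesis indep : forall A B, measurable A -> measurable B ->
  P (D @^-1` A `&` Z @^-1` B) = (P (D @^-1` A) * P (Z @^-1` B))%E.

Let DZ (w : T) : T1 * T2 := (D w, Z w).
Let mDZ : measurable_fun setT DZ.
Proof. exact: measurable_fun_pair. Qed.
HB.instance Definition _ := isMeasurableFun.Build _ _ _ _ DZ mDZ.

Let joint (X : set (T1 * T2)) : measurable X ->
  (distribution P D \x distribution P Z)%E X = distribution P DZ X.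
Proof.
apply: product_measure_unique => A B mA mB /=.
by rewrite /pushforward -indep.
Qed.

Let integral_law d' (T' : measurableType d') (U : {mfun T >-> T'})
    (h : T' -> \bar R) : measurable_fun [set: T'] h ->
  (\int[distribution P U]_x h x = \int[P]_w h (U w))%E.
Proof.
move=> mh; have mU : measurable_fun setT U by [].
rewrite integralE [RHS]integralE; congr (_ - _)%E.
  rewrite (ge0_integral_pushforward mU) //; last exact: measurable_funepos.
  by rewrite preimage_setT -funepos_comp.
rewrite (ge0_integral_pushforward mU) //; last exact: measurable_funeneg.
by rewrite preimage_setT -funeneg_comp.
Qed.

Let integral_joint (h : T1 * T2 -> \bar R) : measurable_fun setT h ->
  (\int[(distribution P D \x distribution P Z)%E]_x h x =
   \int[P]_w h (D w, Z w))%E.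
Proof.
move=> mh; rewrite -(integral_law DZ) //.
by apply: eq_measure_integral => A mA _; exact: joint.
Qed.

Let freeze_ae (h : T1 * T2 -> \bar R) : measurable_fun setT h ->
  P.-integrable setT (fun w => h (D w, Z w)) ->
  let F x := (\int[P]_w h (x, Z w))%E in
  [/\ measurable_fun setT F, P.-integrable setT (F \o D) &
      (\int[P]_w h (D w, Z w) = \int[P]_w F (D w))%E].
Proof.
move=> mh ih F.
have ih' : (distribution P D \x distribution P Z)%E.-integrable setT h.
  apply/integrableP; split => //.
  rewrite (integral_joint (h := abse \o h)); first by move/integrableP : ih => [].
  exact: measurableT_comp.
have FE : F = fubini_F (distribution P Z) h.
  apply/funext => x; rewrite /F /fubini_F integral_law//.
  exact: measurableT_comp.
have mF : measurable_fun setT F by rewrite FE; exact: measurable_fubini_F ih'.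
split => //.
- apply/integrableP; split; first exact: measurableT_comp.
  have /integrableP[_] := integrable_fubini_F ih'.
  by rewrite -FE (integral_law D (h := abse \o F)) //; exact: measurableT_comp.
- by rewrite -integral_joint// -integral12_prod_meas1// -FE integral_law.
Qed.

Lemma freezing (f : T1 -> T2 -> R) :
    measurable_fun setT (fun z : T1 * T2 => f z.1 z.2) ->
    P.-integrable setT (fun w => (f (D w) (Z w))%:E) ->
  let F x := \int[P]_w f x (Z w) in
  [/\ measurable_fun setT F,
      P.-integrable setT (fun w => (F (D w))%:E) &
      forall A, measurable A ->
        (\int[P]_(w in D @^-1` A) (f (D w) (Z w))%:E =
         \int[P]_(w in D @^-1` A) (F (D w))%:E)%E].
Proof.
move=> mf intf F.
pose h (z : T1 * T2) := (f z.1 z.2)%:E.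
have mh : measurable_fun setT h by exact/measurable_EFinP.
have [mG iG _] := freeze_ae mh intf.
set G := (fun x => _) in mG iG.
have FE : F = fine \o G by [].
have mF : measurable_fun setT F by rewrite FE; exact: measurableT_comp.
have aeFG : ae_eq P setT (fun w => (F (D w))%:E) (G \o D).
  have := integrable_ae measurableT iG.
  apply: filterS => w /= /(_ I) fin _.
  by rewrite FE /= fineK.
have mFD : measurable_fun setT (fun w => (F (D w))%:E).
  by apply/measurable_EFinP; exact: measurableT_comp.
have mGD : measurable_fun setT (G \o D) by exact: measurableT_comp.
split => //.
- apply/integrableP; split => //.
  rewrite (ae_eq_integral (abse \o (G \o D))) //; first by move/integrableP : iG => [].
  + exact: measurableT_comp.
  + exact: measurableT_comp.
  + by apply: filterS aeFG => w FG _; exact: (congr1 abse (FG I)).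
- move=> A mA.
  have mDA : measurable (D @^-1` A) by rewrite -[X in measurable X]setTI; exact: measurable_funP.
  pose hA (z : T1 * T2) := ((\1_A z.1)%:E * h z)%E.
  have mhA : measurable_fun setT hA.
    apply: emeasurable_funM => //; apply/measurable_EFinP.
    by apply: measurableT_comp => //; exact: measurable_indic.
  have restr (k : T -> \bar R) : (\int[P]_(w in D @^-1` A) k w =
      \int[P]_w ((\1_A (D w))%:E * k w))%E.
    rewrite integral_mkcond; apply: eq_integral => w _.
    rewrite patchE indicE (_ : (w \in D @^-1` A) = (D w \in A)).
      by case: (D w \in A); rewrite ?mul1e ?mul0e.
    by apply/idP/idP => /set_mem ?; exact/mem_set.
  have ihA : P.-integrable setT (fun w => hA (D w, Z w)).
    apply: (le_integrable measurableT _ _ intf); first exact: measurableT_comp.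
    move=> w _; rewrite /hA /= indicE; case: (_ \in _).
      by rewrite mul1r.
    by rewrite mul0r normr0 lee_fin.
  have [_ _ E] := freeze_ae mhA ihA.
  rewrite restr [LHS]E restr.
  apply: ae_eq_integral => //.
  + have [m _ _] := freeze_ae mhA ihA.
    by apply: measurableT_comp m _.
  + apply: emeasurable_funM => //; apply/measurable_EFinP.
    by apply: measurableT_comp => //; exact: measurable_indic.
  + apply: filterS aeFG => w /= /(_ I) FG _; rewrite FG /G.
    rewrite /hA /= indicE; case: (_ \in _); last by rewrite mul0e integral0_eq// => x _; rewrite mul0e.
    by rewrite mul1e; apply: eq_integral => x _; rewrite mul1e.
Qed.
End freezing.

Section grouping.
Context {R : realType} {d : measure_display} {T : measurableType d}.
Variables (P : probability T R) (n : nat) (F : 'I_n.+1 -> set_system T).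
Hypotheses (FT : forall i, F i setT) (FI : forall i, setI_closed (F i)).
Hypotheses (Fm : forall i, F i `<=` measurable) (iF : independent_family P F).

Lemma independent_ord_max :
  independent2 P <<s \bigcup_i F (widen_ord (leqnSn n) i) >> (F ord_max).
Proof.
pose wi := widen_ord (leqnSn n).
have wi_max (i : 'I_n) : (wi i == ord_max) = false.
  by apply/negbTE; rewrite -val_eqE /= ltn_eqF.
pose G := [set C | exists2 A : 'I_n.+1 -> set T, (forall i, F i (A i)) &
  C = \bigcap_i A (wi i)].
have Gm : G `<=` measurable.
  move=> _ [A FA ->]; apply: fin_bigcap_measurable => //= i _.
  exact: Fm (FA _).
have GI : setI_closed G.
  move=> _ _ [A FA ->] [B FB ->]; exists (fun i => A i `&` B i).
    by move=> i; exact: FI.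
  by rewrite bigcapI.
have GT : G setT by exists (fun=> setT) => //; apply/esym/seteqP; split.
have sub : <<s \bigcup_i F (wi i) >> `<=` <<s G >>.
  apply: smallest_sub; first exact: smallest_sigma_algebra.
  move=> C [i _ FC]; apply: sub_sigma_algebra.
  exists (fun k => if k == wi i then C else setT).
    by move=> k; case: eqP => [->|_].
  apply/seteqP; split => [x Cx k _|x /(_ i I)]; first by case: eqP.
  by rewrite eqxx.
move=> A B /sub GA FB; have mB := Fm FB.
have PB0 : (0 <= fine (P B))%R by exact: fine_ge0.
have PBE : P B = (fine (P B))%:E by rewrite fineK // fin_num_measure.
have E C : mscale (NngNum PB0) P C = (P C * P B)%E.
  by rewrite /mscale /= -PBE muleC.
suff: mrestr P mB A = mscale (NngNum PB0) P A by move=> h; rewrite -[LHS]/(mrestr P mB A) h; exact: E.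
apply: (@g_sigma_algebra_measure_unique _ _ _ G Gm (fun=> setT) (fun=> GT)) => //.
- by rewrite bigcup_const.
- move=> _ [C FC ->]; apply: etrans (esym (E _)); rewrite /mrestr /=.
  pose D i := if i == ord_max then B else C i.
  have FD i : F i (D i) by rewrite /D; case: eqP => [->|].
  have E1 : \bigcap_i C (wi i) `&` B = \bigcap_(i in [set` [set: 'I_n.+1]%SET]) D i.
    apply/seteqP; split => [x [Cx Bx] i _|x Dx].
      rewrite /D; case: (unliftP ord_max i) => [j ->|->]; last by rewrite eqxx.
      have -> : lift ord_max j = wi j by apply/val_inj; rewrite /= /bump leqNgt ltn_ord.
      by rewrite wi_max; exact: Cx.
    split; last by have := Dx ord_max; rewrite /D eqxx /= inE; exact.
    by move=> i _; have := Dx (wi i); rewrite /D wi_max /= inE; exact.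
  have E2 : \bigcap_i C (wi i) =
      \bigcap_(i in [set` (~: [set ord_max])%SET]) D i.
    apply/seteqP; split => [x Cx i|x Dx i _].
      rewrite /= !inE => im; rewrite /D (negbTE im).
      case: (unliftP ord_max i) im => [j ->|->]; last by rewrite eqxx.
      have -> : lift ord_max j = wi j by apply/val_inj; rewrite /= /bump leqNgt ltn_ord.
      by move=> _; exact: Cx.
    by have := Dx (wi i); rewrite /D /= !inE wi_max; exact.
  rewrite -[LHS]/(P (_ `&` B)) E1 iF// E2 iF// (bigD1 ord_max) ?inE//=.
  rewrite muleC /D eqxx; congr (_ * _)%E.
  by apply: eq_bigl => i; rewrite !inE.
- move=> _; rewrite -[X in (X < _)%E]/(P (setT `&` B)) setTI.
  by rewrite (le_lt_trans (probability_le1 _ _)) ?ltry.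
Qed.

End grouping.

Section asymptotics.
Context {R : realType}.
Variables (d : nat -> measure_display) (T : forall n, measurableType (d n)).
Variable P : forall n, probability (T n) R.
Variable F : set_system nat.

Definition is_Op (Z : forall n, T n -> R) (a : nat -> R) : Prop :=
  forall e : R, 0 < e -> exists2 M : R, 0 < M &
    \forall n \near F, prob_ge (P n) (1 - e) [set w | `|Z n w| <= M * a n].

Definition is_op1 (Z : forall n, T n -> R) : Prop :=
  forall e : R, 0 < e -> forall c : R, 0 < c ->
    \forall n \near F, prob_ge (P n) (1 - e) [set w | `|Z n w| <= c].

Definition uniformly_integrable (D : set nat) (U : forall n, T n -> R) : Prop :=
  forall e : R, 0 < e -> exists M : R, forall n, D n ->
    (\int[P n]_(w in [set w | (M < `|U n w|)%R]) `|U n w|%:E <= e%:E)%E.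

End asymptotics.

Section averaging.
Context {R : realType} {dY dE : measure_display}.
Variables (Y : measurableType dY) (E : measurableType dE).

(* All objects attached to one sample size n. Observations are numbered from
   0 to n: those below n are the sample, the last one is the new observation.
   Coordinates, models and folds are numbered from 0 as well. *)
Record experiment (J n : nat) := Experiment {
  disp : measure_display;
  Om : measurableType disp;
  Pr : probability Om R;
  y_ : 'I_n.+1 -> Om -> Y;
  x_ : 'I_n.+1 -> nat -> Om -> R;
  eps_ : 'I_n.+1 -> Om -> E;
  beta : nat -> R;
  mu_ : 'I_n.+1 -> Om -> R;            (* \sum_j beta_j x_ij *)
  p : nat;
  K : nat;
  A : 'I_K -> {set 'I_p};
  fold : 'I_n -> 'I_J;                 (* i lies in the fold I_(fold i) *)
  lam : 'I_K -> R;
  lamcv : 'I_J -> 'I_K -> R;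
  bhat : 'I_K -> Om -> 'cV[R]_p;
  bcv : 'I_J -> 'I_K -> Om -> 'cV[R]_p;
  bstar : 'I_K -> 'cV[R]_p;
  what : Om -> 'cV[R]_K
}.

Variables (g : R -> E -> Y) (L : Y -> R -> R) (r : R -> R -> R).

Section one_experiment.
Context {J n : nat}.
Variable S : experiment J n.

Definition train (i : 'I_n) : 'I_n.+1 := widen_ord (leqnSn n) i.
Definition new : 'I_n.+1 := ord_max.
Definition first : 'I_n.+1 := ord0.

Definition X_ (i : 'I_n.+1) (w : Om S) : 'cV[R]_(p S) := \col_j x_ i j w.

Definition obs_gen (i : 'I_n.+1) : set_system (Om S) :=
  [set C | exists2 B, measurable B & C = y_ i @^-1` B] `|`
  [set C | exists j, exists2 B, measurable B & C = x_ i j @^-1` B].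

Definition obs_sigma (i : 'I_n.+1) : set_system (Om S) := <<s obs_gen i >>.

Definition cov_sigma (i : 'I_n.+1) : set_system (Om S) :=
  <<s [set C | exists j, exists2 B, measurable B & C = x_ i j @^-1` B] >>.

Definition noise_sigma (i : 'I_n.+1) : set_system (Om S) :=
  [set C | exists2 B, measurable B & C = eps_ i @^-1` B].

Definition data_gen : set_system (Om S) :=
  [set C | exists i : 'I_n, exists2 B, measurable B &
             C = y_ (train i) @^-1` B] `|`
  [set C | exists i : 'I_n, exists j : 'I_(p S), exists2 B, measurable B &
             C = x_ (train i) j @^-1` B].

Definition data_sigma : set_system (Om S) := <<s data_gen >>.

Definition iid_sample : Prop :=
  [/\ forall i, measurable_fun setT (y_ (e:=S) i),
      forall i j, measurable_fun setT (x_ (e:=S) i j),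
      independent_family (Pr S) obs_sigma &
      (* equality of the laws on cylinders, which determine them *)
      forall i (N : nat) (B : set Y) (C : nat -> set R),
        measurable B -> (forall j, measurable (C j)) ->
        Pr S (y_ i @^-1` B `&` \bigcap_(j < N) (x_ i j @^-1` C j)) =
        Pr S (y_ first @^-1` B `&` \bigcap_(j < N) (x_ first j @^-1` C j))].

Definition response_model : Prop :=
  forall i,
    [/\ measurable_fun setT (eps_ (e:=S) i),
        independent2 (Pr S) (noise_sigma i) (cov_sigma i),
        is_series (Pr S) (x_ i) (beta S) (mu_ i) &
        {ae Pr S, forall w, y_ i w = g (mu_ i w) (eps_ i w)}].

(* The competitors are the square summable theta together with a version of
   \sum_j theta_j x_1j. *)
Definition beta_minimizes : Prop :=
  is_mean_argmin (Pr S)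
    [set tv : (nat -> R) * (Om S -> R) |
       cvgn (series (fun j => tv.1 j ^+ 2)) /\
       is_series (Pr S) (x_ first) tv.1 tv.2]
    (fun tv w => L (y_ first w) (tv.2 w))
    (beta S, mu_ first).

Definition objective (I : {set 'I_n}) (l : R) (w : Om S) (b : 'cV[R]_(p S)) :
    R :=
  #|I|%:R^-1 * (\sum_(i in I) L (y_ (train i) w) (dotv b (X_ (train i) w)))
  + \sum_j r l (b j 0).

Definition fold_set (m : 'I_J) : {set 'I_n} := [set i | fold S i == m]%SET.

Definition equal_folds : Prop := forall m, #|fold_set m| = (n %/ J)%N.

Definition n_train : nat := (n - n %/ J)%N.

Definition estimators : Prop :=
  forall k w,
    is_argmin (supported (A k)) (objective [set: 'I_n]%SET (lam k) w) (bhat k w).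

Definition cv_estimators : Prop :=
  forall m k w,
    is_argmin (supported (A k)) (objective (~: fold_set m)%SET (lamcv m k) w)
      (bcv m k w).

(* bhat has to be a function of the sample for [risk] to be a conditional
   expectation given the sample; bcv and what need only be random vectors. *)
Definition measurable_estimators : Prop :=
  [/\ forall k j B, measurable B -> data_sigma ((fun w => bhat k w j 0) @^-1` B),
      forall m k j, measurable_fun setT (fun w => bcv (e:=S) m k w j 0) &
      forall k, measurable_fun setT (fun w => what (e:=S) w k 0)].

Definition pseudo_true : Prop :=
  forall k,
    is_mean_argmin (Pr S) (supported (A k))
      (fun b w => L (y_ first w) (dotv b (X_ first w))) (bstar k).

Definition Bhat (w : Om S) : 'M[R]_(p S, K S) := \matrix_(j, k) bhat k w j 0.

Definition Bcv (m : 'I_J) (w : Om S) : 'M[R]_(p S, K S) :=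
  \matrix_(j, k) bcv m k w j 0.

Definition Bstar : 'M[R]_(p S, K S) := \matrix_(j, k) bstar k j 0.

Definition CV (w : Om S) (v : 'cV[R]_(K S)) : R :=
  \sum_m \sum_(i in fold_set m)
    L (y_ (train i) w) (dotv (Bcv m w *m v) (X_ (train i) w)).

Definition cv_weights : Prop :=
  forall w, is_argmin (simplex (m:=K S)) (CV w) (what w).

(* Conditional expectation, given the sample, of the loss incurred by
   Bhat *m v at the new observation: the sample is frozen at w and the new
   observation, independent of it, is integrated out.  Fixing this version
   for all v simultaneously is what gives a meaning to R(\hat w) and to
   inf_v R(v); see [risk_is_cond_exp]. *)
Definition risk (v : 'cV[R]_(K S)) (w : Om S) : R :=
  \int[Pr S]_w' L (y_ new w') (dotv (Bhat w *m v) (X_ new w')).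

Lemma risk_is_cond_exp (v : 'cV[R]_(K S)) :
    measurable_fun setT (fun z : Y * R => L z.1 z.2) ->
    iid_sample -> measurable_estimators ->
  let loss w := L (y_ new w) (dotv (Bhat w *m v) (X_ new w)) in
  (Pr S).-integrable setT (EFin \o loss) ->
  is_cond_exp (Pr S) data_sigma loss (risk v).
Proof.
move=> mL [my mx iF _] [mb _ _] loss iloss.
have mgen i : obs_gen i `<=` measurable.
  move=> _ [[B mB ->]|[j [B mB ->]]]; rewrite -[X in measurable X]setTI.
    exact: my.
  exact: mx.
have dgen : data_gen `<=` measurable.
  move=> _ [[i [B mB ->]]|[i [j [B mB ->]]]]; rewrite -[X in measurable X]setTI.
    exact: my.
  exact: mx.
pose T1 := g_sigma_algebraType data_gen.
pose T2 := g_sigma_algebraType (obs_gen new).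
have mid (G : set_system (Om S)) : G `<=` measurable ->
    measurable_fun setT (fun w : Om S => (w : g_sigma_algebraType G)).
  move=> Gm _ A mA; rewrite setTI preimage_id.
  by move: A mA; apply: smallest_sub => //; exact: sigma_algebra_measurable.
pose D : {mfun Om S >-> T1} :=
  HB.pack (fun w : Om S => (w : T1)) (isMeasurableFun.Build _ _ _ _ _ (mid _ dgen)).
pose Z : {mfun Om S >-> T2} :=
  HB.pack (fun w : Om S => (w : T2))
    (isMeasurableFun.Build _ _ _ _ _ (mid _ (mgen new))).
have indep A B : measurable A -> measurable B ->
    Pr S (D @^-1` A `&` Z @^-1` B) = (Pr S (D @^-1` A) * Pr S (Z @^-1` B))%E.
  move=> mA mB; rewrite !preimage_id.
  apply: (@independent_ord_max _ _ _ _ _ obs_sigma) => //.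
  - by move=> i; exact: (@measurableT _ (g_sigma_algebraType (obs_gen i))).
  - by move=> i; exact: (@measurableI _ (g_sigma_algebraType (obs_gen i))).
  - move=> i; apply: smallest_sub (mgen i).
    exact: sigma_algebra_measurable.
  - move: A mA; apply: smallest_sub; first exact: smallest_sigma_algebra.
    move=> C [[i [B' mB' ->]]|[i [j [B' mB' ->]]]]; apply: sub_sigma_algebra;
      exists i => //; apply: sub_sigma_algebra.
      by left; exists B'.
    by right; exists j; exists B'.
pose f (w : T1) (w' : T2) : R :=
  L (y_ new w') (dotv (Bhat (w : Om S) *m v) (X_ new w')).
have mf : measurable_fun [set: T1 * T2] (fun z : T1 * T2 => f z.1 z.2).
  have m1 (h : T1 -> R) : measurable_fun setT h ->
      measurable_fun setT (fun z : T1 * T2 => h z.1).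
    by move=> mh; exact: measurableT_comp.
  have m2 (h : T2 -> R) : measurable_fun setT h ->
      measurable_fun setT (fun z : T1 * T2 => h z.2).
    by move=> mh; exact: measurableT_comp.
  pose h (z : T1 * T2) : Y * R :=
    (y_ new z.2, dotv (Bhat (z.1 : Om S) *m v) (X_ new z.2)).
  rewrite (_ : (fun z => _) = (fun z : Y * R => L z.1 z.2) \o h) //.
  apply: measurableT_comp mL _; apply: measurable_fun_pair => /=.
    rewrite (_ : (fun z => _) = (fun w : T2 => y_ new w) \o snd) //.
    apply: measurableT_comp measurable_snd.
    move=> _ B mB; rewrite setTI; apply: sub_sigma_algebra; left.
    by exists B.
  rewrite /dotv; apply: measurable_sum => j; apply: measurable_funM.
    under eq_fun do rewrite mxE.
    apply: measurable_sum => k; apply: measurable_funM => //.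
    under eq_fun do rewrite mxE.
    apply: (m1 (fun w : T1 => bhat k (w : Om S) j 0)) => _ B mB.
    by rewrite setTI; exact: mb.
  under eq_fun do rewrite mxE.
  apply: (m2 (fun w : T2 => x_ new j (w : Om S))) => _ B mB.
  rewrite setTI; apply: sub_sigma_algebra; right.
  by exists (j : nat), B.
have [mF iF' EF] := freezing indep mf iloss.
split => //.
by move=> B mB; have := mF measurableT B mB; rewrite setTI.
Qed.

Definition risk_star (v : 'cV[R]_(K S)) : R :=
  \int[Pr S]_w L (y_ new w) (dotv (Bstar *m v) (X_ new w)).

Definition risk_mean (v : 'cV[R]_(K S)) : R := \int[Pr S]_w risk v w.

Definition risk_bayes : R := \int[Pr S]_w L (y_ new w) (mu_ new w).

Definition xi : R := inf [set risk_star v | v in simplex (m:=K S)] - risk_bayes.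

Definition risk_dev (w : Om S) : R :=
  sup [set `|risk v w - risk_star v| | v in simplex (m:=K S)].

Definition risk_ratio (w : Om S) : R :=
  (risk (what w) w - risk_bayes) /
  (inf [set risk v w | v in simplex (m:=K S)] - risk_bayes).

Definition risk_mean_ratio (w : Om S) : R :=
  (risk_mean (what w) - risk_bayes) /
  (inf [set risk_mean v | v in simplex (m:=K S)] - risk_bayes).

Definition p_u : nat := \max_k #|A (e:=S) k|.

Definition s_u : nat := \max_k l0norm (bstar (e:=S) k).

Definition h_u (q : R) : R := \big[Num.max/0]_k lqnorm q (bstar (e:=S) k).

Definition rate2 (C0 q delta : R) : R :=
  let t := delta + Num.sqrt (ln p_u%:R / n%:R) in
  if q == 0 then C0 * Num.sqrt s_u%:R * t
  else C0 * h_u q `^ (q / 2) * t `^ (1 - q / 2).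

Definition rate1 (C0 q delta : R) : R :=
  let t := delta + Num.sqrt (ln p_u%:R / n%:R) in
  if q == 0 then C0 * s_u%:R * t
  else C0 * h_u q `^ q * t `^ (1 - q).

Definition rate (q : R) : R :=
  let t := ln (p S * K S)%:R / n%:R in
  if q == 0 then Num.sqrt s_u%:R * Num.sqrt t
  else h_u q `^ (q / 2) * t `^ (1 / 2 - q / 4).

Definition within_rates (C0 q delta : R) (k : 'I_(K S)) (b : 'cV[R]_(p S)) :
    Prop :=
  lqnorm 2 (b - bstar k) <= rate2 C0 q delta /\
  lqnorm 1 (b - bstar k) <= rate1 C0 q delta.

End one_experiment.
End averaging.

Arguments X_ {R dY dE Y E J n} S i w.
Arguments n_train J n : clear implicits.
Arguments Bhat {R dY dE Y E J n} S w.
Arguments Bcv {R dY dE Y E J n} S m w.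
Arguments CV {R dY dE Y E} L {J n} S w v.
Arguments risk {R dY dE Y E} L {J n} S v w.
Arguments risk_star {R dY dE Y E} L {J n} S v.
Arguments risk_mean {R dY dE Y E} L {J n} S v.
Arguments risk_dev {R dY dE Y E} L {J n} S w.
Arguments risk_ratio {R dY dE Y E} L {J n} S w.
Arguments risk_mean_ratio {R dY dE Y E} L {J n} S w.
Arguments within_rates {R dY dE Y E J n} S C0 q delta k b.

(* n ranges over the positive multiples of the number J of folds. *)
Definition admissible (J : nat) : set nat := [set n | (0 < n)%N /\ (J %| n)%N].

Definition to_infty (J : nat) : set_system nat := within (admissible J) \oo.

(* Main.v *)
(* On an event of probability at least 1 - c exp(-a), the risk R(w) and, up to
   an additive random variable free of w, the criterion CV(w) / n both lie
   within C T_n of R*(w), uniformly over the simplex.  Hence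
   R(what) <= inf R + 4 C T_n, and dividing by xi_n gives the first claim.
   - Replacing the estimators by the pseudo-true values costs O(T_n), provided
     that sum_i <D, X_i>^2 = O(n |D|_2^2 + log(pK) |D|_1^2) uniformly in D.
     Maurey's argument reduces this to sums of few signed coordinate vectors,
     for which a Chernoff bound and a union bound suffice.
   - The empirical process at B* w is a quadratic polynomial in w for the square
     loss, and Bernstein's inequality is applied to its coefficients.  For a
     Lipschitz loss, symmetrization and contraction dominate it by a linear
     process, whose maximum over the simplex is attained at a vertex.
   For the averaged risk, uniform integrability turns the first estimate into
   sup_w |E R(w) - R*(w)| = o(xi_n).  When K = 1, log(pK) may vanish, so that
   these bounds fail, but then the simplex is a point and both ratios are 1. *)
Require Import Defs.
From HB Require Import structures.
From mathcomp Require Import all_boot all_order all_algebra.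
From mathcomp Require Import all_classical all_reals all_analysis.
From mathcomp Require Import measurable_realfun ring lra.
Import Order.TTheory GRing.Theory Num.Theory.
Import numFieldNormedType.Exports.
Set Implicit Arguments.
Unset Strict Implicit.
Unset Printing Implicit Defensive.
Local Open Scope classical_set_scope.
Local Open Scope ring_scope.

(** The rate carries a factor sqrt H, where H is s_u or h_{q,u}^q, which vanishes with the
    pseudo-true vectors, unlike sqrt(log(pK)/n). Hence the process at B* w has to be scaled by the
    largest norm sigma of a pseudo-true vector, and to be centred at the loss of the zero predictor,
    whose fluctuation has no such factor: this is the random variable free of w. The link with H is
    |b_j|^2 <= K_beta^(2-q) |b_j|^q for the entries of a pseudo-true vector, whence sigma^2 = O(H).
    The union bound over the models forces n delta^2 to be of order log(pK) + a. With this delta,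
    the l2 rate is O(T_n), and the l1 rate enters only through |D|_1^2 log(pK)/n = O(T_n^4), which
    is what Maurey's remainder asks for. Both types of loss satisfy |L(y,x) - L(y,b)| <= t (G(y)^2 +
    b^2) + (1/t + 1)(x - b)^2 for every t > 0. Since the error x - b has mean square O(T_n^2), the
    choice of t proportional to T_n makes both terms O(T_n), and only second moments have to be
    controlled. *)

Section real_inequalities.
Context {R : realType}.
Implicit Types x y t : R.

(** Chord of the convex exponential between 0 and x. It turns E exp U <= 2 into E exp(t U) <= 1 +
    t. *)
Lemma expR_convex_le1 t x : 0 <= t <= 1 -> expR (t * x) <= 1 + t * (expR x - 1).
Proof.
move=> t01; have := convex_expR (Itv01 (andP t01).1 (andP t01).2) x 0.
rewrite !convRE /= mulr0 addr0 expR0 mulr1 => h.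
by apply: le_trans h _; rewrite /unstable.onem; lra.
Qed.

Lemma expR_le_quadratic x : expR x <= 1 + x + 4 * (x ^+ 2 * expR `|x|).
Proof.
have [x12|x12] := leP x (1 / 2).
  have ex : expR x * (1 - x) <= 1.
    have := expR_ge1Dx (- x); rewrite expRN => h.
    by rewrite mulrC -ler_pdivlMr ?expR_gt0// mul1r.
  have e1 : 1 <= expR `|x| by rewrite -expR0 ler_expR.
  have h : x ^+ 2 <= x ^+ 2 * expR `|x| by rewrite ler_peMr ?sqr_ge0.
  have e0 := expR_gt0 x.
  by have x0 := sqr_ge0 x; nra.
(* Beyond 1/2 the factor 4 x^2 alone exceeds 1, which fixes the constant 4. *)
have h : 1 <= 4 * x ^+ 2 by nra.
rewrite gtr0_norm; last by lra.
rewrite mulrA; have e0 := expR_gt0 x; nra.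
Qed.

(** Up to 1/2 both exponentials satisfy exp z <= 1 + z + 2 z^2 and the linear terms cancel; beyond
    1/2 it is enough that y <= 2 y^2. *)
Lemma cosh_le_expR x : (expR x + expR (- x)) / 2 <= expR (2 * x ^+ 2).
Proof.
suff h (z : R) : 0 <= z -> (expR z + expR (- z)) / 2 <= expR (2 * z ^+ 2).
  have [x0|x0] := leP 0 x; first exact: h.
  by have := h (- x); rewrite opprK sqrrN addrC; apply; lra.
move: z => y y0; have [y12|y12] := leP y (1 / 2).
  have inv (z : R) : `|z| <= 1 / 2 -> expR z <= 1 + z + 2 * z ^+ 2.
    move=> /ler_normlP[z1 z2].
    have := expR_ge1Dx (- z); rewrite expRN => h.
    have h2 : expR z * (1 - z) <= 1.
      by rewrite mulrC -ler_pdivlMr ?expR_gt0// mul1r.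
    rewrite -(@ler_pM2r _ (1 - z)); last lra.
    apply: le_trans h2 _; have := sqr_ge0 z; rewrite !expr2; nra.
  have ey := inv y; rewrite ger0_norm// in ey.
  have eny := inv (- y); rewrite normrN ger0_norm// sqrrN in eny.
  have := expR_ge1Dx (2 * y ^+ 2).
  have := ey y12; have := eny y12; lra.
have : expR (- y) <= expR y by rewrite ler_expR; lra.
have : expR y <= expR (2 * y ^+ 2) by rewrite ler_expR; nra.
lra.
Qed.

Lemma sqr_le_expR_half y : 0 <= y -> y ^+ 2 <= 16 * expR (y / 2).
Proof.
move=> y0; have h := expR_ge1Dx (y / 4).
have -> : y / 2 = y / 4 + y / 4 by lra.
rewrite expRD; have := expR_gt0 (y / 4); rewrite expr2; nra.
Qed.

Lemma abs_le_expR_sqr x : `|x| <= expR (x ^+ 2).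
Proof.
apply: (@le_trans _ _ (1 + x ^+ 2)); last exact: expR_ge1Dx.
by rewrite -[x ^+ 2]real_normK ?num_real//; have := normr_ge0 x; nra.
Qed.

End real_inequalities.

(** * Events of large inner probability and independent draws *)

Section inner_probability.
Context {R : realType} {d : measure_display} {T : measurableType d}.
Variable P : probability T R.
Implicit Types (a b c x : R) (E F : set T).

Lemma prob_ge_measurable c E : measurable E -> (c%:E <= P E)%E -> prob_ge P c E.
Proof. by move=> mE PE; exists E; split. Qed.

Lemma prob_geS c E F : E `<=` F -> prob_ge P c E -> prob_ge P c F.
Proof. by move=> EF [B [mB BE PB]]; exists B; split => //; exact: subset_trans EF. Qed.

Lemma prob_ge_le b c E : c <= b -> prob_ge P b E -> prob_ge P c E.
Proof.
move=> cb [B [mB BE PB]]; exists B; split => //.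
by apply: le_trans PB; rewrite lee_fin.
Qed.

Lemma prob_geT E : (forall w, E w) -> prob_ge P 1 E.
Proof.
move=> ET; exists setT; split; [by []|by move=> w _; exact: ET|].
by rewrite probability_setT.
Qed.

Lemma prob_ge_setC c B : measurable B -> (P B <= c%:E)%E -> prob_ge P (1 - c) (~` B).
Proof.
move=> mB PB; exists (~` B); split => //; first exact: measurableC.
rewrite probability_setC//.
rewrite -(fineK (fin_num_measure P B mB)) in PB *.
by rewrite -EFinB lee_fin lerB.
Qed.

(** In terms of failure probabilities the union bound is additive, so that bounds 1 - c exp(-a)
    combine by adding the constants c. *)
Lemma prob_geI a b E F : prob_ge P (1 - a) E -> prob_ge P (1 - b) F ->
  prob_ge P (1 - (a + b)) (E `&` F).
Proof.
move=> [A [mA AE PA]] [B [mB BF PB]].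
have : prob_ge P (1 - (a + b)) (~` (~` A `|` ~` B)).
  apply: prob_ge_setC; first by apply: measurableU; exact: measurableC.
  apply: le_trans (measureU2 _ _ _) _; [exact: measurableC|exact: measurableC|].
  have h (C : set T) c : measurable C -> ((1 - c)%:E <= P C)%E -> (P (~` C) <= c%:E)%E.
    move=> mC; rewrite probability_setC// -(fineK (fin_num_measure P C mC)).
    by rewrite -EFinB !lee_fin; lra.
  by rewrite EFinD; apply: leeD; exact: h.
rewrite setCU !setCK; apply: prob_geS => w [Aw Bw].
by split; [exact: AE|exact: BF].
Qed.

Lemma prob_ge_forall (I : finType) (e : I -> R) (E : I -> set T) :
  (forall i, prob_ge P (1 - e i) (E i)) ->
  prob_ge P (1 - \sum_i e i) [set w | forall i, E i w].
Proof.
move=> h.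
suff : forall s : seq I,
    prob_ge P (1 - \sum_(i <- s) e i) [set w | forall i, i \in s -> E i w].
  move=> /(_ (index_enum I)); apply: prob_geS => w /= Ew i.
  by apply: Ew; rewrite mem_index_enum.
elim=> [|i s IH].
  by rewrite big_nil subr0; apply: prob_geT => w i; rewrite in_nil.
rewrite big_cons; apply: prob_geS (prob_geI (h i) IH) => w [Ei Es] j.
by rewrite inE => /predU1P[->//|]; exact: Es.
Qed.

Lemma prob_ge_markov c x (U : T -> \bar R) : measurable_fun setT U ->
  (forall w, 0 <= U w)%E -> 0 < x -> (\int[P]_w U w <= c%:E)%E ->
  prob_ge P (1 - c / x) [set w | (U w < x%:E)%E].
Proof.
move=> mU U0 x0 Uc.
have -> : [set w | (U w < x%:E)%E] = ~` [set w | (x%:E <= U w)%E].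
  by apply/seteqP; split => w /=; rewrite ltNge => /negP.
have mE : measurable [set w | (x%:E <= U w)%E].
  by rewrite -[X in measurable X]setTI; exact: emeasurable_fun_c_infty.
apply: prob_ge_setC => //.
have := @le_integral_comp_abse _ _ _ P _ measurableT U x id (@measurable_id _ _ setT)
  (fun=> id) (fun _ _ _ _ => id) mU x0.
rewrite /= !setTI.
have aU w : `|U w|%E = U w by rewrite gee0_abs.
under eq_integral do rewrite aU.
have -> : [set w | (x%:E <= `|U w|)%E] = [set w | (x%:E <= U w)%E].
  by apply/seteqP; split => w /=; rewrite aU.
move=> h; have {}h := le_trans h Uc.
rewrite -(fineK (fin_num_measure P _ mE)) in h *.
by rewrite lee_fin ler_pdivlMr// mulrC -lee_fin EFinM.
Qed.

End inner_probability.

Section freezing_ge0.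
Context {R : realType} {d d1 d2 : measure_display}.
Context {T : measurableType d} {T1 : measurableType d1} {T2 : measurableType d2}.
Variables (P : probability T R) (mu : probability T2 R).
Variables (D : {mfun T >-> T1}) (Z : {mfun T >-> T2}).
Hypothesis indep : forall A B, measurable A -> measurable B ->
  P (D @^-1` A `&` Z @^-1` B) = (P (D @^-1` A) * mu B)%E.

Let DZ (w : T) : T1 * T2 := (D w, Z w).
Let mDZ : measurable_fun setT DZ.
Proof. exact: measurable_fun_pair. Qed.
HB.instance Definition _ := isMeasurableFun.Build _ _ _ _ DZ mDZ.

(** Nonnegative counterpart of [freezing]: Tonelli takes the place of Fubini, so no integrability is
    asked. The inner law [mu] is given in advance, so that all draws can share it. *)
Lemma ge0_integral_freeze (h : T1 * T2 -> \bar R) :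
    measurable_fun setT h -> (forall x, 0 <= h x)%E ->
  (\int[P]_w h (D w, Z w) = \int[P]_w \int[mu]_y h (D w, y))%E.
Proof.
move=> mh h0.
have E1 : (\int[P]_w h (D w, Z w) = \int[distribution P DZ]_x h x)%E.
  by rewrite (ge0_integral_pushforward mDZ)// preimage_setT.
have E2 : (\int[distribution P DZ]_x h x = \int[(distribution P D \x mu)%E]_x h x)%E.
  apply: eq_measure_integral => A mA _; apply/esym.
  exact: product_measure_unique.
rewrite E1 E2 fubini_tonelli1//.
have mD : measurable_fun setT D by [].
rewrite (ge0_integral_pushforward mD) ?preimage_setT//.
  exact: measurable_fun_fubini_tonelli_F.
by move=> y _; exact: integral_ge0.
Qed.

End freezing_ge0.

Section iid.
Context {R : realType} {d dz : measure_display}.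
Context {Om : measurableType d} {Z : measurableType dz}.

Definition preimages (z : Om -> Z) : set_system Om :=
  [set C | exists2 B, measurable B & C = z @^-1` B].

Definition iid_draws (P : probability Om R) (mu : probability Z R) (n : nat)
    (z : 'I_n.+1 -> Om -> Z) : Prop :=
  [/\ forall i, measurable_fun setT (z i),
      forall i B, measurable B -> P (z i @^-1` B) = mu B &
      independent_family P (fun i => preimages (z i))].

Lemma measurable_id_sub (G : set_system Om) : G `<=` measurable ->
  measurable_fun setT (fun w : Om => (w : g_sigma_algebraType G)).
Proof.
move=> Gm _ A mA; rewrite setTI preimage_id.
by move: A mA; apply: smallest_sub => //; exact: sigma_algebra_measurable.
Qed.

Variables (P : probability Om R) (mu : probability Z R) (n : nat).
Variable z : 'I_n.+1 -> Om -> Z.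
Hypothesis iid : iid_draws P mu z.

Lemma ge0_integral_draw (i : 'I_n.+1) (h : Z -> \bar R) :
  measurable_fun setT h -> (forall y, 0 <= h y)%E ->
  (\int[P]_w h (z i w) = \int[mu]_y h y)%E.
Proof.
move=> mh h0; have [mz law _] := iid.
have -> : (\int[mu]_y h y = \int[pushforward P (z i)]_y h y)%E.
  by apply: eq_measure_integral => A mA _; exact/esym/law.
by rewrite ge0_integral_pushforward// preimage_setT.
Qed.

Definition past (m : nat) : set_system Om :=
  [set C | exists2 i : 'I_n.+1, (i < m)%N & preimages (z i) C].

Lemma past_indep (m : 'I_n.+1) A B : <<s past m >> A -> measurable B ->
  P (A `&` z m @^-1` B) = (P A * mu B)%E.
Proof.
move=> pA mB; have [mz law ind] := iid.
pose wi (l : 'I_m.+1) : 'I_n.+1 := widen_ord (ltn_ord m) l.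
have wi_inj : injective wi by move=> l l' /(congr1 val) /= ?; exact/val_inj.
have wi_max : wi ord_max = m by exact/val_inj.
rewrite -(law m)// -wi_max.
apply: (@independent_ord_max _ _ _ _ _ (fun l => preimages (z (wi l)))).
- by move=> l; exists setT.
- move=> l _ _ [C mC ->] [C' mC' ->]; exists (C `&` C') => //.
  exact: measurableI.
- by move=> l _ [C mC ->]; rewrite -[X in measurable X]setTI; exact: mz.
- move=> J0 F FJ.
  (* Independence is stated for families indexed by all n + 1 draws, so the events of the first m +
     1 draws are extended to every index. The default value of [inord] is harmless, since only
     indices in the image of [wi] are looked at. *)
  pose F' k := F (inord (k : 'I_n.+1)).
  have F'wi l : F' (wi l) = F l.
    by rewrite /F' /=; congr F; apply/val_inj; rewrite /= inordK.
  have := ind [set wi l | l in J0]%SET F'.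
  rewrite big_imset/=; last by move=> ? ? _ _; exact: wi_inj.
  under eq_bigr do rewrite F'wi.
  move=> <-.
    congr (P _); apply/seteqP; split => w /= Fw l.
      by rewrite /= => /imsetP[l' l'J ->]; rewrite F'wi; exact: Fw.
    by move=> lJ; rewrite -F'wi; apply: Fw => /=; exact: imset_f.
  by move=> _ /imsetP[l lJ ->]; rewrite F'wi; exact: FJ.
- move: A pA; apply: smallest_sub; first exact: smallest_sigma_algebra.
  move=> C [i im Ci]; apply: sub_sigma_algebra.
  exists (Ordinal im) => //; rewrite /=.
  rewrite (_ : wi _ = i)//; exact/val_inj.
- by exists B.
Qed.

Lemma past_sub (m : nat) : past m `<=` measurable.
Proof.
have [mz _ _] := iid.
by move=> _ [i _ [B mB ->]]; rewrite -[X in measurable X]setTI; exact: mz.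
Qed.

Lemma measurable_past (m : nat) (i : 'I_n.+1) : (i < m)%N ->
  measurable_fun setT (fun w : g_sigma_algebraType (past m) => z i (w : Om)).
Proof.
move=> im _ B mB; rewrite setTI; apply: sub_sigma_algebra.
by exists i => //; exists B.
Qed.

Lemma ge0_integral_past (m : 'I_n.+1) (h : g_sigma_algebraType (past m) * Z -> \bar R) :
    measurable_fun setT h -> (forall x, 0 <= h x)%E ->
  (\int[P]_w h (w, z m w) = \int[P]_w \int[mu]_y h (w, y))%E.
Proof.
move=> mh h0; have [mz _ _] := iid.
pose T1 := g_sigma_algebraType (past m).
pose D : {mfun Om >-> T1} :=
  HB.pack (fun w : Om => (w : T1))
    (isMeasurableFun.Build _ _ _ _ _ (measurable_id_sub (@past_sub m))).
pose z' : {mfun Om >-> Z} :=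
  HB.pack (z m) (isMeasurableFun.Build _ _ _ _ _ (mz m)).
apply: (ge0_integral_freeze (D := D) (Z := z')) => // A B mA mB.
by rewrite [D @^-1` _]preimage_id; apply: past_indep.
Qed.

End iid.

Section integral_bounds.
Context {R : realType} {d : measure_display} {T : measurableType d}.
Variable mu : probability T R.
Implicit Types (f g : T -> R) (c : R).

Lemma EFin_Rintegral f : mu.-integrable setT (EFin \o f) ->
  (\int[mu]_x (f x)%:E = (\int[mu]_x f x)%:E)%E.
Proof. by move=> fi; rewrite /Rintegral fineK//; exact: integrable_fin_num. Qed.

Lemma integrable_dominated f g : measurable_fun setT f ->
  (forall x, `|f x| <= g x) -> mu.-integrable setT (EFin \o g) ->
  mu.-integrable setT (EFin \o f).
Proof.
move=> mf fg; apply: le_integrable => //; first exact/measurable_EFinP.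
by move=> x _ /=; rewrite lee_fin; apply: le_trans (fg x) (ler_norm _).
Qed.

Lemma ge0_integrable f c : measurable_fun setT f -> (forall x, 0 <= f x) ->
  (\int[mu]_x (f x)%:E <= c%:E)%E -> mu.-integrable setT (EFin \o f).
Proof.
move=> mf f0 fc; apply/integrableP; split; first exact/measurable_EFinP.
under eq_integral do rewrite /= ger0_norm//.
exact: le_lt_trans fc (ltry _).
Qed.

Lemma Rintegral_le f c : measurable_fun setT f -> (forall x, 0 <= f x) ->
  (\int[mu]_x (f x)%:E <= c%:E)%E -> \int[mu]_x f x <= c.
Proof.
move=> mf f0 fc; have fi := ge0_integrable mf f0 fc.
by rewrite -lee_fin -EFin_Rintegral.
Qed.

Lemma integrableD_EFin f g : mu.-integrable setT (EFin \o f) ->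
  mu.-integrable setT (EFin \o g) ->
  mu.-integrable setT (EFin \o (fun x => f x + g x)).
Proof. by move=> fi gi; have := integrableD measurableT fi gi. Qed.

Lemma integrableB_EFin f g : mu.-integrable setT (EFin \o f) ->
  mu.-integrable setT (EFin \o g) ->
  mu.-integrable setT (EFin \o (fun x => f x - g x)).
Proof. by move=> fi gi; have := integrableB measurableT fi gi. Qed.

Lemma integrableZ_EFin c f : mu.-integrable setT (EFin \o f) ->
  mu.-integrable setT (EFin \o (fun x => c * f x)).
Proof. by move=> fi; have := integrableZl measurableT c fi. Qed.

Lemma integrable_cst c : mu.-integrable setT (EFin \o (fun=> c)).
Proof. exact: finite_measure_integrable_cst. Qed.

Lemma Rintegral_cstT c : \int[mu]_x c = c.
Proof. by rewrite /Rintegral integral_cst//= probability_setT mule1. Qed.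

Lemma Rintegral_mono f g : mu.-integrable setT (EFin \o f) ->
  mu.-integrable setT (EFin \o g) -> (forall x, f x <= g x) ->
  \int[mu]_x f x <= \int[mu]_x g x.
Proof. by move=> fi gi fg; exact: le_Rintegral. Qed.

Lemma integrable_sum_EFin (I : finType) (h : I -> T -> R) :
  (forall i, mu.-integrable setT (EFin \o h i)) ->
  mu.-integrable setT (EFin \o (fun x => \sum_i h i x)).
Proof.
move=> ih; have := integrable_sum measurableT (mu := mu) (index_enum I)
  (P := predT) (h := fun i => EFin \o h i) (fun i _ => ih i).
by congr (_.-integrable _ _); apply/funext => x /=; rewrite sumEFin.
Qed.

Lemma Rintegral_sum (I : finType) (h : I -> T -> R) :
  (forall i, mu.-integrable setT (EFin \o h i)) ->
  \int[mu]_x \sum_i h i x = \sum_i \int[mu]_x h i x.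
Proof.
move=> ih; apply: EFin_inj.
rewrite -EFin_Rintegral; last exact: integrable_sum_EFin.
under eq_integral do rewrite -sumEFin.
rewrite integral_sum// -sumEFin; apply: eq_bigr => i _.
exact: EFin_Rintegral.
Qed.

End integral_bounds.

(** * Exponential moments of sums over a sample *)

Section functionals.
Context {R : realType} {dz : measure_display} {Z : measurableType dz}.
Variable (mu : probability Z R) (I : finType).
Implicit Types (F : (I -> R) -> \bar R) (phi : I -> Z -> R).

(* Only finitely many coordinates matter, so measurability of the functional
   is expressed through its action on measurable families. *)
Definition mfunctional F : Prop :=
  forall d' (T' : measurableType d') (h : I -> T' -> R),
    (forall i, measurable_fun setT (h i)) ->
    measurable_fun setT (fun t => F (fun i => h i t)).

(** Effect on a functional of adding one observation to a sum. Expectations over a sample become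
    iterates of this operator, and inequalities between them need only be proved for a single
    step. *)
Definition avg phi F (G : I -> R) : \bar R :=
  (\int[mu]_y F (fun i => G i + phi i y)%R)%E.

Lemma avg_ge0 phi F : (forall G, 0 <= F G)%E -> forall G, (0 <= avg phi F G)%E.
Proof. by move=> F0 G; exact: integral_ge0. Qed.

Lemma mfunctional_shift phi F d' (T' : measurableType d') (h : I -> T' -> R) :
  mfunctional F -> (forall i, measurable_fun setT (phi i)) ->
  (forall i, measurable_fun setT (h i)) ->
  measurable_fun setT (fun x : T' * Z => F (fun i => h i x.1 + phi i x.2)).
Proof.
move=> mF mphi mh; apply: (mF _ _ (fun i (x : T' * Z) => h i x.1 + phi i x.2)) => i.
by apply: measurable_funD; exact: measurableT_comp.
Qed.

Lemma mfunctional_avg phi F : (forall G, 0 <= F G)%E -> mfunctional F ->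
  (forall i, measurable_fun setT (phi i)) -> mfunctional (avg phi F).
Proof.
move=> F0 mF mphi d' T' h mh.
exact: (measurable_fun_fubini_tonelli_F _ (mfunctional_shift mF mphi mh)).
Qed.

Lemma iter_avg_ge0 phi F : (forall G, 0 <= F G)%E ->
  forall m G, (0 <= iter m (avg phi) F G)%E.
Proof. by move=> F0; elim=> [|m IH] G //; exact: avg_ge0. Qed.

Lemma mfunctional_iter_avg phi F m : (forall G, 0 <= F G)%E -> mfunctional F ->
  (forall i, measurable_fun setT (phi i)) -> mfunctional (iter m (avg phi) F).
Proof.
move=> F0 mF mphi; elim: m => [//|m IH]; apply: mfunctional_avg => //.
exact: iter_avg_ge0.
Qed.

Lemma mfunctional_line phi F G : mfunctional F ->
  (forall i, measurable_fun setT (phi i)) ->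
  measurable_fun setT (fun y => F (fun i => G i + phi i y)).
Proof.
move=> mF mphi; apply: mF => i.
by apply: measurable_funD => //; exact: measurable_cst.
Qed.

Lemma avg_le phi F F' G : (forall G, 0 <= F G)%E ->
  mfunctional F -> mfunctional F' -> (forall i, measurable_fun setT (phi i)) ->
  (forall G, F G <= F' G)%E -> (avg phi F G <= avg phi F' G)%E.
Proof.
move=> F0 mF mF' mphi FF'; apply: ge0_le_integral => //; exact: mfunctional_line.
Qed.

Lemma iter_avg_le phi F F' m G : (forall G, 0 <= F G)%E ->
  mfunctional F -> mfunctional F' -> (forall i, measurable_fun setT (phi i)) ->
  (forall G, F G <= F' G)%E -> (iter m (avg phi) F G <= iter m (avg phi) F' G)%E.
Proof.
move=> F0 mF mF' mphi FF'.
have F'0 G0 : (0 <= F' G0)%E by exact: le_trans (FF' _).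
elim: m G => [//|m IH] G /=.
apply: avg_le => //; [exact: iter_avg_ge0|exact: mfunctional_iter_avg..].
Qed.

Context {d : measure_display} {Om : measurableType d}.
Variables (P : probability Om R) (n : nat) (z : 'I_n.+1 -> Om -> Z).
Hypothesis iid : iid_draws P mu z.

Lemma integral_iid_sum phi : (forall i, measurable_fun setT (phi i)) ->
  forall m, (m <= n.+1)%N -> forall F, (forall G, 0 <= F G)%E -> mfunctional F ->
  (\int[P]_w F (fun i => \sum_(l < n.+1 | (l < m)%N) phi i (z l w))%R =
   iter m (avg phi) F (fun=> 0%R))%E.
Proof.
move=> mphi; elim=> [|m IH] mn F F0 mF.
  under eq_integral do under eq_fun do rewrite big_pred0//.
  by rewrite /= integral_cst//= probability_setT mule1.
(* The innermost averaging, next to [F], belongs to draw m, which is integrated out with the earlier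
   draws frozen. *)
rewrite iterSr -IH//; [|exact: ltnW|exact: avg_ge0|exact: mfunctional_avg].
pose H (x : g_sigma_algebraType (past z m) * Z) :=
  F (fun i => \sum_(l < n.+1 | (l < m)%N) phi i (z l (x.1 : Om)) + phi i x.2)%R.
have mH : measurable_fun setT H.
  pose h i (w : g_sigma_algebraType (past z m)) :=
    \sum_(l < n.+1 | (l < m)%N) phi i (z l (w : Om)).
  suff mh i : measurable_fun setT (h i) by exact: (mfunctional_shift mF mphi mh).
  rewrite /h; under eq_fun do rewrite big_mkcond/=.
  apply: measurable_sum => l; case: (boolP (l < m)%N) => [lm|_]; last exact: measurable_cst.
  exact: (measurableT_comp (mphi i) (measurable_past lm)).
have H0 x : (0 <= H x)%E by exact: F0.
have := ge0_integral_past iid (m := Ordinal mn) mH H0; rewrite /H /= => <-.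
apply: eq_integral => w _; congr F; apply/funext => i.
rewrite [LHS](bigD1 (Ordinal mn))//= addrC; congr (_ + _).
by apply: eq_bigl => l; rewrite ltnS -val_eqE /= ltn_neqAle andbC.
Qed.

End functionals.

Section chernoff.
Context {R : realType} {d dz : measure_display}.
Context {Om : measurableType d} {Z : measurableType dz}.
Variables (P : probability Om R) (mu : probability Z R) (n : nat).
Variable z : 'I_n.+1 -> Om -> Z.
Hypothesis iid : iid_draws P mu z.

(** The last of the n + 1 draws is the new observation and stays out of the sum. *)
Definition sample_sum (f : Z -> R) (w : Om) : R :=
  \sum_(i < n) f (z (widen_ord (leqnSn n) i) w).

Lemma sample_sumE f w : sample_sum f w = \sum_(l < n.+1 | (l < n)%N) f (z l w).
Proof.
by rewrite /sample_sum big_ord_narrow.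
Qed.

Lemma measurable_sample_sum f : measurable_fun setT f ->
  measurable_fun setT (sample_sum f).
Proof.
have [mz _ _] := iid.
by move=> mf; apply: measurable_sum => i; exact: measurableT_comp.
Qed.

Lemma integral_exp_sample_sum (f : Z -> R) (M : R) : measurable_fun setT f ->
  0 <= M -> (\int[mu]_y (expR (f y))%:E <= M%:E)%E ->
  (\int[P]_w (expR (sample_sum f w))%:E <= (M ^+ n)%:E)%E.
Proof.
move=> mf M0 fM.
pose F (G : unit -> R) : \bar R := (expR (G tt))%:E.
have mF : mfunctional F.
  move=> d' T' h mh; apply/measurable_EFinP.
  exact: (measurableT_comp (@measurable_expR R) (mh tt)).
have F0 G : (0 <= F G)%E by rewrite lee_fin expR_ge0.
rewrite (_ : (\int[P]_w _)%E = iter n (avg mu (fun=> f)) F (fun=> 0)); last first.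
  rewrite -(integral_iid_sum iid (phi := fun=> f) (fun=> mf) (leqnSn n) F0 mF).
  by apply: eq_integral => w _; rewrite sample_sumE.
have mcF c : mfunctional (fun G => c%:E * F G)%E.
  by move=> d' T' h mh; apply: emeasurable_funM => //; exact: mF.
have cF0 c G : 0 <= c -> (0 <= c%:E * F G)%E by move=> c0; rewrite mule_ge0.
have avgF c G : 0 <= c -> (avg mu (fun=> f) (fun G => c%:E * F G)%E G <=
    (c * M)%:E * F G)%E.
  move=> c0; rewrite /avg /F.
  under eq_integral do rewrite expRD EFinM muleA.
  have mef : measurable_fun setT (fun y => (expR (f y))%:E).
    apply/measurable_EFinP.
    exact: (measurableT_comp (@measurable_expR R) mf).
  rewrite ge0_integralZl//; last by rewrite -EFinM lee_fin mulr_ge0// expR_ge0.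
  rewrite EFinM [X in (_ <= X)%E]muleAC lee_wpmul2l//.
  by rewrite -EFinM lee_fin mulr_ge0// expR_ge0.
(* One averaging multiplies [F] by at most [M]; the scalar [c] accumulates these factors along the
   induction. *)
suff h m c G : 0 <= c ->
    (iter m (avg mu (fun=> f)) (fun G => c%:E * F G)%E G <= (c * M ^+ m)%:E * F G)%E.
  have := h n 1 (fun=> 0) ler01.
  rewrite (_ : (fun G => 1%:E * F G)%E = F); last by apply/funext => G; rewrite mul1e.
  by rewrite mul1r /F expR0 mule1.
elim: m c => [|m IH] c c0; first by rewrite expr0 mulr1.
rewrite iterSr exprS mulrA.
apply: le_trans (IH (c * M) (mulr_ge0 c0 M0)).
apply: iter_avg_le => // [G'||G'].
- by apply: avg_ge0 => ?; exact: cF0.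
- by apply: mfunctional_avg => // ?; exact: cF0.
- exact: avgF.
Qed.

End chernoff.

Section maximal_inequalities.
Context {R : realType} {d dz : measure_display}.
Context {Om : measurableType d} {Z : measurableType dz}.
Variables (P : probability Om R) (mu : probability Z R) (n : nat).
Variable z : 'I_n.+1 -> Om -> Z.
Hypothesis iid : iid_draws P mu z.
Variables (I : finType) (a : R).

Lemma prob_ge_exp_sample_sum (f : Z -> R) (M x : R) : measurable_fun setT f ->
  0 <= M -> (\int[mu]_y (expR (f y))%:E <= M%:E)%E ->
  prob_ge P (1 - M ^+ n * expR (- x)) [set w | sample_sum z f w < x].
Proof.
move=> mf M0 fM; rewrite expRN.
have mS : measurable_fun setT (fun w => (expR (sample_sum z f w))%:E).
  apply/measurable_EFinP.
  exact: (measurableT_comp (@measurable_expR R) (measurable_sample_sum iid mf)).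
have S0 w : (0 <= (expR (sample_sum z f w))%:E)%E by rewrite lee_fin expR_ge0.
have := prob_ge_markov mS S0 (expR_gt0 x) (integral_exp_sample_sum iid mf M0 fM).
by apply: prob_geS => w /=; rewrite lte_fin ltr_expR.
Qed.

(** Chernoff's bound at exponent 1. Of the threshold (2 + a) n, one n pays for 2^n, another for the
    number of indices, and exp(-a n) <= exp(-a) is left. *)
Lemma prob_ge_sum_sqr (u : I -> Z -> R) :
  (forall k, measurable_fun setT (u k)) ->
  (forall k, (\int[mu]_y (expR (u k y ^+ 2))%:E <= 2%:E)%E) ->
  (0 < n)%N -> 0 <= a -> #|I|%:R <= expR n%:R :> R ->
  prob_ge P (1 - expR (- a))
    [set w | forall k, sample_sum z (fun y => u k y ^+ 2) w <= (2 + a) * n%:R].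
Proof.
move=> mu_ u2 n0 a0 cI.
have h k := @prob_ge_exp_sample_sum (fun y => u k y ^+ 2) 2 ((2 + a) * n%:R)
  (measurable_funX _ (mu_ k)) (ler0n _ 2) (u2 k).
apply: (prob_geS _ (prob_ge_le _ (prob_ge_forall h))) => [w /= hw k|].
  exact/ltW/hw.
rewrite lerB// sumr_const -[X in X <= _]mulr_natl.
have e1 : 2 <= expR 1 :> R by have := expR_ge1Dx (1 : R); lra.
have : 2 ^+ n <= expR n%:R :> R.
  by rewrite -[n%:R]mulr1 expRM_natl lerXn2r// nnegrE ?expR_ge0.
move=> e2.
apply: (@le_trans _ _ (expR n%:R * (expR n%:R * expR (- ((2 + a) * n%:R))))).
  apply: ler_pM => //.
  by rewrite ler_wpM2r// expR_ge0.
rewrite -!expRD ler_expR.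
have : 1 <= n%:R :> R by rewrite ler1n.
nra.
Qed.

(** In the quadratic remainder 4 t^2 W^2 exp|tW|, half of the exponent |W| absorbs W^2 at the price
    16, and the other half absorbs exp|tW| as |t| <= 1/2. This gives 64 t^2 exp|W|, of mean at most
    128 t^2. *)
Lemma integral_exp_centered (W : Z -> R) (t : R) : measurable_fun setT W ->
  (\int[mu]_y (expR `|W y|)%:E <= 2%:E)%E -> `|t| <= 1 / 2 ->
  (\int[mu]_y (expR (t * (W y - \int[mu]_y' W y')))%:E <=
    (expR (128 * t ^+ 2))%:E)%E.
Proof.
move=> mW W2 t12.
have mabs : measurable_fun setT (fun y => expR `|W y|).
  apply: (measurableT_comp (@measurable_expR R)).
  exact: (measurableT_comp (@normr_measurable R setT) mW).
have iabs : mu.-integrable setT (EFin \o (fun y => expR `|W y|)).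
  by apply: ge0_integrable mabs _ W2 => y; exact: expR_ge0.
have iW : mu.-integrable setT (EFin \o W).
  apply: integrable_dominated mW _ iabs => y.
  by have := expR_ge1Dx `|W y|; lra.
pose m := \int[mu]_y W y.
have mexp : measurable_fun setT (fun y => expR (t * W y)).
  by apply: (measurableT_comp (@measurable_expR R)); exact: measurable_funM.
have bnd y : expR (t * W y) <= 1 + (t * W y + 64 * t ^+ 2 * expR `|W y|).
  rewrite addrA; apply: le_trans (expR_le_quadratic _) _.
  rewrite lerD2l exprMn.
  have -> : 4 * (t ^+ 2 * W y ^+ 2 * expR `|t * W y|) =
    4 * t ^+ 2 * (W y ^+ 2 * expR `|t * W y|) by ring.
  have hW : `|t * W y| <= `|W y| / 2.
    by rewrite normrM mulrC ler_wpM2l//; lra.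
  have e1 : expR `|t * W y| <= expR (`|W y| / 2) by rewrite ler_expR.
  have e2 := sqr_le_expR_half (normr_ge0 (W y)).
  rewrite real_normK ?num_real// in e2.
  have -> : expR `|W y| = expR (`|W y| / 2) * expR (`|W y| / 2).
    by rewrite -expRD; congr expR; lra.
  have t0 : 0 <= 4 * t ^+ 2 by rewrite mulr_ge0// sqr_ge0.
  have -> : 64 * t ^+ 2 * (expR (`|W y| / 2) * expR (`|W y| / 2)) =
    4 * t ^+ 2 * ((16 * expR (`|W y| / 2)) * expR (`|W y| / 2)) by ring.
  rewrite ler_wpM2l//.
  by rewrite ler_pM ?sqr_ge0 ?expR_ge0.
have iR : mu.-integrable setT (EFin \o (fun y => 1 + (t * W y + 64 * t ^+ 2 * expR `|W y|))).
  apply: integrableD_EFin (integrable_cst mu 1) _.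
  by apply: integrableD_EFin; exact: integrableZ_EFin.
have le1 : (\int[mu]_y (expR (t * W y))%:E <= (expR (t * m + 128 * t ^+ 2))%:E)%E.
  apply: (@le_trans _ _ (\int[mu]_y (1 + (t * W y + 64 * t ^+ 2 * expR `|W y|))%:E)%E).
    apply: ge0_le_integral => //.
    - exact/measurable_EFinP.
    - by move/integrableP: iR => [].
    - by move=> y _; rewrite lee_fin.
  rewrite EFin_Rintegral// lee_fin.
  have i1 := integrableZ_EFin t iW.
  have i2 := integrableZ_EFin (64 * t ^+ 2) iabs.
  rewrite RintegralD//; [|exact: (integrable_cst mu 1)|exact: integrableD_EFin].
  rewrite RintegralD//.
  rewrite !RintegralZl// Rintegral_cstT -/m.
  have : \int[mu]_y expR `|W y| <= 2.
    by apply: Rintegral_le => // y; exact: expR_ge0.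
  have := expR_ge1Dx (t * m + 128 * t ^+ 2); have := sqr_ge0 t.
  rewrite -[64 * _ ^+ 2 * _]mulrA; nra.
under eq_integral do rewrite mulrBr expRD EFinM muleC.
rewrite ge0_integralZl//; last exact/measurable_EFinP.
apply: (@le_trans _ _ ((expR (- (t * m)))%:E * (expR (t * m + 128 * t ^+ 2))%:E)%E).
  by rewrite lee_wpmul2l// lee_fin expR_ge0.
by rewrite -EFinM -expRD lee_fin ler_expR; lra.
Qed.

Lemma prob_ge_bernstein (W : I -> Z -> R) (b : R) :
  (forall k, measurable_fun setT (W k)) ->
  (forall k, (\int[mu]_y (expR `|W k y|)%:E <= 2%:E)%E) ->
  (0 < n)%N -> 0 < b <= n%:R -> 2 * #|I|%:R * expR (- b) <= expR (- a) ->
  prob_ge P (1 - expR (- a))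
    [set w | forall k, `|sample_sum z (W k) w - n%:R * \int[mu]_y W k y| <=
       66 * Num.sqrt (n%:R * b)].
Proof.
move=> mW W2 n0 /andP[b0 bn] cI.
have nR0 : 0 < n%:R :> R by rewrite ltr0n.
pose s := Num.sqrt (n%:R * b).
have s2 : s ^+ 2 = n%:R * b by rewrite sqr_sqrtr// mulr_ge0// ltW.
have s0 : 0 < s by rewrite sqrtr_gt0 mulr_gt0.
(* With this t the moment bound contributes n * 128 t^2 = 32 b, while the threshold 66 s becomes t *
   66 s = 33 b, so that each tail is at most exp(-b). The condition b <= n ensures t <= 1/2. *)
pose t := s / (2 * n%:R).
have sn : s <= n%:R.
  have : s ^+ 2 <= n%:R ^+ 2 by rewrite s2 expr2 ler_wpM2l// ltW.
  by rewrite ler_pXn2r// nnegrE ltW.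
have t0 : 0 < t by rewrite divr_gt0// mulr_gt0.
have t12 : t <= 1 / 2 by rewrite /t ler_pdivrMr ?mulr_gt0//; lra.
have nt2 : n%:R * t ^+ 2 = b / 4.
  rewrite /t expr_div_n s2; field; lra.
have ts : t * s = b / 2.
  rewrite /t mulrAC -expr2 s2; field; lra.
have h (e : bool) k : prob_ge P (1 - expR (- b)) [set w |
   sample_sum z (fun y => (-1) ^+ e * t * (W k y - \int[mu]_y' W k y')) w < 33 * b].
  apply: prob_ge_le (@prob_ge_exp_sample_sum _ (expR (128 * t ^+ 2)) (33 * b) _ _ _).
  - rewrite -expRM_natl -expRD lerB// ler_expR.
    have -> : n%:R * (128 * t ^+ 2) = 32 * b by rewrite mulrCA nt2; field.
    lra.
  - apply: measurable_funM; first exact: measurable_cst.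
    by apply: measurable_funB => //; exact: measurable_cst.
  - exact: expR_ge0.
  - have := @integral_exp_centered (W k) ((-1) ^+ e * t) (mW k) (W2 k).
    rewrite normrM normr_sign (mul1r `|t|) gtr0_norm// exprMn sqrr_sign (mul1r (t ^+ 2)).
    by apply.
have := prob_geI (prob_ge_forall (h false)) (prob_ge_forall (h true)).
rewrite !sumr_const -[expR _ *+ _]mulr_natl.
move=> H; apply: (prob_geS _ (prob_ge_le _ H)) => [w [H1 H2] k|]; last first.
  by rewrite lerB//; apply: le_trans cI; lra.
have E (e : bool) : sample_sum z (fun y => (-1) ^+ e * t * (W k y - \int[mu]_y' W k y')) w =
    (-1) ^+ e * t * (sample_sum z (W k) w - n%:R * \int[mu]_y W k y).
  rewrite /sample_sum -mulr_sumr sumrB sumr_const card_ord.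
  by rewrite -[_ *+ n]mulr_natl.
move: (H1 k) (H2 k) => /=; rewrite (E false) (E true) expr0 expr1 !mul1r mulN1r.
set D := _ - _ => d1 d2.
have e33 : 33 * b = t * (66 * s) by rewrite mulrCA ts; field.
rewrite e33 (ltr_pM2l t0) in d1; rewrite e33 mulNr -mulrN (ltr_pM2l t0) in d2.
by rewrite -/s ler_norml; apply/andP; split; lra.
Qed.

End maximal_inequalities.

(** * Symmetrization and contraction *)

Section contraction.
Context {R : realType} {dz : measure_display} {Z : measurableType dz}.
Variable (mu : probability Z R) (I : finType).
Implicit Types (F : (I -> R) -> \bar R) (phi : I -> Z -> R).

(* The functionals for which symmetrization followed by the contraction
   principle can be performed one observation at a time; the class contains
   the maximum and is stable under averaging over a random shift. *)
Record contractive F : Prop := Contractive {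
  contractive_ge0 : forall G, (0 <= F G)%E;
  contractive_meas : mfunctional F;
  contractive_jensen : forall h : I -> Z -> R,
    (forall i, mu.-integrable setT (EFin \o h i)) ->
    (F (fun i => \int[mu]_y h i y)%R <= \int[mu]_y F (fun i => h i y))%E;
  contractive_mid : forall A B,
    (2%:E * F (fun i => (A i + B i) / 2)%R <= F A + F B)%E;
  contractive_swap : forall G f a, (forall i j, `|f i - f j| <= `|a i - a j|) ->
    (forall i, `|f i| <= `|a i|) ->
    (F (fun i => G i + f i)%R + F (fun i => G i - f i)%R <=
     F (fun i => G i + a i)%R + F (fun i => G i - a i)%R)%E }.

(** All properties hold pointwise in the shift and are then integrated; for Jensen's inequality the
    two integrals are exchanged by Tonelli. *)
Lemma contractive_avg phi F : (forall i, measurable_fun setT (phi i)) ->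
  contractive F -> contractive (avg mu phi F).
Proof.
move=> mphi [F0 mF FJ Fm Fs]; split.
- exact: avg_ge0.
- exact: mfunctional_avg.
- move=> h ih.
  have mh i : measurable_fun setT (h i).
    by apply/measurable_EFinP; exact: measurable_int (ih i).
  pose H (x : Z * Z) := F (fun i => h i x.1 + phi i x.2).
  have mH : measurable_fun setT H by exact: mfunctional_shift mF mphi mh.
  have H0 x : (0 <= H x)%E by exact: F0.
  have -> : (\int[mu]_y avg mu phi F (fun i => h i y) = \int[mu]_x \int[mu]_y H (x, y))%E.
    by [].
  rewrite (@fubini_tonelli _ _ _ _ _ mu mu H mH H0) /=.
  apply: ge0_le_integral => //.
  + exact: mfunctional_line.
  + exact: measurable_fun_fubini_tonelli_G.
  + move=> y _; rewrite /H /=.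
    have int i := integrableD_EFin (ih i) (integrable_cst mu (phi i y)).
    apply: le_trans (FJ _ int); rewrite le_eqVlt; apply/orP; left; apply/eqP.
    congr F; apply/funext => i.
    rewrite RintegralD//; last exact: (integrable_cst mu (phi i y)).
    by rewrite Rintegral_cstT.
- move=> A B; rewrite /avg -ge0_integralZl//; last exact: mfunctional_line.
  rewrite -ge0_integralD//; [|exact: mfunctional_line..].
  apply: ge0_le_integral => //.
  + by move=> y _; rewrite mule_ge0.
  + by apply: emeasurable_funM => //; exact: mfunctional_line.
  + by apply: emeasurable_funD => //; exact: mfunctional_line.
  + move=> y _; apply: le_trans (Fm _ _).
    rewrite le_eqVlt; apply/orP; left; apply/eqP; congr (_ * F _)%E.
    by apply/funext => i; field.
- move=> G f a fa fa0; rewrite /avg -!ge0_integralD//; [|exact: mfunctional_line..].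
  apply: ge0_le_integral => //.
  + by move=> y _; rewrite adde_ge0.
  + by apply: emeasurable_funD => //; exact: mfunctional_line.
  + by apply: emeasurable_funD => //; exact: mfunctional_line.
  + move=> y _; have := Fs (fun i => G i + phi i y) f a fa fa0.
    have E u : (fun i => G i + phi i y + u i) = (fun i => G i + u i + phi i y).
      by apply/funext => i; rewrite addrAC.
    by rewrite (E f) (E a) (E (fun i => - f i)) (E (fun i => - a i)).
Qed.

Lemma contractive_add F1 F2 : contractive F1 -> contractive F2 ->
  contractive (fun G => F1 G + F2 G)%E.
Proof.
move=> c1 c2; have F10 := contractive_ge0 c1; have F20 := contractive_ge0 c2.
have mF1 := contractive_meas c1; have mF2 := contractive_meas c2; split.
- by move=> G; rewrite adde_ge0.
- by move=> d' T' h mh; apply: emeasurable_funD; [exact: mF1|exact: mF2].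
- move=> h ih.
  have mh i : measurable_fun setT (h i).
    by apply/measurable_EFinP; exact: measurable_int (ih i).
  rewrite ge0_integralD//; [|exact: mF1|exact: mF2].
  by rewrite leeD//; exact: contractive_jensen.
- move=> A B; rewrite ge0_muleDr// addeACA leeD//; exact: contractive_mid.
- move=> G f a fa fa0; rewrite addeACA [leRHS]addeACA leeD//;
    exact: contractive_swap.
Qed.

Lemma contractive_scale c F : (0 <= c)%R -> contractive F ->
  contractive (fun G => c%:E * F G)%E.
Proof.
move=> c0 cF; have F0 := contractive_ge0 cF; have mF := contractive_meas cF.
split.
- by move=> G; rewrite mule_ge0.
- by move=> d' T' h mh; apply: emeasurable_funM => //; exact: mF.
- move=> h ih.
  have mh i : measurable_fun setT (h i).
    by apply/measurable_EFinP; exact: measurable_int (ih i).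
  rewrite ge0_integralZl//; last exact: mF.
  by rewrite lee_wpmul2l//; exact: contractive_jensen.
- move=> A B; rewrite muleCA -ge0_muleDr// lee_wpmul2l//.
  exact: contractive_mid.
- move=> G f a fa fa0; rewrite -!ge0_muleDr// lee_wpmul2l//.
  exact: contractive_swap.
Qed.

(** The averaging step for an observation multiplied by a Rademacher sign. *)
Definition symavg phi F (G : I -> R) : \bar R :=
  (2^-1%:E * (avg mu phi F G + avg mu (fun i y => - phi i y)%R F G))%E.

Lemma contractive_symavg phi F : (forall i, measurable_fun setT (phi i)) ->
  contractive F -> contractive (symavg phi F).
Proof.
move=> mphi cF; apply: contractive_scale; first by rewrite invr_ge0.
apply: contractive_add; apply: contractive_avg => // i.
by apply: measurableT_comp.
Qed.

(** The 0 in the maximum acts as one more index at which G, f and a vanish; this is where |f i| <=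
    |a i| enters beside the bound on increments. For the swap, a pair of indices (i, j) realizing
    the two maxima on the left contributes f i - f j, at most |a i - a j|, and the right side
    dominates either sign of a i - a j. *)
Lemma contractive_max : contractive (fun G => (\big[Num.max/0%R]_i G i)%:E).
Proof.
split.
- by move=> G; rewrite lee_fin bigmax_ge_id.
- move=> d' T' h mh; apply/measurable_EFinP.
  elim: (index_enum I) => [|i s IH].
    by under eq_fun do rewrite big_nil; exact: measurable_cst.
  by under eq_fun do rewrite big_cons; exact: measurable_maxr.
- move=> h ih.
  have mh i : measurable_fun setT (h i).
    by apply/measurable_EFinP; exact: measurable_int (ih i).
  have mM : measurable_fun setT (fun y => (\big[Num.max/0%R]_i h i y)%:E).
    apply/measurable_EFinP; elim: (index_enum I) => [|i s IH].
      by under eq_fun do rewrite big_nil; exact: measurable_cst.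
    by under eq_fun do rewrite big_cons; exact: measurable_maxr.
  have M0 y : (0 <= (\big[Num.max/0%R]_i h i y)%:E)%E.
    by rewrite lee_fin bigmax_ge_id.
  have [fin|] := ltP (\int[mu]_y (\big[Num.max/0%R]_i h i y)%:E)%E +oo%E; last first.
    by rewrite leye_eq => /eqP ->; rewrite leey.
  have iM : mu.-integrable setT (EFin \o (fun y => \big[Num.max/0%R]_i h i y)).
    apply/integrableP; split => //.
    suff -> : (\int[mu]_y `|(\big[Num.max/0%R]_i h i y)%:E| =
      \int[mu]_y (\big[Num.max/0%R]_i h i y)%:E)%E by [].
    by apply: eq_integral => y _; rewrite gee0_abs.
  rewrite EFin_Rintegral// lee_fin; apply: bigmax_le => [|i _].
    by apply: Rintegral_ge0 => y _; exact: bigmax_ge_id.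
  by apply: Rintegral_mono => // y; exact: le_bigmax.
- move=> A B; rewrite -EFinM -EFinD lee_fin mulrC -ler_pdivlMr//.
  apply: bigmax_le => [|i _].
    by rewrite divr_ge0// addr_ge0// bigmax_ge_id.
  by rewrite ler_pM2r// lerD// le_bigmax.
- move=> G f a fa fa0; rewrite -!EFinD lee_fin.
  set M := _ + \big[_/_]_i (G i - a i).
  have bm (u : I -> R) j : u j <= \big[Num.max/0]_i u i by exact: le_bigmax.
  have M0' (u : I -> R) : 0 <= \big[Num.max/0]_i u i by exact: bigmax_ge_id.
  pose MD := \big[Num.max/0]_i (G i + a i); pose MB := \big[Num.max/0]_i (G i - a i).
  have bD i : G i + a i <= MD by exact: (bm (fun i => G i + a i)).
  have bB i : G i - a i <= MB by exact: (bm (fun i => G i - a i)).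
  have pD : 0 <= MD by exact: M0'.
  have pB : 0 <= MB by exact: M0'.
  have ME : M = MD + MB by [].
  have aM i : G i + `|a i| <= M.
    by have := bD i; have := bB i; rewrite ME; case: (ger0P (a i)) => ai; lra.
  have aaM i j : G i + G j + `|a i - a j| <= M.
    have := bD i; have := bB i; have := bD j; have := bB j.
    by rewrite ME; case: (ger0P (a i - a j)) => aij; lra.
  have M0 : 0 <= M by rewrite addr_ge0// bigmax_ge_id.
  rewrite -lerBrDr; apply: bigmax_le => [|i _].
    rewrite subr_ge0; apply: bigmax_le => // j _.
    apply: le_trans (aM j); rewrite lerD2l; apply: le_trans (fa0 j).
    by rewrite -normrN ler_norm.
  rewrite lerBrDr -lerBrDl; apply: bigmax_le => [|j _].
    rewrite subr_ge0; apply: le_trans (aM i); rewrite lerD2l.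
    by apply: le_trans (fa0 i); exact: ler_norm.
  rewrite lerBrDl; apply: le_trans (aaM i j).
  by have := fa i j; have := ler_norm (f i - f j); lra.
Qed.

Variables (f a : I -> Z -> R).
Hypothesis if_ : forall i, mu.-integrable setT (EFin \o f i).
Hypothesis ma : forall i, measurable_fun setT (a i).
Hypothesis fa : forall i j y, `|f i y - f j y| <= `|a i y - a j y|.
Hypothesis fa0 : forall i y, `|f i y| <= `|a i y|.

Let mf i : measurable_fun setT (f i).
Proof. by apply/measurable_EFinP; exact: measurable_int (if_ i). Qed.

Let phi i y := f i y - \int[mu]_y' f i y'.
Let a2 i y := 2 * a i y.

Let mphi i : measurable_fun setT (phi i).
Proof. by apply: measurable_funB => //; exact: measurable_cst. Qed.

Let ma2 i : measurable_fun setT (a2 i).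
Proof. by apply: measurable_funM => //; exact: measurable_cst. Qed.

(* G + f - E f is the midpoint of G + 2 f and G - 2 E f; Jensen's inequality
   removes the expectation, and the signs are then symmetric. *)
Lemma avg_le_symavg F G : contractive F -> (avg mu phi F G <= symavg a2 F G)%E.
Proof.
move=> [F0 mF FJ Fm Fs].
have mf2 i : measurable_fun setT (fun y => 2 * f i y).
  by apply: measurable_funM => //; exact: measurable_cst.
have mNf2 i : measurable_fun setT (fun y => - (2 * f i y)) by exact: measurableT_comp.
have mNa2 i : measurable_fun setT (fun y => - a2 i y) by exact: measurableT_comp.
have h1 y : (2%:E * F (fun i => G i + phi i y)%R <=
    F (fun i => G i + 2 * f i y)%R + avg mu (fun i y => - (2 * f i y))%R F G)%E.
  have E1 : (fun i => G i + phi i y) =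
     (fun i => ((G i + 2 * f i y) + (G i - 2 * \int[mu]_y' f i y')) / 2).
    by apply/funext => i; rewrite /phi; field.
  rewrite E1; apply: le_trans (Fm _ _) _; rewrite leeD2l//.
  have i1 i := integrableB_EFin (integrable_cst mu (G i)) (integrableZ_EFin 2 (if_ i)).
  apply: le_trans (FJ _ i1); rewrite le_eqVlt; apply/orP; left; apply/eqP.
  congr F; apply/funext => i.
  rewrite RintegralB//; [|exact: (integrable_cst mu (G i))|exact: integrableZ_EFin].
  by rewrite Rintegral_cstT RintegralZl.
rewrite /symavg -(@lee_pmul2l _ 2%:E)// muleA -EFinM divff// mul1e.
rewrite {1}/avg -ge0_integralZl//; last exact: mfunctional_line.
apply: (@le_trans _ _ (avg mu (fun i y => 2 * f i y)%R F G +
    avg mu (fun i y => - (2 * f i y))%R F G)%E).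
  have -> : (avg mu (fun i y => - (2 * f i y))%R F G =
      \int[mu]_y (cst (avg mu (fun i y => - (2 * f i y))%R F G) y))%E.
    by rewrite integral_cst//= probability_setT mule1.
  rewrite {1}/avg -ge0_integralD//; last 2 first.
  - exact: mfunctional_line.
  - by move=> y _; exact: avg_ge0.
  apply: ge0_le_integral => //.
  - by move=> y _; rewrite mule_ge0.
  - by apply: emeasurable_funM => //; exact: mfunctional_line.
  - by apply: emeasurable_funD => //; exact: mfunctional_line.
rewrite /avg -!ge0_integralD//; [|exact: mfunctional_line..].
apply: ge0_le_integral => //.
- by move=> y _; rewrite adde_ge0.
- by apply: emeasurable_funD => //; exact: mfunctional_line.
- by apply: emeasurable_funD => //; exact: mfunctional_line.
move=> y _; apply: (Fs G (fun i => 2 * f i y) (fun i => 2 * a i y)) => [i j|i].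
  by rewrite -!mulrBr !normrM ler_wpM2l.
by rewrite !normrM ler_wpM2l.
Qed.

(** Observations are exchanged one at a time. The induction is over all contractive functionals
    because each exchange replaces [F] by [symavg a2 F]. *)
Lemma iter_avg_le_symavg m F G : contractive F ->
  (iter m (avg mu phi) F G <= iter m (symavg a2) F G)%E.
Proof.
elim: m F => [//|m IH] F cF; rewrite !iterSr.
have cS := contractive_symavg ma2 cF.
apply: le_trans (IH _ cS); have cA := contractive_avg mphi cF.
apply: iter_avg_le => //; try exact: contractive_meas; try exact: contractive_ge0.
by move=> G'; exact: avg_le_symavg.
Qed.

End contraction.

Section symmetrized_maximum.
Context {R : realType} {dz : measure_display} {Z : measurableType dz}.
Variables (mu : probability Z R) (I K : finType).
Variables (v : I -> K -> R) (al : K -> Z -> R) (t c : R).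
Hypothesis v0 : forall i k, 0 <= v i k.
Hypothesis v1 : forall i, \sum_k v i k <= 1.
Hypothesis mal : forall k, measurable_fun setT (al k).
Hypothesis al2 : forall k, (\int[mu]_y (expR (al k y ^+ 2))%:E <= 2%:E)%E.
Hypotheses (t0 : 0 < t) (t8 : 8 * t ^+ 2 <= 1) (c0 : 0 <= c).

(** The hyperbolic cosine of 2 t al: the factor by which one signed observation, doubled by
    symmetrization, multiplies the exponential of coordinate k in the mean. *)
Let ch k y := (expR (2 * t * al k y) + expR (- (2 * t * al k y))) / 2.

Let mch k : measurable_fun setT (ch k).
Proof.
apply: measurable_funM; last exact: measurable_cst.
have m1 : measurable_fun setT (fun y => 2 * t * al k y).
  by apply: measurable_funM => //; exact: measurable_cst.
apply: measurable_funD; apply: (measurableT_comp (@measurable_expR R)) => //.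
exact: measurableT_comp.
Qed.

Let ch0 k y : 0 <= ch k y.
Proof. by rewrite divr_ge0// addr_ge0// expR_ge0. Qed.

Lemma integral_cosh_le k : (\int[mu]_y (ch k y)%:E <= (expR (8 * t ^+ 2))%:E)%E.
Proof.
have me : measurable_fun setT (fun y => expR (al k y ^+ 2)).
  by apply: (measurableT_comp (@measurable_expR R)); exact: measurable_funX.
have ie : mu.-integrable setT (EFin \o (fun y => expR (al k y ^+ 2))).
  by apply: ge0_integrable me _ (al2 k) => y; exact: expR_ge0.
have e2 : \int[mu]_y expR (al k y ^+ 2) <= 2.
  by apply: Rintegral_le => // y; exact: expR_ge0.
have ib := integrableD_EFin (integrable_cst mu (1 - 8 * t ^+ 2))
  (integrableZ_EFin (8 * t ^+ 2) ie).
have bnd y : ch k y <= 1 - 8 * t ^+ 2 + 8 * t ^+ 2 * expR (al k y ^+ 2).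
  apply: le_trans (cosh_le_expR _) _.
  have -> : 2 * (2 * t * al k y) ^+ 2 = 8 * t ^+ 2 * al k y ^+ 2 by ring.
  apply: le_trans (expR_convex_le1 _ _) _; last lra.
  by rewrite t8 andbT mulr_ge0// sqr_ge0.
apply: (@le_trans _ _ (\int[mu]_y (1 - 8 * t ^+ 2 + 8 * t ^+ 2 * expR (al k y ^+ 2))%:E)%E).
  apply: ge0_le_integral => //.
  - by move=> y _; rewrite lee_fin.
  - exact/measurable_EFinP.
  - by move/integrableP: ib => [].
  - by move=> y _; rewrite lee_fin.
rewrite EFin_Rintegral// lee_fin RintegralD//; last 2 first.
- exact: (integrable_cst mu (1 - 8 * t ^+ 2)).
- exact: integrableZ_EFin.
rewrite Rintegral_cstT RintegralZl//.
by have := expR_ge1Dx (8 * t ^+ 2); have := sqr_ge0 t; nra.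
Qed.

Let a i y := \sum_k v i k * al k y.

Let ma i : measurable_fun setT (a i).
Proof.
by apply: measurable_sum => k; apply: measurable_funM.
Qed.

(* [u <= c + exp (t (u - c)) / t] linearizes the maximum in the exponentials. *)
Lemma iter_symavg_max_le m (u : K -> R) :
  (iter m (symavg mu (fun i y => 2 * a i y)%R) (fun G => (\big[Num.max/0%R]_i G i)%:E)
     (fun i => \sum_k v i k * u k)%R <=
   (c + t^-1 * expR (- (t * c)) * expR (8 * t ^+ 2) ^+ m *
     \sum_k expR (t * u k))%:E)%E.
Proof.
set kap := t^-1 * expR (- (t * c)).
have kap0 : 0 <= kap by rewrite mulr_ge0 ?expR_ge0// invr_ge0 ltW.
set Mx := fun G : I -> R => _.
have cM := contractive_max mu I : contractive mu Mx.
have ma2 i : measurable_fun setT (fun y => 2 * a i y).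
  by apply: measurable_funM => //; exact: measurable_cst.
have mNa2 i : measurable_fun setT (fun y => - (2 * a i y)) by exact: measurableT_comp.
elim: m u => [|m IH] u.
  rewrite expr0 mulr1 lee_fin; apply: bigmax_le => [|i _].
    rewrite addr_ge0// mulr_ge0// sumr_ge0// => k _; exact: expR_ge0.
  have S0 : 0 <= \sum_k expR (t * u k) by apply: sumr_ge0 => k _; exact: expR_ge0.
  have uk k : u k <= c + kap * \sum_k expR (t * u k).
    have h1 : u k <= c + kap * expR (t * u k).
      have -> : kap * expR (t * u k) = t^-1 * expR (t * (u k - c)).
        by rewrite /kap -mulrA -expRD; congr (_ * expR _); ring.
      have := expR_ge1Dx (t * (u k - c)).
      set e := expR _ => he.
      have : t * (u k - c) <= t * (t^-1 * e) by rewrite mulrA divff ?gt_eqF// mul1r; lra.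
      by rewrite ler_pM2l//; lra.
    apply: le_trans h1 _; rewrite lerD2l ler_wpM2l//.
    by rewrite (bigD1 k)//= lerDl sumr_ge0// => ? _; exact: expR_ge0.
  set B := c + _ in uk *.
  have B0 : 0 <= B by rewrite addr_ge0// mulr_ge0.
  (* A bound common to the vertices passes to all weights of mass at most 1, as [B] is nonnegative.
     The size of [I] does not enter, so a net of weights may later be as fine as desired. *)
  apply: (@le_trans _ _ (\sum_k v i k * B)).
    by apply: ler_sum => k _; rewrite ler_wpM2l.
  by rewrite -mulr_suml -[leRHS]mul1r ler_wpM2r.
rewrite iterS; set F := iter m _ _.
have cF : contractive mu F.
  rewrite /F; elim: (m) => [//|j IHj]; rewrite iterS.
  exact: contractive_symavg.
have F0 := contractive_ge0 cF; have mF := contractive_meas cF.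
set M := expR (8 * t ^+ 2).
have hp k : 0 <= kap * M ^+ m * expR (t * u k).
  apply: mulr_ge0 (expR_ge0 _); apply: mulr_ge0 => //.
  exact/exprn_ge0/expR_ge0.
(* A signed observation merely translates [u], which makes the induction hypothesis applicable to
   the translated vector. *)
have shift (e : bool) y : (fun i => \sum_k v i k * u k + (-1) ^+ e * (2 * a i y)) =
    (fun i => \sum_k v i k * (u k + (-1) ^+ e * (2 * al k y))).
  apply/funext => i; rewrite /a !mulr_sumr -big_split /=.
  by apply: eq_bigr => k _; ring.
rewrite /symavg /avg -ge0_integralD//; [|exact: mfunctional_line..].
rewrite -ge0_integralZl//; last 2 first.
- by apply: emeasurable_funD; exact: mfunctional_line.
- by move=> y _; rewrite adde_ge0.
apply: (@le_trans _ _ (\int[mu]_y (c%:E +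
    \sum_k (kap * M ^+ m * expR (t * u k))%:E * (ch k y)%:E))%E).
  apply: ge0_le_integral => //.
  - by move=> y _; rewrite mule_ge0// adde_ge0.
  - apply: emeasurable_funM => //.
    by apply: emeasurable_funD; exact: mfunctional_line.
  - apply: emeasurable_funD => //; apply: emeasurable_sum => k.
    by apply: emeasurable_funM => //; exact/measurable_EFinP.
  move=> y _.
  have h e := IH (fun k => u k + (-1) ^+ e * (2 * al k y)).
  have := leeD (h false) (h true).
  rewrite -!shift.
  have -> : (fun i => \sum_k v i k * u k + (-1) ^+ false * (2 * a i y)) =
    (fun i => \sum_k v i k * u k + 2 * a i y) by apply/funext => i; rewrite mul1r.
  have -> : (fun i => \sum_k v i k * u k + (-1) ^+ true * (2 * a i y)) =
    (fun i => \sum_k v i k * u k - 2 * a i y).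
    by apply/funext => i; rewrite expr1 mulN1r.
  rewrite -/F -EFinD => {}h.
  apply: le_trans (lee_wpmul2l _ h) _; first by rewrite lee_fin.
  under [X in (_ <= _ + X)%E]eq_bigr do rewrite -EFinM.
  rewrite sumEFin -EFinD -EFinM lee_fin.
  rewrite le_eqVlt; apply/orP; left; apply/eqP.
  rewrite (_ : \sum_k _ * ch k y = kap * M ^+ m * \sum_k
      (expR (t * (u k + (-1) ^+ false * (2 * al k y))) +
       expR (t * (u k + (-1) ^+ true * (2 * al k y)))) / 2).
    by rewrite -mulr_suml big_split /=; field.
  rewrite mulr_sumr; apply: eq_bigr => k _; rewrite -(mulrA (kap * M ^+ m)); congr (_ * _).
  rewrite /ch /= expr0 expr1 mul1r mulN1r.
  have -> : t * (u k + 2 * al k y) = t * u k + 2 * t * al k y by ring.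
  have -> : t * (u k - 2 * al k y) = t * u k - 2 * t * al k y by ring.
  by rewrite !expRD; field.
rewrite ge0_integralD//; last 2 first.
- move=> y _; apply: sume_ge0 => k _.
  by rewrite -EFinM lee_fin mulr_ge0.
- apply: emeasurable_sum => k.
  by apply: emeasurable_funM => //; exact/measurable_EFinP.
rewrite integral_cst//= probability_setT mule1 EFinD leeD2l//.
rewrite ge0_integral_sum//; last 2 first.
- by move=> k; apply: emeasurable_funM => //; exact/measurable_EFinP.
- by move=> k y _; rewrite -EFinM lee_fin mulr_ge0.
rewrite mulr_sumr -sumEFin; apply: lee_sum => k _.
rewrite ge0_integralZl//; last 3 first.
- exact/measurable_EFinP.
- by move=> y _; rewrite lee_fin.
- by rewrite lee_fin.
apply: le_trans (lee_wpmul2l _ (integral_cosh_le k)) _.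
  by rewrite lee_fin.
rewrite -EFinM lee_fin le_eqVlt; apply/orP; left; apply/eqP.
by rewrite -/M exprSr; ring.
Qed.

End symmetrized_maximum.

Section lipschitz_class.
Context {R : realType} {d dz : measure_display}.
Context {Om : measurableType d} {Z : measurableType dz}.
Variables (P : probability Om R) (mu : probability Z R) (n : nat).
Variable z : 'I_n.+1 -> Om -> Z.
Hypothesis iid : iid_draws P mu z.
Variables (K : finType) (al : K -> Z -> R) (b : R).
Hypothesis mal : forall k, measurable_fun setT (al k).
Hypothesis al2 : forall k, (\int[mu]_y (expR (al k y ^+ 2))%:E <= 2%:E)%E.
Hypotheses (b12 : 1 / 2 <= b) (bn : b <= n%:R) (Kb : #|K|%:R <= expR b).

Let b0 : 0 < b. Proof. by move: b12; lra. Qed.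
Let n0 : 0 < n%:R :> R. Proof. exact: lt_le_trans b0 bn. Qed.

Lemma prob_ge_contraction (I : finType) (v : I -> K -> R) (f : I -> Z -> R) (e : R) :
  (forall i k, 0 <= v i k) -> (forall i, \sum_k v i k <= 1) ->
  (forall i, mu.-integrable setT (EFin \o f i)) ->
  (forall i j y, `|f i y - f j y| <= `|\sum_k (v i k - v j k) * al k y|) ->
  (forall i y, `|f i y| <= `|\sum_k v i k * al k y|) -> 0 < e ->
  prob_ge P (1 - e) [set w | forall i,
    sample_sum z (f i) w - n%:R * \int[mu]_y f i y <= 12 * Num.sqrt (n%:R * b) / e].
Proof.
move=> v0 v1 if_ ff f0 e0; have bp := b0; have np := n0; have b12' := b12.
pose s := Num.sqrt (n%:R * b).
have s2 : s ^+ 2 = n%:R * b by rewrite sqr_sqrtr// mulr_ge0// ltW.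
have s0 : 0 < s by rewrite sqrtr_gt0 mulr_gt0.
(* This t makes the growth term n * 8 t^2 equal to 8 b / 9, and c below makes t c = 2 b. With #|K|
   <= exp b the total exponent -2 b + 8 b / 9 + b is negative, so the mean of the maximum is at most
   (2 b + 1) / t, which is at most 12 s because b >= 1/2. Markov's inequality then divides by e. *)
pose t := s / (3 * n%:R).
have t0 : 0 < t by rewrite divr_gt0// mulr_gt0.
have t2 : n%:R * t ^+ 2 = b / 9 by rewrite /t expr_div_n s2; field; rewrite gt_eqF.
have t8 : 8 * t ^+ 2 <= 1.
  rewrite -(ler_pM2l n0) mulrCA t2 mulr1; move: b0 bn; lra.
have tV : t^-1 = 3 * s / b.
  have : t * (3 * s / b) = 1.
    rewrite /t; have -> : s / (3 * n%:R) * (3 * s / b) = s ^+ 2 / (n%:R * b).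
      by field; rewrite !gt_eqF.
    by rewrite s2 divff// mulf_neq0 ?gt_eqF.
  have tn0 : t != 0 by rewrite gt_eqF.
  by move=> h; apply: (mulfI tn0); rewrite h divff.
pose c := 2 * b / t.
have c0 : 0 <= c by apply: divr_ge0; [apply: mulr_ge0; rewrite ?(ltW b0)|exact: ltW].
pose a i y := \sum_k v i k * al k y.
have ma i : measurable_fun setT (a i).
  by apply: measurable_sum => k; apply: measurable_funM.
pose phi i y := f i y - \int[mu]_y' f i y'.
have mf i : measurable_fun setT (f i).
  by apply/measurable_EFinP; exact: measurable_int (if_ i).
have mphi i : measurable_fun setT (phi i).
  by apply: measurable_funB => //; exact: measurable_cst.
have aa i j y : `|f i y - f j y| <= `|a i y - a j y|.
  apply: le_trans (ff i j y) _; rewrite /a -sumrB.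
  by under eq_bigr do rewrite mulrBl.
have cM := contractive_max mu I; have M0 := contractive_ge0 cM.
have mM := contractive_meas cM.
pose U w : \bar R := (\big[Num.max/0]_i sample_sum z (phi i) w)%:E.
have mU : measurable_fun setT U.
  by apply: (mM _ _ (fun i => sample_sum z (phi i))) => i; exact: (measurable_sample_sum iid (mphi i)).
have EU : (\int[P]_w U w <= (12 * s)%:E)%E.
  have -> : (\int[P]_w U w)%E = iter n (avg mu phi)
      (fun G : I -> R => (\big[Num.max/0]_i G i)%:E) (fun=> 0).
    rewrite -(integral_iid_sum iid mphi (leqnSn n) M0 mM).
    apply: eq_integral => w _; rewrite /U; congr (_%:E); apply: eq_bigr => i _.
    by rewrite sample_sumE.
  apply: le_trans (iter_avg_le_symavg if_ ma aa f0 n _ cM) _.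
  have := iter_symavg_max_le v0 v1 mal al2 t0 t8 c0 n (fun=> 0).
  rewrite (_ : (fun i => \sum_k v i k * 0) = fun=> 0); last first.
    by apply/funext => i; rewrite big1// => k _; rewrite mulr0.
  move=> /le_trans; apply; rewrite lee_fin.
  rewrite mulr0 expR0 sumr_const -mulr_natl mulr1 -expRM_natl.
  have -> : t * c = 2 * b by rewrite /c mulrCA divff ?mulr1 ?gt_eqF.
  have -> : n%:R * (8 * t ^+ 2) = 8 * b / 9 by rewrite mulrCA t2; field.
  apply: (@le_trans _ _ (c + t^-1 * (expR (- (2 * b)) * expR (8 * b / 9) * expR b))).
    rewrite lerD2l -!mulrA ler_wpM2l ?invr_ge0 ?(ltW t0)//.
    by rewrite !ler_wpM2l ?expR_ge0.
  rewrite -!expRD.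
  have : expR (- (2 * b) + 8 * b / 9 + b) <= 1 by rewrite expR_le1; lra.
  set X := expR _ => X1.
  apply: (@le_trans _ _ ((2 * b + 1) * t^-1)).
    by rewrite mulrDl mul1r lerD2l ler_piMr// invr_ge0 ltW.
  rewrite tV mulrA ler_pdivrMr//; nra.
have es : 0 < 12 * s / e by rewrite divr_gt0// mulr_gt0.
have U0 w : (0 <= U w)%E by rewrite lee_fin bigmax_ge_id.
have := prob_ge_markov mU U0 es EU.
have -> : 12 * s / (12 * s / e) = e by field; rewrite !gt_eqF.
apply: prob_geS => w /= Uw i.
rewrite lte_fin in Uw; apply/ltW; apply: le_lt_trans Uw.
apply: le_trans (le_bigmax _ _ i).
by rewrite /sample_sum /phi sumrB sumr_const card_ord mulr_natl.
Qed.

Lemma abs_subgaussian_integrable k : mu.-integrable setT (EFin \o al k).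
Proof.
have me : measurable_fun setT (fun y => expR (al k y ^+ 2)).
  by apply: (measurableT_comp (@measurable_expR R)); exact: measurable_funX.
apply: integrable_dominated (mal k) _ (ge0_integrable me _ (al2 k)) => y.
  exact: abs_le_expR_sqr.
exact: expR_ge0.
Qed.

Variable l : (K -> R) -> Z -> R.
Hypothesis ml : forall u, measurable_fun setT (l u).
Hypothesis ll : forall u v y, `|l u y - l v y| <= `|\sum_k (u k - v k) * al k y|.
Hypothesis l0 : forall y, l (fun=> 0) y = 0.

Let l_le u y : `|l u y| <= `|\sum_k u k * al k y|.
Proof.
by have := ll u (fun=> 0) y; rewrite l0 subr0; under eq_bigr do rewrite subr0.
Qed.

Let integrable_lin (c : K -> R) :
  mu.-integrable setT (EFin \o (fun y => \sum_k c k * `|al k y|)).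
Proof.
apply: integrable_sum_EFin => k; apply: integrableZ_EFin.
exact: integrable_norm (abs_subgaussian_integrable k).
Qed.

Let integrable_l u : mu.-integrable setT (EFin \o l u).
Proof.
apply: integrable_dominated (ml u) _ (integrable_lin (fun k => `|u k|)) => y.
apply: le_trans (l_le u y) _; apply: le_trans (ler_norm_sum _ _ _) _.
by apply: ler_sum => k _; rewrite normrM.
Qed.

Lemma prob_ge_lipschitz_simplex (e a : R) : 0 < e -> 0 <= a ->
  prob_ge P (1 - (e + e + expR (- a))) [set w | forall u : K -> R,
    (forall k, 0 <= u k) -> \sum_k u k <= 1 ->
    `|sample_sum z (l u) w - n%:R * \int[mu]_y l u y| <=
      12 * Num.sqrt (n%:R * b) / e + 1].
Proof.
move=> e0 a0; have np := n0.
(* Mesh of a grid on the simplex. Rounding weights to the grid costs #|K| (3 + a) n / N on the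
   sample, through |x| <= 1 + x^2 and the bound (2 + a) n on the sums of squares, and 2 #|K| n / N
   in the mean; this N makes the total at most 1. *)
pose N := (Num.truncn (#|K|%:R * n%:R * (5 + a) : R)).+1.
have NR0 : 0 < N%:R :> R by rewrite ltr0n.
have NE : #|K|%:R * n%:R * (5 + a) <= N%:R.
  have h0 : 0 <= #|K|%:R * n%:R * (5 + a) by rewrite !mulr_ge0// addr_ge0.
  by have /andP[_ h1] := truncn_itv h0; exact: ltW.
pose I : finType := {ffun K -> 'I_N.+1}.
(* Grid points of mass above 1 are sent to 0, so that the whole of [I] indexes admissible
   weights. *)
pose v (f : I) k : R := if (\sum_k (f k : nat) <= N)%N then (f k)%:R / N%:R else 0.
have v0 f k : 0 <= v f k by rewrite /v; case: ifP => // _; rewrite divr_ge0.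
have v1 f : \sum_k v f k <= 1.
  rewrite /v; case: (boolP (\sum_k (f k : nat) <= N)%N) => h; last by rewrite big1.
  by rewrite -mulr_suml -natr_sum ler_pdivrMr// mul1r ler_nat.
have A := prob_ge_contraction (f := fun i => l (v i)) v0 v1
  (fun i => integrable_l (v i)) (fun i j => ll (v i) (v j)) (fun i => l_le (v i)) e0.
have B := prob_ge_contraction (f := fun i y => -1 * l (v i) y) v0 v1
  (fun i => integrableZ_EFin (-1) (integrable_l (v i))).
have {}B : prob_ge P (1 - e) [set w | forall i,
    - (sample_sum z (l (v i)) w - n%:R * \int[mu]_y l (v i) y) <=
    12 * Num.sqrt (n%:R * b) / e].
  have B1 (i j : I) y : `|-1 * l (v i) y - -1 * l (v j) y| <=
      `|\sum_k (v i k - v j k) * al k y|.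
    by rewrite -mulrBr normrM normrN1 mul1r.
  have B2 (i : I) y : `|-1 * l (v i) y| <= `|\sum_k v i k * al k y|.
    by rewrite normrM normrN1 mul1r.
  apply: prob_geS (B _ B1 B2 e0) => w /= Bw i.
  have := Bw i; rewrite RintegralZl//.
  by rewrite /sample_sum -mulr_sumr mulrCA -mulrBr mulN1r.
have nN : (0 < n)%N by rewrite -(ltr0n R).
have Kn : #|K|%:R <= expR n%:R :> R by apply: le_trans Kb _; rewrite ler_expR.
have C := prob_ge_sum_sqr iid mal al2 nN a0 Kn.
apply: prob_geS (prob_geI (prob_geI A B) C) => w [[Aw Bw] Cw] u u0 u1.
have uN k : u k <= 1.
  by apply: le_trans u1; rewrite (bigD1 k)//= lerDl sumr_ge0.
(* Rounding down keeps the total mass at most 1. *)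
pose f : I := [ffun k => inord (Num.truncn (N%:R * u k))].
have Nu k : 0 <= N%:R * u k by rewrite mulr_ge0.
have fE k : (f k : nat) = Num.truncn (N%:R * u k).
  rewrite ffunE inordK// ltnS -(ler_nat R).
  have /andP[h _] := truncn_itv (Nu k); apply: le_trans h _.
  by rewrite ler_piMr.
have fle k : (f k)%:R / N%:R <= u k.
  have /andP[h _] := truncn_itv (Nu k).
  by rewrite ler_pdivrMr// mulrC fE.
have fge k : u k <= (f k)%:R / N%:R + N%:R^-1.
  have /andP[_ /ltW h'] := truncn_itv (Nu k); move: h'.
  rewrite -fE -natr1 => h; rewrite -[X in _ + X]mul1r -mulrDl ler_pdivlMr//.
  by rewrite mulrC.
have sf : (\sum_k (f k : nat) <= N)%N.
  rewrite -(ler_nat R) natr_sum -[leRHS]mul1r -ler_pdivrMr// mulr_suml.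
  by apply: le_trans u1; apply: ler_sum.
have vE k : v f k = (f k)%:R / N%:R by rewrite /v sf.
have du k : `|u k - v f k| <= N%:R^-1.
  by rewrite vE ler_norml; have := fle k; have := fge k; have := invr_gt0 (N%:R : R);
     rewrite NR0; lra.
have dl y : `|l u y - l (v f) y| <= \sum_k N%:R^-1 * `|al k y|.
  apply: le_trans (ll _ _ _) _; apply: le_trans (ler_norm_sum _ _ _) _.
  by apply: ler_sum => k _; rewrite normrM ler_wpM2r.
have dS : `|sample_sum z (l u) w - sample_sum z (l (v f)) w| <=
    N%:R^-1 * (#|K|%:R * (3 + a) * n%:R).
  rewrite /sample_sum -sumrB; apply: le_trans (ler_norm_sum _ _ _) _.
  apply: (@le_trans _ _ (\sum_(i < n) \sum_k
      N%:R^-1 * (1 + al k (z (widen_ord (leqnSn n) i) w) ^+ 2))).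
    apply: ler_sum => i _; apply: le_trans (dl _) _; apply: ler_sum => k _.
    rewrite ler_wpM2l ?invr_ge0//; set x := al _ _.
    rewrite -[x ^+ 2]real_normK ?num_real//; have := normr_ge0 x; nra.
  rewrite exchange_big /=; under eq_bigr do rewrite -mulr_sumr.
  rewrite -mulr_sumr ler_wpM2l ?invr_ge0//.
  apply: (@le_trans _ _ (\sum_(k : K) (3 + a) * n%:R)).
    apply: ler_sum => k _; rewrite big_split/= sumr_const card_ord.
    by have := Cw k; rewrite /sample_sum; lra.
  by rewrite sumr_const -[X in X <= _]mulr_natl mulrA.
have dI : `|\int[mu]_y l u y - \int[mu]_y l (v f) y| <= N%:R^-1 * (#|K|%:R * 2).
  rewrite -RintegralB//; have ilu := integrableB_EFin (integrable_l u) (integrable_l (v f)).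
  apply: le_trans (le_normr_Rintegral measurableT ilu) _.
  apply: (@le_trans _ _ (\int[mu]_y \sum_k N%:R^-1 * `|al k y|)).
    exact: (Rintegral_mono (integrable_norm ilu) (integrable_lin (fun=> N%:R^-1)) dl).
  rewrite Rintegral_sum; last first.
    move=> k; apply: integrableZ_EFin.
    exact: integrable_norm (abs_subgaussian_integrable k).
  apply: (@le_trans _ _ (\sum_(k : K) N%:R^-1 * 2)); last first.
    by rewrite -mulr_sumr sumr_const mulr_natl.
  apply: ler_sum => k _; rewrite RintegralZl//; last first.
    exact: integrable_norm (abs_subgaussian_integrable k).
  rewrite ler_wpM2l ?invr_ge0//.
  have mabs : measurable_fun setT (fun y => `|al k y|) by exact: measurableT_comp.
  apply: Rintegral_le => //; apply: le_trans (al2 k).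
  apply: ge0_le_integral => //.
  - exact/measurable_EFinP.
  - apply/measurable_EFinP; apply: (measurableT_comp (@measurable_expR R)).
    exact: measurable_funX.
  - by move=> y _; rewrite lee_fin abs_le_expR_sqr.
have Aw' := Aw f; have Bw' := Bw f.
set rhs := 12 * _ / e in Aw' Bw' *.
have : N%:R^-1 * (#|K|%:R * (3 + a) * n%:R) + n%:R * (N%:R^-1 * (#|K|%:R * 2)) <= 1.
  have -> : N%:R^-1 * (#|K|%:R * (3 + a) * n%:R) + n%:R * (N%:R^-1 * (#|K|%:R * 2)) =
    #|K|%:R * n%:R * (5 + a) / N%:R by ring.
  by rewrite ler_pdivrMr// mul1r.
have dI' : `|n%:R * \int[mu]_y l u y - n%:R * \int[mu]_y l (v f) y| <=
    n%:R * (N%:R^-1 * (#|K|%:R * 2)).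
  by rewrite -mulrBr normrM ger0_norm// ler_wpM2l.
move: dS dI'; rewrite !ler_norml => /andP[dS1 dS2] /andP[dI1 dI2] tot.
by apply/andP; split; lra.
Qed.

End lipschitz_class.

(** * Restricted upper bounds by Maurey's method *)

Section vectors.
Context {R : realType} {p : nat}.
Implicit Types u v x : 'cV[R]_p.

Lemma dotvDl u v x : dotv (u + v) x = dotv u x + dotv v x.
Proof. by rewrite /dotv -big_split; apply: eq_bigr => j _; rewrite mxE mulrDl. Qed.

Lemma dotvZl c u x : dotv (c *: u) x = c * dotv u x.
Proof. by rewrite /dotv mulr_sumr; apply: eq_bigr => j _; rewrite mxE mulrA. Qed.

Lemma dotvBl u v x : dotv (u - v) x = dotv u x - dotv v x.
Proof. by rewrite -scaleN1r dotvDl dotvZl mulN1r. Qed.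

Lemma dotvC u v : dotv u v = dotv v u.
Proof. by apply: eq_bigr => j _; rewrite mulrC. Qed.

Lemma dotv0l x : dotv 0 x = 0.
Proof. by rewrite /dotv big1// => j _; rewrite mxE mul0r. Qed.

Lemma dotv_suml (I : finType) (F : I -> 'cV[R]_p) x :
  dotv (\sum_i F i) x = \sum_i dotv (F i) x.
Proof.
by apply: (big_morph (fun u => dotv u x)) => [u v|]; [exact: dotvDl|exact: dotv0l].
Qed.

Lemma dotvv_ge0 u : 0 <= dotv u u.
Proof. by apply: sumr_ge0 => j _; rewrite -expr2 sqr_ge0. Qed.

Lemma dotvv_eq0 u : dotv u u = 0 -> u = 0.
Proof.
move=> u0; apply/matrixP => j l; rewrite (ord1 l) mxE; apply/eqP.
rewrite -sqrf_eq0 expr2; apply: contra_eqT u0 => uj.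
rewrite gt_eqF// /dotv (bigD1 j)//= ltr_wpDr//.
  by apply: sumr_ge0 => i _; rewrite -expr2 sqr_ge0.
by rewrite lt_neqAle eq_sym uj -expr2 sqr_ge0.
Qed.

Definition norm1 u : R := \sum_j `|u j 0|.

Lemma norm1_ge0 u : 0 <= norm1 u.
Proof. exact: sumr_ge0. Qed.

End vectors.

Section maurey.
Context {R : realType}.

(** Expectation of [G] after m independent steps [u j] drawn with probabilities [pi j], started at
    [v]; as a recursion it needs no probability space of tuples. *)
Fixpoint walk (V : zmodType) (J : finType) (pi : J -> R) (u : J -> V)
    (m : nat) (G : V -> R) (v : V) : R :=
  if m is m'.+1 then \sum_j pi j * walk pi u m' G (v + u j) else G v.

Section walk_lemmas.
Variables (V : zmodType) (J : finType) (pi : J -> R) (u : J -> V).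
Hypotheses (pi0 : forall j, 0 <= pi j) (pi1 : \sum_j pi j = 1).

Lemma walk_ge0 m (G : V -> R) v :
  (forall s : seq J, size s = m -> 0 <= G (v + \sum_(j <- s) u j)) ->
  0 <= walk pi u m G v.
Proof.
elim: m v => [|m IH] v Gs /=; first by have := Gs [::] erefl; rewrite big_nil addr0.
apply: sumr_ge0 => j _; apply: mulr_ge0 => //; apply: IH => s sm.
by have := Gs (j :: s); rewrite /= sm big_cons addrA; exact.
Qed.

Lemma walkB m (G H : V -> R) v :
  walk pi u m (fun v => G v - H v) v = walk pi u m G v - walk pi u m H v.
Proof.
elim: m v => [//|m IH] v /=; rewrite -sumrB; apply: eq_bigr => j _.
by rewrite IH mulrBr.
Qed.

Lemma walkZ m c (G : V -> R) v :
  walk pi u m (fun v => c * G v) v = c * walk pi u m G v.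
Proof.
elim: m v => [//|m IH] v /=; rewrite mulr_sumr; apply: eq_bigr => j _.
by rewrite IH mulrCA.
Qed.

Lemma walk_sum m (I : finType) (G : I -> V -> R) v :
  walk pi u m (fun v => \sum_i G i v) v = \sum_i walk pi u m (G i) v.
Proof.
elim: m v => [//|m IH] v /=; rewrite exchange_big /=; apply: eq_bigr => j _.
by rewrite IH mulr_sumr.
Qed.

Variables (l : V -> R) (y : J -> R).
Hypothesis ly : forall v j, l (v + u j) = l v + y j.

Let m1 := \sum_j pi j * y j.
Let m2 := \sum_j pi j * y j ^+ 2.

(** Squared mean of the walk plus m times the variance of one step. *)
Lemma walk_sqr m v :
  walk pi u m (fun v => l v ^+ 2) v = (l v + m%:R * m1) ^+ 2 + m%:R * (m2 - m1 ^+ 2).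
Proof.
elim: m v => [|m IH] v /=; first by rewrite !mul0r !addr0.
transitivity (\sum_j (pi j * ((l v + m%:R * m1) ^+ 2 + m%:R * (m2 - m1 ^+ 2)) +
    (2 * (l v + m%:R * m1)) * (pi j * y j) + pi j * y j ^+ 2)).
  by apply: eq_bigr => j _; rewrite IH ly; ring.
rewrite !big_split/= -mulr_suml pi1 -mulr_sumr -/m1 -/m2 -natr1; ring.
Qed.

Lemma mean_sqr_le : m1 ^+ 2 <= m2.
Proof.
rewrite -subr_ge0; have -> : m2 - m1 ^+ 2 = \sum_j pi j * (y j - m1) ^+ 2.
  transitivity (\sum_j (pi j * y j ^+ 2 - 2 * m1 * (pi j * y j) + pi j * m1 ^+ 2)).
    by rewrite big_split sumrB/= -mulr_suml pi1 -mulr_sumr -/m1 -/m2; ring.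
  by apply: eq_bigr => j _; ring.
by apply: sumr_ge0 => j _; rewrite mulr_ge0// sqr_ge0.
Qed.

End walk_lemmas.

Variables (p n s : nat) (x : 'I_n -> 'cV[R]_p) (B : R).

Definition atom (j : 'I_p * bool) : 'cV[R]_p := (-1) ^+ j.2 *: delta_mx j.1 0.

(* Maurey's empirical method: D is the mean of |D|_1 times a random signed
   coordinate vector, and averaging s independent copies of it changes the two
   quadratic forms in a controlled way. *)
Lemma maurey_quadratic : (0 < s)%N -> 0 <= B ->
  (forall f : s.-tuple ('I_p * bool), let v := \sum_(j <- f) atom j in
    \sum_i dotv v (x i) ^+ 2 <= B * dotv v v) ->
  forall D, \sum_i dotv D (x i) ^+ 2 <= B * (dotv D D + norm1 D ^+ 2 / s%:R).
Proof.
move=> s0 B0 Bf D.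
have sR0 : 0 < s%:R :> R by rewrite ltr0n.
have [D0|D0] := eqVneq (norm1 D) 0.
  have -> : D = 0.
    apply/matrixP => j l; rewrite (ord1 l) mxE; apply/eqP; rewrite -normr_eq0.
    move/eqP: D0; rewrite /norm1 psumr_eq0// => /allP/(_ j); apply.
    by rewrite mem_index_enum.
  rewrite big1 => [|i _]; last by rewrite dotv0l expr0n.
  by rewrite mulr_ge0// addr_ge0 ?dotvv_ge0// divr_ge0 ?sqr_ge0.
pose rho := norm1 D.
have rho0 : 0 < rho by rewrite lt_neqAle eq_sym D0 norm1_ge0.
pose pi j := `|D j 0| / rho.
have pi0 j : 0 <= pi j by rewrite divr_ge0// ltW.
have pi1 : \sum_j pi j = 1 by rewrite -mulr_suml divff.
pose u j := atom (j, D j 0 < 0).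
have lin (v y : 'cV[R]_p) j : dotv (v + u j) y = dotv v y + dotv (u j) y.
  exact: dotvDl.
have uE j y : dotv (u j) y = (-1) ^+ (D j 0 < 0)%R * y j 0.
  rewrite /u /atom dotvZl; congr (_ * _); rewrite /dotv (bigD1 j)//= big1.
    by rewrite mxE !eqxx mul1r addr0.
  by move=> i ij; rewrite mxE (negbTE ij) mul0r.
have meanE y : \sum_j pi j * dotv (u j) y = dotv D y / rho.
  rewrite [in RHS]/dotv mulr_suml; apply: eq_bigr => j _; rewrite uE /pi.
  rewrite [in RHS](numEsign (D j 0)); set sg := (-1) ^+ _.
  by field; rewrite gt_eqF.
pose G v := B * (\sum_c dotv v (delta_mx c 0) ^+ 2) - \sum_i dotv v (x i) ^+ 2.
have dd v c : dotv v (delta_mx c 0) = v c 0.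
  rewrite /dotv (bigD1 c)//= big1; first by rewrite mxE !eqxx mulr1 addr0.
  by move=> i ic; rewrite mxE (negbTE ic) mulr0.
have {Bf} : 0 <= walk pi u s G 0.
  apply: walk_ge0 => // t ts; rewrite add0r /G subr_ge0.
  have /= := Bf (map_tuple (fun j => (j, D j 0 < 0)) (Tuple (introT eqP ts))).
  rewrite big_map => /le_trans; apply; rewrite ler_wpM2l//.
  rewrite le_eqVlt; apply/orP; left; apply/eqP; apply: eq_bigr => c _.
  by rewrite dd expr2.
rewrite walkB walkZ !walk_sum subr_ge0.
pose m2 y := \sum_j pi j * dotv (u j) y ^+ 2.
have wE y : walk pi u s (fun v => dotv v y ^+ 2) 0 =
    (s%:R * (dotv D y / rho)) ^+ 2 + s%:R * (m2 y - (dotv D y / rho) ^+ 2).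
  by rewrite (walk_sqr pi1 (fun v j => lin v y j)) dotv0l add0r meanE.
under eq_bigr do rewrite wE; under [X in _ <= B * X]eq_bigr do rewrite wE.
move=> H.
(* The walk has mean (s / rho) D, hence this scaling. The variance is dropped on the left; on the
   right it is at most s B, because the atoms are unit vectors. *)
have c0 : 0 < (s%:R / rho) ^+ 2 by rewrite exprn_gt0// divr_gt0.
rewrite -(ler_pM2l c0); apply: le_trans (le_trans _ H) _.
  rewrite mulr_sumr; apply: ler_sum => i _; rewrite -[leLHS]addr0 lerD//.
    by rewrite le_eqVlt; apply/orP; left; apply/eqP; field; rewrite gt_eqF.
  rewrite mulr_ge0// subr_ge0 -meanE.
  exact: mean_sqr_le.
rewrite [leRHS]mulrCA ler_wpM2l//.
have sum2 : \sum_c m2 (delta_mx c 0) = 1.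
  rewrite /m2 exchange_big -pi1; apply: eq_bigr => j _.
  rewrite -mulr_sumr (bigD1 j)//= big1 => [|c cj].
    by rewrite uE mxE !eqxx mulr1 sqrr_sign addr0 mulr1.
  by rewrite uE mxE eq_sym (negbTE cj) mulr0 expr0n.
apply: (@le_trans _ _ (\sum_c ((s%:R * (dotv D (delta_mx c 0) / rho)) ^+ 2 +
    s%:R * m2 (delta_mx c 0)))).
  apply: ler_sum => c _; rewrite lerD2l ler_wpM2l//.
  by rewrite lerBlDr lerDl sqr_ge0.
rewrite big_split/= -mulr_sumr sum2 mulrDr lerD//.
  rewrite /dotv mulr_sumr; apply: ler_sum => c _; rewrite -/(dotv _ _) dd.
  by rewrite le_eqVlt; apply/orP; left; apply/eqP; field; rewrite gt_eqF.
rewrite le_eqVlt; apply/orP; left; apply/eqP; rewrite -/rho; field.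
by rewrite !gt_eqF.
Qed.

End maurey.

Section restricted_upper_bound.
Context {R : realType} {d dz : measure_display}.
Context {Om : measurableType d} {Z : measurableType dz}.
Variables (P : probability Om R) (mu : probability Z R) (n p : nat).
Variable z : 'I_n.+1 -> Om -> Z.
Hypothesis iid : iid_draws P mu z.
Variables (X : Z -> 'cV[R]_p) (th : R).
Hypothesis mX : forall j, measurable_fun setT (fun y => X y j 0).
Hypothesis th0 : 0 < th.
Hypothesis sgX : forall v, dotv v v <= 1 ->
  (\int[mu]_y (expR (th * dotv v (X y) ^+ 2))%:E <= 2%:E)%E.

Lemma measurable_dotv v : measurable_fun setT (fun y => dotv v (X y)).
Proof.
by apply: measurable_sum => j; apply: measurable_funM.
Qed.

Lemma prob_ge_sum_sqr_dotv (I : finType) (v : I -> 'cV[R]_p) (a : R) :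
  (0 < n)%N -> 0 <= a -> #|I|%:R <= expR n%:R :> R ->
  prob_ge P (1 - expR (- a)) [set w | forall i,
    sample_sum z (fun y => dotv (v i) (X y) ^+ 2) w <=
      (2 + a) * n%:R / th * dotv (v i) (v i)].
Proof.
move=> n0 a0 In; have th0' := th0.
(* Since the inverse of 0 is 0, [u i] vanishes together with [v i]. *)
pose u i : 'cV[R]_p := (Num.sqrt (dotv (v i) (v i)))^-1 *: v i.
have u1 i : dotv (u i) (u i) <= 1.
  rewrite dotvZl dotvC dotvZl mulrA -expr2 exprVn sqr_sqrtr ?dotvv_ge0//.
  have [->|v0] := eqVneq (dotv (v i) (v i)) 0; first by rewrite mulr0.
  by rewrite mulVf.
have mu_ i : measurable_fun setT (fun y => Num.sqrt th * dotv (u i) (X y)).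
  by apply: measurable_funM => //; exact: measurable_dotv.
have u2 i : (\int[mu]_y (expR ((Num.sqrt th * dotv (u i) (X y)) ^+ 2))%:E <= 2%:E)%E.
  under eq_integral do rewrite exprMn sqr_sqrtr ?(ltW th0)//.
  exact: sgX.
have := prob_ge_sum_sqr iid mu_ u2 n0 a0 In.
apply: prob_geS => w /= h i; have := h i; rewrite /sample_sum.
have [v0|v0] := eqVneq (dotv (v i) (v i)) 0.
  rewrite v0 mulr0 (dotvv_eq0 v0) => _.
  by rewrite big1// => l _; rewrite dotv0l expr0n.
have vp : 0 < dotv (v i) (v i) by rewrite lt_neqAle eq_sym v0 dotvv_ge0.
under eq_bigr do rewrite exprMn sqr_sqrtr ?(ltW th0)// dotvZl exprMn exprVn
  sqr_sqrtr ?dotvv_ge0//.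
rewrite -!mulr_sumr mulrA -ler_pdivlMl ?divr_gt0// => /le_trans; apply.
by rewrite le_eqVlt; apply/orP; left; apply/eqP; field; rewrite v0 gt_eqF.
Qed.

Lemma prob_ge_restricted_upper (s : nat) (a : R) :
  (0 < n)%N -> (0 < s)%N -> 0 <= a -> ((p * 2) ^ s)%:R <= expR n%:R :> R ->
  prob_ge P (1 - expR (- a)) [set w | forall D,
    sample_sum z (fun y => dotv D (X y) ^+ 2) w <=
      (2 + a) * n%:R / th * (dotv D D + norm1 D ^+ 2 / s%:R)].
Proof.
move=> n0 s0 a0 ps; have th0' := th0.
have In : #|{: s.-tuple ('I_p * bool)}|%:R <= expR n%:R :> R.
  by rewrite card_tuple card_prod card_ord card_bool.
have := prob_ge_sum_sqr_dotv (fun f : s.-tuple ('I_p * bool) => \sum_(j <- f) atom j)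
  n0 a0 In.
apply: prob_geS => w /= h D; apply: maurey_quadratic => //.
by rewrite divr_ge0 ?mulr_ge0 ?addr_ge0// ltW.
Qed.

End restricted_upper_bound.

(** * The sample and the loss *)

Section observations.
Context {R : realType} {dY : measure_display} (Y : measurableType dY).

(** An observation keeps the whole covariate sequence. Equality of laws is assumed on exactly these
    sets, which are stable under intersection and so determine a law. *)
Definition cylinders : set_system (Y * (nat -> R)) :=
  [set C | exists N (B : set Y) (D : nat -> set R), [/\ measurable B,
     forall j, measurable (D j) &
     C = [set x | B x.1 /\ forall j, (j < N)%N -> D j (x.2 j)]]].

Definition observation := g_sigma_algebraType cylinders.

Lemma cylindersI : setI_closed cylinders.
Proof.
move=> _ _ [N [B [D [mB mD ->]]]] [N' [B' [D' [mB' mD' ->]]]].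
exists (maxn N N'), (B `&` B').
exists (fun j => (if (j < N)%N then D j else setT) `&` (if (j < N')%N then D' j else setT)).
split; first exact: measurableI.
  by move=> j; apply: measurableI; case: ifP.
apply/seteqP; split => [x [[Bx Dx] [B'x D'x]]|x [[Bx B'x] DDx]].
  split=> // j _; split; case: ifP => // jN; [exact: Dx|exact: D'x].
split; split => // j jN.
  by have [+ _] := DDx j (leq_trans jN (leq_maxl _ _)); rewrite jN.
by have [_] := DDx j (leq_trans jN (leq_maxr _ _)); rewrite jN.
Qed.

Lemma cylindersT : cylinders setT.
Proof.
exists 0%N, setT, (fun=> setT); split => //.
by apply/seteqP; split => x.
Qed.

Lemma measurable_obs_y : measurable_fun setT (fun x : observation => x.1).
Proof.
move=> _ B mB; rewrite setTI; apply: sub_sigma_algebra.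
exists 0%N, B, (fun=> setT); split => //.
by apply/seteqP; split => [x Bx|x []].
Qed.

Lemma measurable_obs_x j : measurable_fun setT (fun x : observation => x.2 j : R).
Proof.
move=> _ B mB; rewrite setTI; apply: sub_sigma_algebra.
exists j.+1, setT, (fun i => if i == j then B else setT); split => //.
  by move=> i; case: ifP.
apply/seteqP; split => [x Bx|x [_ /(_ j (leqnn _))]]; last by rewrite eqxx.
by split => // i _; case: eqP => [->|].
Qed.

Context {d : measure_display} {Om : measurableType d}.

Lemma measurable_observation (y : Om -> Y) (x : nat -> Om -> R) :
  measurable_fun setT y -> (forall j, measurable_fun setT (x j)) ->
  measurable_fun setT (fun w => (y w, x^~ w) : observation).
Proof.
move=> my mx; apply: (@measurability _ _ Om observation setT _ cylinders) => //.
move=> _ [_ [N [B [D [mB mD ->]]]] <-]; rewrite setTI.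
rewrite (_ : _ @^-1` _ = y @^-1` B `&` \bigcap_(j < N) (x j @^-1` D j)).
  apply: measurableI; first by rewrite -[X in measurable X]setTI; exact: my.
  by apply: bigcap_measurableType => j _; rewrite -[X in measurable X]setTI; exact: mx.
by apply/seteqP; split => w /= [].
Qed.

End observations.

Section sample.
Context {R : realType} {dY dE : measure_display}.
Context {Y : measurableType dY} {E : measurableType dE} {J n : nat}.
Variable S : experiment (R := R) Y E J n.
Hypothesis iidS : iid_sample S.

Definition draw (i : 'I_n.+1) (w : Om S) : observation (R := R) Y :=
  (y_ i w, (x_ (e:=S) i)^~ w).

Lemma measurable_draw i : measurable_fun setT (draw i).
Proof. by have [my mx _ _] := iidS; exact: measurable_observation. Qed.

Definition draw_mfun i : {mfun Om S >-> observation (R := R) Y} :=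
  HB.pack (draw i) (isMeasurableFun.Build _ _ _ _ (draw i) (measurable_draw i)).

Definition law : probability (observation (R := R) Y) R :=
  distribution (Pr S) (draw_mfun first).

Lemma iid_draws_sample : iid_draws (Pr S) law draw.
Proof.
have [my mx ind cyl] := iidS; split; first exact: measurable_draw.
  move=> i B mB; rewrite /law.
  rewrite -[LHS]/(distribution (Pr S) (draw_mfun i) B).
  apply: (@g_sigma_algebra_measure_unique _ R (observation (R := R) Y)
    (@cylinders R dY Y) _ (fun=> setT) _ _ (distribution (Pr S) (draw_mfun i))
    (distribution (Pr S) (draw_mfun first))) => //.
  - exact: sub_sigma_algebra.
  - by move=> _; exact: cylindersT.
  - by rewrite bigcup_const.
  - exact: cylindersI.
  - move=> _ [N [C [D [mC mD ->]]]].
    have preE k : [set w | [set x : observation Y | C x.1 /\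
        forall j, (j < N)%N -> D j (x.2 j)] (draw k w)] =
        y_ k @^-1` C `&` \bigcap_(j < N) (x_ k j @^-1` D j).
      by apply/seteqP; split => w /= [].
    apply: (etrans (congr1 (Pr S) (preE i))).
    apply: (etrans (cyl i N C D mC mD)).
    exact: (esym (congr1 (Pr S) (preE first))).
  - by move=> _; rewrite (le_lt_trans (probability_le1 _ _)) ?ltry.
move=> I A IA; apply: ind => i iI; have [B mB ->] := IA i iI.
have mgen : measurable_fun setT
    (fun w : g_sigma_algebraType (obs_gen (S := S) i) => draw i (w : Om S)).
  apply: measurable_observation => [|j] _ C mC; rewrite setTI;
    apply: sub_sigma_algebra.
    by left; exists C.
  by right; exists j; exists C.
by have := mgen measurableT B mB; rewrite setTI.
Qed.

End sample.

Section subgaussian_moments.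
Context {R : realType} {dz : measure_display} {Z : measurableType dz}.
Variables (mu : probability Z R) (th : R).
Hypothesis th0 : 0 < th.

(** The mean of f^2 is read off from th f^2 <= exp(th f^2) - 1. *)
Lemma subgaussian_sqr (f : Z -> R) : measurable_fun setT f ->
  (\int[mu]_y (expR (th * f y ^+ 2))%:E <= 2%:E)%E ->
  mu.-integrable setT (EFin \o (fun y => f y ^+ 2)) /\
  \int[mu]_y f y ^+ 2 <= th^-1.
Proof.
move=> mf f2; have th0' := th0.
have mf2 : measurable_fun setT (fun y => f y ^+ 2) by exact: measurable_funX.
have me : measurable_fun setT (fun y => expR (th * f y ^+ 2)).
  by apply: (measurableT_comp (@measurable_expR R)); exact: measurable_funM.
have ie : mu.-integrable setT (EFin \o (fun y => expR (th * f y ^+ 2))).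
  by apply: ge0_integrable me _ f2 => y; exact: expR_ge0.
have e2 : \int[mu]_y expR (th * f y ^+ 2) <= 2.
  by apply: Rintegral_le => // y; exact: expR_ge0.
have ib := integrableZ_EFin th^-1 (integrableB_EFin ie (integrable_cst mu 1)).
have bnd y : f y ^+ 2 <= th^-1 * (expR (th * f y ^+ 2) - 1).
  rewrite ler_pdivlMl//; have := expR_ge1Dx (th * f y ^+ 2); lra.
have i2 : mu.-integrable setT (EFin \o (fun y => f y ^+ 2)).
  by apply: integrable_dominated mf2 _ ib => y; rewrite ger0_norm ?sqr_ge0.
split => //; apply: le_trans (Rintegral_mono i2 ib bnd) _.
rewrite RintegralZl//; last exact: (integrableB_EFin ie (integrable_cst mu 1)).
rewrite RintegralB//; last exact: (integrable_cst mu 1).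
rewrite Rintegral_cstT ler_piMr ?invr_ge0 ?(ltW th0)//; lra.
Qed.

Context {p : nat}.
Variable X : Z -> 'cV[R]_p.
Hypothesis mX : forall j, measurable_fun setT (fun y => X y j 0).
Hypothesis sgX : forall v, dotv v v <= 1 ->
  (\int[mu]_y (expR (th * dotv v (X y) ^+ 2))%:E <= 2%:E)%E.

Lemma dotv_second_moment v :
  mu.-integrable setT (EFin \o (fun y => dotv v (X y) ^+ 2)) /\
  \int[mu]_y dotv v (X y) ^+ 2 <= dotv v v / th.
Proof.
have [v0|v0] := eqVneq (dotv v v) 0.
  have -> : (fun y => dotv v (X y) ^+ 2) = (fun=> 0).
    by apply/funext => y; rewrite (dotvv_eq0 v0) dotv0l expr0n.
  by rewrite Rintegral_cstT v0 mul0r; split => //; exact: (integrable_cst mu 0).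
have vp : 0 < dotv v v by rewrite lt_neqAle eq_sym v0 dotvv_ge0.
pose u := (Num.sqrt (dotv v v))^-1 *: v.
have uu : dotv u u <= 1.
  by rewrite dotvZl dotvC dotvZl mulrA -expr2 exprVn sqr_sqrtr ?dotvv_ge0// mulVf.
have [iu uth] := subgaussian_sqr (measurable_dotv mX u) (sgX uu).
have vu y : dotv v (X y) ^+ 2 = dotv v v * dotv u (X y) ^+ 2.
  by rewrite dotvZl exprMn exprVn sqr_sqrtr ?dotvv_ge0// mulrA divff ?mul1r.
have -> : (fun y => dotv v (X y) ^+ 2) = (fun y => dotv v v * dotv u (X y) ^+ 2).
  by apply/funext => y; rewrite vu.
split; first exact: integrableZ_EFin.
by rewrite RintegralZl// ler_wpM2l// dotvv_ge0.
Qed.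

End subgaussian_moments.

Section loss.
Context {R : realType} {dY : measure_display} {Y : measurableType dY}.
Variables (L : Y -> R -> R) (G : Y -> R).

(* Common consequence of the two alternatives for the loss; the Cauchy-Schwarz
   step of the argument is already built in through the free parameter t. *)
Definition loss_modulus : Prop := forall y a b t, 0 < t ->
  `|L y a - L y b| <= t * (G y ^+ 2 + b ^+ 2) + (t^-1 + 1) * (a - b) ^+ 2.

Hypothesis LG : loss_modulus.

Context {dz : measure_display} {Z : measurableType dz}.
Variables (mu : probability Z R) (th : R) (p : nat).
Variables (X : Z -> 'cV[R]_p) (yv : Z -> Y).
Hypothesis th0 : 0 < th.
Hypothesis mX : forall j, measurable_fun setT (fun y => X y j 0).
Hypothesis sgX : forall v, dotv v v <= 1 ->
  (\int[mu]_y (expR (th * dotv v (X y) ^+ 2))%:E <= 2%:E)%E.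
Hypothesis my : measurable_fun setT yv.
Hypothesis mG : measurable_fun setT (fun y => G (yv y)).
Hypothesis sgG : (\int[mu]_y (expR (th * G (yv y) ^+ 2))%:E <= 2%:E)%E.
Hypothesis mL : measurable_fun setT (fun z : Y * R => L z.1 z.2).

Definition lossv (b : 'cV[R]_p) (y : Z) : R := L (yv y) (dotv b (X y)).

Lemma measurable_lossv b : measurable_fun setT (lossv b).
Proof.
have h : measurable_fun setT (fun y => (yv y, dotv b (X y))).
  by apply: measurable_fun_pair => //; exact: measurable_dotv.
exact: (measurableT_comp mL h).
Qed.

Let bound t b D y := t * (G (yv y) ^+ 2 + dotv b (X y) ^+ 2) + (t^-1 + 1) * dotv D (X y) ^+ 2.

Let lossvB t b b' y : 0 < t -> `|lossv b y - lossv b' y| <= bound t b' (b - b') y.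
Proof.
by move=> t0; apply: le_trans (LG _ _ _ t0) _; rewrite /bound dotvBl.
Qed.

Let bound_integrable t b D : 0 < t -> mu.-integrable setT (EFin \o bound t b D) /\
  \int[mu]_y bound t b D y <= t / th * (1 + dotv b b) + (t^-1 + 1) / th * dotv D D.
Proof.
move=> t0.
have [iG G2] := subgaussian_sqr th0 mG sgG.
have [ib b2] := dotv_second_moment th0 mX sgX b.
have [iD D2] := dotv_second_moment th0 mX sgX D.
have i1 := integrableZ_EFin t (integrableD_EFin iG ib).
have i2 := integrableZ_EFin (t^-1 + 1) iD.
split; first exact: integrableD_EFin.
rewrite /bound RintegralD// !RintegralZl//; last exact: integrableD_EFin.
rewrite RintegralD//; apply: lerD.
  rewrite -mulrA ler_wpM2l ?(ltW t0)// mulrDr mulr1 lerD//.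
  by rewrite mulrC.
rewrite -mulrA ler_wpM2l ?addr_ge0 ?invr_ge0 ?(ltW t0)//.
by rewrite mulrC.
Qed.

Lemma lossv_integrable b b' : mu.-integrable setT (EFin \o lossv b') ->
  mu.-integrable setT (EFin \o lossv b).
Proof.
move=> ib'; have [iB _] := bound_integrable b' (b - b') ltr01.
apply: integrable_dominated (measurable_lossv b) _
  (integrableD_EFin (integrable_norm ib') iB) => y /=.
have := lossvB b b' y ltr01.
have := ler_normD (lossv b' y) (lossv b y - lossv b' y); rewrite addrC subrK; lra.
Qed.

(** The parameter of the modulus is taken equal to the bound t on the distance: then (1/t + 1) t^2 =
    t + t^2, and both terms are of order t. *)
Lemma pop_loss_close b b' t : mu.-integrable setT (EFin \o lossv b) -> 0 < t ->
  dotv (b - b') (b - b') <= t ^+ 2 ->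
  `|\int[mu]_y lossv b y - \int[mu]_y lossv b' y| <= t / th * (2 + dotv b' b' + t).
Proof.
move=> ib t0 dt; have th0' := th0.
have ib' := lossv_integrable b' ib.
have [iB B2] := bound_integrable b' (b - b') t0.
have iD := integrableB_EFin ib ib'.
rewrite -RintegralB//.
apply: le_trans (le_normr_Rintegral measurableT iD) _.
apply: le_trans (Rintegral_mono (integrable_norm iD) iB (fun y => lossvB b b' y t0)) _.
apply: le_trans B2 _.
have c0 : 0 <= (t^-1 + 1) / th by rewrite divr_ge0 ?addr_ge0 ?invr_ge0 ?(ltW t0) ?(ltW th0).
apply: (@le_trans _ _ (t / th * (1 + dotv b' b') + (t^-1 + 1) / th * t ^+ 2)).
  by rewrite lerD2l ler_wpM2l.
rewrite le_eqVlt; apply/orP; left; apply/eqP; field.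
by rewrite !gt_eqF.
Qed.

(** Here [b'] varies with the observation, because cross-validation scores each one with the
    estimator that leaves out its own fold. *)
Lemma emp_loss_close (I : finType) (zs : I -> Z) (b : 'cV[R]_p) (b' : I -> 'cV[R]_p)
    (t N A : R) : 0 < t -> 0 <= N ->
  \sum_i G (yv (zs i)) ^+ 2 <= N * A -> \sum_i dotv b (X (zs i)) ^+ 2 <= N * A ->
  \sum_i dotv (b' i - b) (X (zs i)) ^+ 2 <= N * (A * t ^+ 2) ->
  `|\sum_i lossv (b' i) (zs i) - \sum_i lossv b (zs i)| <= N * (A * t * (3 + t)).
Proof.
move=> t0 N0 hG hb hD; rewrite -sumrB.
apply: le_trans (ler_norm_sum _ _ _) _.
apply: (@le_trans _ _ (\sum_i bound t b (b' i - b) (zs i))).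
  by apply: ler_sum => i _; exact: lossvB.
rewrite /bound big_split/= -!mulr_sumr big_split/=.
have c0 : 0 <= t^-1 + 1 by rewrite addr_ge0 ?invr_ge0 ?(ltW t0).
have := ler_wpM2l c0 hD; have := ler_wpM2l (ltW t0) (lerD hG hb).
have -> : (t^-1 + 1) * (N * (A * t ^+ 2)) = N * (A * t) * (1 + t).
  by field; rewrite gt_eqF.
have -> : t * (N * A + N * A) = N * (A * t) * 2 by ring.
have -> : N * (A * t * (3 + t)) = N * (A * t) * 2 + N * (A * t) * (1 + t) by ring.
lra.
Qed.

End loss.

(** * The empirical process at the pseudo-true values *)

Section deviation.
Context {R : realType} {d dz : measure_display}.
Context {Om : measurableType d} {Z : measurableType dz}.
Variables (mu : probability Z R) (n : nat) (z : 'I_n.+1 -> Om -> Z).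

Definition deviation (f : Z -> R) (w : Om) : R :=
  sample_sum z f w - n%:R * \int[mu]_y f y.

Lemma deviation_lin (I : finType) (c : I -> R) (f : I -> Z -> R) w :
  (forall i, mu.-integrable setT (EFin \o f i)) ->
  deviation (fun y => \sum_i c i * f i y) w = \sum_i c i * deviation (f i) w.
Proof.
move=> fi; rewrite /deviation Rintegral_sum; last by move=> i; exact: integrableZ_EFin.
rewrite /sample_sum exchange_big mulr_sumr -sumrB; apply: eq_bigr => i _.
by rewrite RintegralZl// mulrBr mulr_sumr mulrCA.
Qed.

Lemma deviation_lin_le (I : finType) (c : I -> R) (f : I -> Z -> R) w M :
  (forall i, mu.-integrable setT (EFin \o f i)) ->
  (forall i, `|deviation (f i) w| <= M) ->
  `|deviation (fun y => \sum_i c i * f i y) w| <= (\sum_i `|c i|) * M.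
Proof.
move=> fi fM; rewrite deviation_lin// mulr_suml.
apply: le_trans (ler_norm_sum _ _ _) _; apply: ler_sum => i _.
by rewrite normrM ler_wpM2l.
Qed.

End deviation.

Section empirical_process.
Context {R : realType} {d dz dY : measure_display}.
Context {Om : measurableType d} {Z : measurableType dz} {Y : measurableType dY}.
Variables (P : probability Om R) (mu : probability Z R) (n p : nat).
Variable z : 'I_n.+1 -> Om -> Z.
Hypothesis iid : iid_draws P mu z.
Variables (X : Z -> 'cV[R]_p) (yv : Z -> Y) (th : R) (L : Y -> R -> R).
Hypothesis th0 : 0 < th.
Hypothesis mX : forall j, measurable_fun setT (fun y => X y j 0).
Hypothesis sgX : forall v, dotv v v <= 1 ->
  (\int[mu]_y (expR (th * dotv v (X y) ^+ 2))%:E <= 2%:E)%E.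
Hypothesis my : measurable_fun setT yv.
Hypothesis mL : measurable_fun setT (fun z : Y * R => L z.1 z.2).
Variables (K : finType) (b : K -> 'cV[R]_p) (sg lam a : R).
Hypothesis sg0 : 0 < sg.
Hypothesis bsg : forall k, dotv (b k) (b k) <= sg ^+ 2.
Hypotheses (a0 : 0 <= a) (lam12 : 1 / 2 <= lam) (Klam : #|K|%:R <= expR lam).

Let comb (u : K -> R) := \sum_k u k *: b k.

Let sgb k : (\int[mu]_y (expR (th * (dotv (b k) (X y) / sg) ^+ 2))%:E <= 2%:E)%E.
Proof.
have -> : (fun y => (expR (th * (dotv (b k) (X y) / sg) ^+ 2))%:E) =
    (fun y => (expR (th * dotv (sg^-1 *: b k) (X y) ^+ 2))%:E).
  by apply/funext => y; rewrite dotvZl [_ / sg]mulrC.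
apply: sgX; rewrite dotvZl dotvC dotvZl mulrA -expr2 exprVn ler_pdivrMl ?exprn_gt0//.
by rewrite mulr1.
Qed.

Let mbX k : measurable_fun setT (fun y => dotv (b k) (X y) / sg).
Proof. by apply: measurable_funM => //; exact: measurable_dotv. Qed.

(** A product of two sub-gaussian variables is sub-exponential: |f g| <= (f^2 + g^2) / 2, and exp((x
    + y) / 2) is at most the mean of exp x and exp y. *)
Lemma exp_abs_le (W f g : Z -> R) : measurable_fun setT W ->
  measurable_fun setT f -> measurable_fun setT g ->
  (\int[mu]_y (expR (th * f y ^+ 2))%:E <= 2%:E)%E ->
  (\int[mu]_y (expR (th * g y ^+ 2))%:E <= 2%:E)%E ->
  (forall y, W y = th * (f y * g y)) ->
  (\int[mu]_y (expR `|W y|)%:E <= 2%:E)%E.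
Proof.
move=> mW mf mg f2 g2 WE; have th0' := th0.
have me (h : Z -> R) : measurable_fun setT h -> measurable_fun setT (fun y => expR (th * h y ^+ 2)).
  move=> mh; apply: (measurableT_comp (@measurable_expR R)).
  by apply: measurable_funM => //; exact: measurable_funX.
have ie (h : Z -> R) : measurable_fun setT h -> (\int[mu]_y (expR (th * h y ^+ 2))%:E <= 2%:E)%E ->
    mu.-integrable setT (EFin \o (fun y => expR (th * h y ^+ 2))) /\
    \int[mu]_y expR (th * h y ^+ 2) <= 2.
  move=> mh h2; split; first by apply: ge0_integrable (me _ mh) _ h2 => y; exact: expR_ge0.
  by apply: Rintegral_le (me _ mh) _ h2 => y; exact: expR_ge0.
have [ief f2'] := ie f mf f2; have [ieg g2'] := ie g mg g2.
have ib := integrableZ_EFin 2^-1 (integrableD_EFin ief ieg).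
have bnd y : expR `|W y| <= 2^-1 * (expR (th * f y ^+ 2) + expR (th * g y ^+ 2)).
  set A := expR (th * f y ^+ 2 / 2); set B := expR (th * g y ^+ 2 / 2).
  have -> : expR (th * f y ^+ 2) = A * A by rewrite -expRD; congr expR; field.
  have -> : expR (th * g y ^+ 2) = B * B by rewrite -expRD; congr expR; field.
  have : expR `|W y| <= A * B.
    rewrite -expRD ler_expR WE normrM gtr0_norm// normrM.
    rewrite -[f y ^+ 2]real_normK ?num_real// -[g y ^+ 2]real_normK ?num_real//.
    have := sqr_ge0 (`|f y| - `|g y|); rewrite !expr2; nra.
  have := sqr_ge0 (A - B); rewrite expr2; lra.
apply: (@le_trans _ _ (\int[mu]_y
    (2^-1 * (expR (th * f y ^+ 2) + expR (th * g y ^+ 2)))%:E)%E).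
  apply: ge0_le_integral => //.
  - apply/measurable_EFinP; apply: (measurableT_comp (@measurable_expR R)).
    exact: measurableT_comp.
  - by move/integrableP: ib => [].
  - by move=> y _; rewrite lee_fin.
rewrite EFin_Rintegral// lee_fin RintegralZl//; last exact: integrableD_EFin.
by rewrite RintegralD//; lra.
Qed.

(** The loss difference is -e <b_u, X> + <b_u, X>^2 / 2, a polynomial in u with coefficients u_k and
    u_k u_l. Each family sums to 1 on the simplex, so the largest deviation of a coefficient
    variable controls all u at once; dividing the b_k by sg makes the factor sg appear. *)
Lemma emp_process_square (e : Y -> R) :
  (forall y m, L y m = 1 / 2 * (e y - m) ^+ 2) ->
  measurable_fun setT (fun y => e (yv y)) ->
  (\int[mu]_y (expR (th * e (yv y) ^+ 2))%:E <= 2%:E)%E ->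
  (6 + 2 * a) * lam <= n%:R ->
  prob_ge P (1 - expR (- a)) [set w | forall u : K -> R,
    (forall k, 0 <= u k) -> \sum_k u k = 1 ->
    `|deviation mu z (fun y => lossv L X yv (comb u) y - lossv L X yv 0 y) w| <=
      66 * (1 + sg) * Num.sqrt (6 + 2 * a) / th * (sg * Num.sqrt (n%:R * lam))].
Proof.
move=> LE me e2 lamn; have lam12' := lam12; have a0' := a0; have sg0' := sg0.
have th0' := th0.
pose W (i : K + K * K) y := match i with
  | inl k => th * (e (yv y) * (dotv (b k) (X y) / sg))
  | inr kl => th * (dotv (b kl.1) (X y) / sg * (dotv (b kl.2) (X y) / sg)) end.
have mW i : measurable_fun setT (W i).
  by case: i => [k|[k l]] /=; apply: measurable_funM => //; apply: measurable_funM.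
have W2 i : (\int[mu]_y (expR `|W i y|)%:E <= 2%:E)%E.
  case: i (mW i) => [k|[k l]] mWi.
    exact: (exp_abs_le mWi me (mbX k) e2 (sgb k)).
  exact: (exp_abs_le mWi (mbX k) (mbX l) (sgb k) (sgb l)).
have iW i : mu.-integrable setT (EFin \o W i).
  have mabs : measurable_fun setT (fun y => expR `|W i y|).
    apply: (measurableT_comp (@measurable_expR R)); exact: measurableT_comp.
  apply: integrable_dominated (mW i) _ (ge0_integrable mabs _ (W2 i)) => y.
    by have := expR_ge1Dx `|W i y|; lra.
  exact: expR_ge0.
(* The exponent 2 lam pays for the #|K| + #|K|^2 variables up to a factor 2. Since lam >= 1/2, the
   remaining (4 + 2 a) lam is at least 2 + a, and exp(-2) <= 1/4 absorbs that factor and the one for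
   two-sided tails. *)
pose bb := (6 + 2 * a) * lam.
have bb0 : 0 < bb by rewrite /bb mulr_gt0//; lra.
have nR0 : 0 < n%:R :> R by exact: lt_le_trans bb0 lamn.
have nN : (0 < n)%N by rewrite -(ltr0n R).
have bbn : 0 < bb <= n%:R by rewrite bb0.
have card : 2 * #|{: K + K * K}|%:R * expR (- bb) <= expR (- a).
  rewrite card_sum card_prod natrD natrM.
  have k0 : 0 <= #|K|%:R :> R by [].
  set k : R := #|K|%:R in k0 *.
  have [k1|k1] := ltP k 1.
    have -> : k = 0.
      apply/eqP; rewrite /k pnatr_eq0; move: k1; rewrite /k -[1]/(1%:R) ltr_nat.
      by case: #|K|.
    by rewrite mulr0 addr0 mulr0 mul0r expR_ge0.
  have kl : k <= expR lam by exact: Klam.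
  have eb : expR (- bb) = expR (- (2 * lam)) * expR (- ((4 + 2 * a) * lam)).
    by rewrite -expRD; congr expR; rewrite /bb; ring.
  have h1 : (k + k * k) * expR (- (2 * lam)) <= 2.
    have -> : expR (- (2 * lam)) = (expR lam)^-1 ^+ 2.
      by rewrite -expRN expr2 -expRD; congr expR; ring.
    rewrite exprVn ler_pdivrMr ?exprn_gt0 ?expR_gt0// expr2; nra.
  have h2 : expR (- ((4 + 2 * a) * lam)) <= expR (- a) * (1 / 4).
    apply: (@le_trans _ _ (expR (- a) * expR (- 2))).
      by rewrite -expRD ler_expR; nra.
    rewrite ler_wpM2l ?expR_ge0//.
    have -> : - 2 = - 1 + - 1 :> R by ring.
    have : expR (- 1) <= 1 / 2 :> R.
      by rewrite expRN -[1 / 2]invrK lef_pV2 ?posrE ?expR_gt0//;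
         have := expR_ge1Dx (1 : R); lra.
    have := expR_ge0 (- 1 : R); rewrite expRD; nra.
  have h0 : 0 <= (k + k * k) * expR (- (2 * lam)).
    by rewrite mulr_ge0 ?expR_ge0 ?addr_ge0 ?mulr_ge0.
  rewrite eb; have := ler_pM h0 (expR_ge0 _) h1 h2; lra.
have := prob_ge_bernstein iid mW W2 nN bbn card.
apply: prob_geS => w /= H u u0 u1.
pose c (i : K + K * K) := match i with
  | inl k => - (u k * (sg / th))
  | inr kl => u kl.1 * u kl.2 * (sg ^+ 2 / (2 * th)) end.
have uX y : dotv (comb u) (X y) = \sum_k u k * dotv (b k) (X y).
  by rewrite dotv_suml; apply: eq_bigr => k _; rewrite dotvZl.
have -> : (fun y => lossv L X yv (comb u) y - lossv L X yv 0 y) =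
    (fun y => \sum_i c i * W i y).
  apply/funext => y; rewrite /lossv !LE dotv0l big_sumType/= -(pair_bigA _ (fun k l =>
    u k * u l * (sg ^+ 2 / (2 * th)) *
    (th * (dotv (b k) (X y) / sg * (dotv (b l) (X y) / sg)))))/=.
  have -> : \sum_i - (u i * (sg / th)) * (th * (e (yv y) * (dotv (b i) (X y) / sg))) =
      - e (yv y) * dotv (comb u) (X y).
    rewrite uX mulr_sumr; apply: eq_bigr => k _; field.
    by rewrite !gt_eqF.
  have -> : \sum_k \sum_l u k * u l * (sg ^+ 2 / (2 * th)) *
    (th * (dotv (b k) (X y) / sg * (dotv (b l) (X y) / sg))) =
      1 / 2 * dotv (comb u) (X y) ^+ 2.
    rewrite [dotv _ _ ^+ 2]expr2 uX mulr_suml mulr_sumr; apply: eq_bigr => k _.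
    rewrite 2!mulr_sumr; apply: eq_bigr => l _; field.
    by rewrite !gt_eqF.
  by field.
have H' i : `|deviation mu z (W i) w| <= 66 * Num.sqrt (n%:R * bb) by exact: H.
apply: le_trans (deviation_lin_le _ iW H') _.
have cs : \sum_i `|c i| = sg / th + sg ^+ 2 / (2 * th).
  rewrite big_sumType/= -(pair_bigA _ (fun k l => `|u k * u l * (sg ^+ 2 / (2 * th))|))/=.
  have t1 : 0 <= sg / th by rewrite divr_ge0 ?ltW.
  have t2 : 0 <= sg ^+ 2 / (2 * th) by rewrite divr_ge0 ?sqr_ge0 ?mulr_ge0 ?ltW.
  congr (_ + _).
    transitivity (\sum_k u k * (sg / th)); last by rewrite -mulr_suml u1 mul1r.
    by apply: eq_bigr => k _; rewrite normrN ger0_norm// mulr_ge0.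
  transitivity (\sum_k u k * (sg ^+ 2 / (2 * th))); last by rewrite -mulr_suml u1 mul1r.
  apply: eq_bigr => k _.
  transitivity (\sum_l u k * u l * (sg ^+ 2 / (2 * th))).
    by apply: eq_bigr => l _; rewrite ger0_norm// mulr_ge0// mulr_ge0.
  by rewrite -mulr_suml -mulr_sumr u1 mulr1.
rewrite cs; set s1 := Num.sqrt (6 + _); set s2 := Num.sqrt (n%:R * lam).
have -> : Num.sqrt (n%:R * bb) = s1 * s2.
  by rewrite /bb mulrCA sqrtrM// addr_ge0// mulr_ge0.
have -> : 66 * (1 + sg) * s1 / th * (sg * s2) =
    (sg / th + sg ^+ 2 / th) * (66 * (s1 * s2)) by field; rewrite gt_eqF.
rewrite ler_wpM2r ?mulr_ge0 ?sqrtr_ge0// lerD2l ler_wpM2l ?sqr_ge0//.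
by rewrite lef_pV2 ?posrE ?mulr_gt0//; lra.
Qed.

(** Markov's inequality is used at level exp(-a), once for each sign, whence the factor exp a in the
    constant. *)
Lemma emp_process_lipschitz (Lu : R) : 0 < Lu ->
  (forall y m1 m2, `|L y m1 - L y m2| <= Lu * `|m1 - m2|) ->
  (forall v, mu.-integrable setT (EFin \o lossv L X yv v)) ->
  lam <= n%:R ->
  prob_ge P (1 - 3 * expR (- a)) [set w | forall u : K -> R,
    (forall k, 0 <= u k) -> \sum_k u k = 1 ->
    `|deviation mu z (fun y => lossv L X yv (comb u) y - lossv L X yv 0 y) w| <=
      (12 * expR a + 2) * Lu / Num.sqrt th * (sg * Num.sqrt (n%:R * lam))].
Proof.
move=> Lu0 LL iL lamn; have lam12' := lam12; have a0' := a0; have sg0' := sg0.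
have st0 : 0 < Num.sqrt th by rewrite sqrtr_gt0.
pose al k y := Num.sqrt th * (dotv (b k) (X y) / sg).
have mal k : measurable_fun setT (al k) by apply: measurable_funM => //.
have al2 k : (\int[mu]_y (expR (al k y ^+ 2))%:E <= 2%:E)%E.
  have -> : (fun y => (expR (al k y ^+ 2))%:E) =
      (fun y => (expR (th * (dotv (b k) (X y) / sg) ^+ 2))%:E).
    by apply/funext => y; rewrite /al exprMn sqr_sqrtr// ltW.
  exact: sgb.
(* This scaling turns the loss differences into contractions of the linear forms in [al], whose
   squares have exponential moment at most 2. *)
pose c := Num.sqrt th / (Lu * sg).
have c0 : 0 < c by rewrite divr_gt0// mulr_gt0.
pose l u y := c * (lossv L X yv (comb u) y - lossv L X yv 0 y).
have uX u y : dotv (comb u) (X y) = \sum_k u k * dotv (b k) (X y).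
  by rewrite dotv_suml; apply: eq_bigr => k _; rewrite dotvZl.
have ml u : measurable_fun setT (l u).
  by apply: measurable_funM => //; apply: measurable_funB; exact: measurable_lossv.
have ll u v y : `|l u y - l v y| <= `|\sum_k (u k - v k) * al k y|.
  rewrite /l -mulrBr normrM (gtr0_norm c0) opprB addrA subrK.
  have -> : \sum_k (u k - v k) * al k y =
      Num.sqrt th / sg * (dotv (comb u) (X y) - dotv (comb v) (X y)).
    rewrite !uX -sumrB mulr_sumr; apply: eq_bigr => k _; rewrite /al; field.
    by rewrite gt_eqF.
  rewrite normrM (gtr0_norm (divr_gt0 st0 sg0)).
  have -> : Num.sqrt th / sg = c * Lu by rewrite /c; field; rewrite !gt_eqF.
  by rewrite -[leRHS]mulrA ler_pM2l//; exact: LL.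
have l0 y : l (fun=> 0) y = 0.
  have c00 : comb (fun=> 0) = 0 by rewrite /comb big1// => k _; rewrite scale0r.
  by rewrite /l c00 subrr mulr0.
have := prob_ge_lipschitz_simplex iid mal al2 lam12 lamn Klam ml ll l0
  (expR_gt0 (- a)) a0.
have -> : expR (- a) + expR (- a) + expR (- a) = 3 * expR (- a) by ring.
apply: prob_geS => w /= H u u0 u1.
have := H u u0; rewrite u1 lexx => /(_ isT).
have id : mu.-integrable setT
   (EFin \o (fun y => lossv L X yv (comb u) y - lossv L X yv 0 y)).
  exact: integrableB_EFin.
rewrite /l RintegralZl// /sample_sum -mulr_sumr mulrCA -mulrBr normrM (gtr0_norm c0).
rewrite -ler_pdivlMl// => /le_trans; apply.
set s := Num.sqrt (n%:R * lam).
have nl : 1 / 2 <= n%:R * lam :> R.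
  have n0 : (0 < n)%N by rewrite -(ltr0n R); lra.
  have : 1 <= n%:R :> R by rewrite ler1n.
  by nra.
(* The discretization error 1 is absorbed by the main term, because n lam >= 1/2. *)
have s1 : 1 <= 2 * s.
  have : 1 / 2 <= s; last by lra.
  rewrite -[1 / 2]ger0_norm// -sqrtr_sqr ler_sqrt; first by rewrite expr2; lra.
  lra.
have -> : c^-1 * (12 * s / expR (- a) + 1) =
    (12 * expR a * s + 1) * (Lu / Num.sqrt th * sg).
  rewrite /c expRN; field.
  by rewrite !gt_eqF ?expR_gt0.
have -> : (12 * expR a + 2) * Lu / Num.sqrt th * (sg * s) =
  (12 * expR a * s + 2 * s) * (Lu / Num.sqrt th * sg) by ring.
by rewrite ler_wpM2r ?lerD2l// !mulr_ge0 ?invr_ge0// ltW.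
Qed.

End empirical_process.

(** * Rates *)

Section norms.
Context {R : realType} {m : nat}.
Implicit Type v : 'cV[R]_m.

Lemma lqnorm2E v : lqnorm 2 v = Num.sqrt (dotv v v).
Proof.
rewrite /lqnorm -powR12_sqrt ?dotvv_ge0//; congr powR; apply: eq_bigr => j _.
by rewrite powR_mulrn// real_normK ?num_real// expr2.
Qed.

Lemma lqnorm2_le v c : 0 <= c -> lqnorm 2 v <= c -> dotv v v <= c ^+ 2.
Proof.
move=> c0; rewrite lqnorm2E => h; rewrite -[leLHS]sqr_sqrtr ?dotvv_ge0//.
by rewrite ler_pXn2r// nnegrE sqrtr_ge0.
Qed.

Lemma lqnorm1E v : lqnorm 1 v = norm1 v.
Proof.
rewrite /lqnorm invr1 powRr1; first by apply: eq_bigr => j _; rewrite powRr1.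
by apply: sumr_ge0 => j _; exact: powR_ge0.
Qed.

Lemma lqnorm_powR q v : 0 < q -> lqnorm q v `^ q = \sum_j `|v j 0| `^ q.
Proof.
move=> q0; rewrite /lqnorm -powRrM mulVf ?gt_eqF// powRr1//.
by apply: sumr_ge0 => j _; exact: powR_ge0.
Qed.

Lemma coord_sqr_le v j : v j 0 ^+ 2 <= dotv v v.
Proof.
rewrite /dotv (bigD1 j)//= -expr2 lerDl; apply: sumr_ge0 => i _.
by rewrite -expr2 sqr_ge0.
Qed.

(** No entry exceeds B in modulus, so v_j^2 = |v_j|^(2-q) |v_j|^q <= B^(2-q) |v_j|^q. *)
Lemma dotvv_le_sparsity q v B : 0 < q <= 1 -> 0 < B -> dotv v v <= B ^+ 2 ->
  dotv v v <= B `^ (2 - q) * lqnorm q v `^ q.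
Proof.
move=> /andP[q0 q1] B0 vB; rewrite lqnorm_powR// mulr_sumr.
apply: ler_sum => j _; have [->|vj] := eqVneq (v j 0) 0.
  by rewrite mul0r mulr_ge0 ?powR_ge0.
have av : 0 < `|v j 0| by rewrite normr_gt0.
have -> : v j 0 * v j 0 = `|v j 0| `^ (2 - q) * `|v j 0| `^ q.
  rewrite -powRD; last by rewrite normr_eq0 vj implybT.
  by rewrite subrK powR_mulrn// real_normK ?num_real// expr2.
rewrite ler_wpM2r ?powR_ge0// ge0_ler_powR ?nnegrE ?(ltW B0)//; first by lra.
rewrite -(@ler_pXn2r _ 2)// ?nnegrE ?(ltW B0)// real_normK ?num_real//.
exact: le_trans (coord_sqr_le v j) vB.
Qed.

Lemma dotvv_le_l0norm v B : dotv v v <= B ^+ 2 -> dotv v v <= B ^+ 2 * (l0norm v)%:R.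
Proof.
move=> vB; have [v0|v0] := posnP (l0norm v).
  suff -> : v = 0 by rewrite dotv0l mulr_ge0// sqr_ge0.
  apply/matrixP => j l; rewrite (ord1 l) mxE; apply/eqP.
  move/eqP: v0; rewrite cards_eq0 => /eqP/setP/(_ j); rewrite !inE => /negbFE/eqP ->.
  exact: eqxx.
apply: le_trans vB _; rewrite ler_peMr ?sqr_ge0// ler1n//.
Qed.

End norms.

Section convex_combinations.
Context {R : realType} {p : nat} {K : finType}.
Variables (u : K -> R) (b : K -> 'cV[R]_p).
Hypotheses (u0 : forall k, 0 <= u k) (u1 : \sum_k u k = 1).

Lemma sqr_mean_le (x : K -> R) : (\sum_k u k * x k) ^+ 2 <= \sum_k u k * x k ^+ 2.
Proof. exact: mean_sqr_le. Qed.

Lemma mean_le (x : K -> R) c : (forall k, x k <= c) -> \sum_k u k * x k <= c.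
Proof.
move=> xc; rewrite -[leRHS]mul1r -u1 mulr_suml; apply: ler_sum => k _.
exact: ler_wpM2l.
Qed.

Lemma dotv_comb x : dotv (\sum_k u k *: b k) x = \sum_k u k * dotv (b k) x.
Proof. by rewrite dotv_suml; apply: eq_bigr => k _; rewrite dotvZl. Qed.

Lemma comb_coord j : (\sum_k u k *: b k) j 0 = \sum_k u k * b k j 0.
Proof. by rewrite summxE; apply: eq_bigr => k _; rewrite mxE. Qed.

Lemma dotvv_comb_le c : (forall k, dotv (b k) (b k) <= c) ->
  dotv (\sum_k u k *: b k) (\sum_k u k *: b k) <= c.
Proof.
move=> bc; apply: (@le_trans _ _ (\sum_k u k * dotv (b k) (b k))); last exact: mean_le.
under [leRHS]eq_bigr do rewrite /dotv mulr_sumr.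
rewrite [leRHS]exchange_big; apply: ler_sum => j _; rewrite -expr2 comb_coord.
apply: le_trans (sqr_mean_le _) _; apply: ler_sum => k _.
by rewrite expr2.
Qed.

Lemma norm1_comb_le c : (forall k, norm1 (b k) <= c) ->
  norm1 (\sum_k u k *: b k) <= c.
Proof.
move=> bc; apply: (@le_trans _ _ (\sum_k u k * norm1 (b k))); last exact: mean_le.
under [leRHS]eq_bigr do rewrite /norm1 mulr_sumr.
rewrite [leRHS]exchange_big; apply: ler_sum => j _; rewrite comb_coord.
apply: le_trans (ler_norm_sum _ _ _) _; apply: ler_sum => k _.
by rewrite normrM ger0_norm.
Qed.

End convex_combinations.

Section rates.
Context {R : realType} {dY dE : measure_display}.
Context {Y : measurableType dY} {E : measurableType dE} {J n : nat}.
Variable S : experiment (R := R) Y E J n.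
Variables (q Kb : R).
Hypotheses (q01 : 0 <= q <= 1) (Kb0 : 0 < Kb).

(** With this quantity H, the rate is sqrt H * t^(1/2 - q/4), where t = log(pK)/n, for q = 0 and q >
    0 alike. *)
Definition sparsity : R := if q == 0 then (s_u S)%:R else h_u S q `^ q.

Lemma sparsity_ge0 : 0 <= sparsity.
Proof. by rewrite /sparsity; case: ifP => // _; exact: powR_ge0. Qed.

Let h0 : 0 <= h_u S q. Proof. exact: bigmax_ge_id. Qed.

Lemma sqrt_sparsity : q != 0 -> Num.sqrt sparsity = h_u S q `^ (q / 2).
Proof.
by move=> q0; rewrite /sparsity (negbTE q0) -powR12_sqrt ?powR_ge0// -powRrM.
Qed.

Lemma rateE : rate S q = Num.sqrt sparsity *
  (ln (p S * K S)%:R / n%:R) `^ (1 / 2 - q / 4).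
Proof.
have t0 : 0 <= ln (p S * K S)%:R / n%:R :> R.
  rewrite divr_ge0//; case: (p S * K S)%N => [|k]; first by rewrite ln0.
  by rewrite ln_ge0// ler1n.
rewrite /rate; have [q0|q0] := eqVneq q 0; last by rewrite sqrt_sparsity.
by rewrite /sparsity q0 eqxx mul0r subr0 mul1r powR12_sqrt.
Qed.

Lemma rate2E C0 delta : 0 <= delta -> rate2 S C0 q delta = C0 * Num.sqrt sparsity *
  (delta + Num.sqrt (ln (p_u S)%:R / n%:R)) `^ (1 - q / 2).
Proof.
move=> d0; rewrite /rate2; have [q0|q0] := eqVneq q 0; last by rewrite sqrt_sparsity.
by rewrite /sparsity q0 eqxx mul0r subr0 powRr1// addr_ge0// sqrtr_ge0.
Qed.

Lemma rate1E C0 delta : 0 <= delta -> rate1 S C0 q delta = C0 * sparsity *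
  (delta + Num.sqrt (ln (p_u S)%:R / n%:R)) `^ (1 - q).
Proof.
move=> d0; rewrite /rate1 /sparsity; case: eqP => [->|//].
by rewrite subr0 powRr1// addr_ge0// sqrtr_ge0.
Qed.

Lemma bstar_sparsity k : dotv (bstar (e:=S) k) (bstar (e:=S) k) <= Kb ^+ 2 ->
  dotv (bstar (e:=S) k) (bstar (e:=S) k) <= Kb `^ (2 - q) * sparsity.
Proof.
move=> bK; have [q0 q1] := andP q01; rewrite /sparsity.
have [q00|q0'] := eqVneq q 0.
  rewrite q00 subr0 powR_mulrn ?(ltW Kb0)//; apply: le_trans (dotvv_le_l0norm bK) _.
  rewrite ler_wpM2l ?sqr_ge0// ler_nat.
  exact: (@leq_bigmax _ (fun k => l0norm (bstar (e:=S) k))).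
have qp : 0 < q by rewrite lt_neqAle eq_sym q0'.
have qq : 0 < q <= 1 by rewrite qp.
apply: le_trans (dotvv_le_sparsity qq Kb0 bK) _.
rewrite ler_wpM2l ?powR_ge0// ge0_ler_powR ?nnegrE ?powR_ge0//.
exact: (le_bigmax _ (fun k => lqnorm q (bstar (e:=S) k))).
Qed.

Variables (t c tau C0 : R).
Hypotheses (t0 : 0 < t) (c1 : 1 <= c) (C00 : 0 < C0).
Hypotheses (tau0 : 0 <= tau) (tauc : tau <= c * Num.sqrt t).

Let T := Num.sqrt sparsity * t `^ (1 / 2 - q / 4).

Let tau_le x : 0 <= x <= 1 -> tau `^ x <= c * t `^ (x / 2).
Proof.
move=> /andP[x0 x1]; have c0 : 0 <= c by exact: le_trans ler01 c1.
apply: (@le_trans _ _ ((c * Num.sqrt t) `^ x)).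
  by rewrite ge0_ler_powR ?nnegrE// mulr_ge0 ?sqrtr_ge0.
rewrite powRM ?sqrtr_ge0// -powR12_sqrt ?(ltW t0)// -powRrM.
have -> : 2^-1 * x = x / 2 by field.
rewrite ler_wpM2r ?powR_ge0//.
by rewrite -[leRHS]powRr1// ler_powR.
Qed.

Lemma rate2_le : C0 * Num.sqrt sparsity * tau `^ (1 - q / 2) <= C0 * c * T.
Proof.
have q01' := q01; have [q0 q1] := andP q01.
have -> : C0 * c * T = C0 * Num.sqrt sparsity * (c * t `^ (1 / 2 - q / 4)).
  by rewrite /T; ring.
rewrite ler_wpM2l ?mulr_ge0 ?sqrtr_ge0 ?(ltW C00)//.
have -> : 1 / 2 - q / 4 = (1 - q / 2) / 2 by field.
by apply: tau_le; apply/andP; split; lra.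
Qed.

(** Since tau^(2-2q) t is of order t^(2-q), the square of the l1 rate times t is of the order of the
    fourth power of T. This product is what Maurey's bound adds to the squared l2 error. *)
Lemma rate1_le : (C0 * sparsity * tau `^ (1 - q)) ^+ 2 * t <= (C0 * c * T ^+ 2) ^+ 2.
Proof.
have [q0 q1] := andP q01.
have T2 : T ^+ 2 = sparsity * t `^ (1 - q / 2).
  rewrite /T exprMn sqr_sqrtr ?sparsity_ge0// -powR_mulrn ?powR_ge0// -powRrM.
  by have -> : (1 / 2 - q / 4) * 2 = 1 - q / 2 by field.
have h : tau `^ (1 - q) <= c * t `^ ((1 - q) / 2).
  by apply: tau_le; apply/andP; split; lra.
have tt : t `^ ((1 - q) / 2) ^+ 2 * t = t `^ (1 - q / 2) ^+ 2.
  rewrite -!powR_mulrn ?powR_ge0// -!powRrM -[X in _ * X]powRr1 ?ltW//.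
  rewrite -powRD; last by apply/implyP => _; rewrite gt_eqF.
  by have -> : (1 - q) / 2 * 2 + 1 = (1 - q / 2) * 2 by field.
rewrite T2; have -> : (C0 * c * (sparsity * t `^ (1 - q / 2))) ^+ 2 =
  (C0 * sparsity * (c * t `^ ((1 - q) / 2))) ^+ 2 * t.
  rewrite !exprMn -tt; ring.
rewrite ler_wpM2r ?(ltW t0)// ler_pXn2r// ?nnegrE; last 2 first.
- by rewrite !mulr_ge0 ?powR_ge0 ?sparsity_ge0 ?(ltW C00).
- by rewrite !mulr_ge0 ?powR_ge0 ?sparsity_ge0 ?(ltW C00)// (le_trans ler01).
by rewrite ler_wpM2l// mulr_ge0 ?sparsity_ge0 ?(ltW C00).
Qed.

End rates.

(** * Sub-gaussian norms and the laws of the sample *)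

Section psi2.
Context {R : realType} {d : measure_display} {T : measurableType d}.
Variable P : probability T R.

Lemma subgaussian_mono (f g : T -> R) (a b : R) : measurable_fun setT f ->
  measurable_fun setT g -> 0 <= a <= b -> (forall w, f w ^+ 2 <= g w ^+ 2) ->
  (\int[P]_w (expR (b * g w ^+ 2))%:E <= 2%:E)%E ->
  (\int[P]_w (expR (a * f w ^+ 2))%:E <= 2%:E)%E.
Proof.
move=> mf mg /andP[a0 ab] fg; apply: le_trans.
have me (h : T -> R) c : measurable_fun setT h ->
    measurable_fun setT (fun y => (expR (c * h y ^+ 2))%:E).
  move=> mh; apply/measurable_EFinP; apply: (measurableT_comp (@measurable_expR R)).
  by apply: measurable_funM => //; exact: measurable_funX.
apply: ge0_le_integral => //; [exact: me|exact: me|move=> w _].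
by rewrite lee_fin ler_expR ler_pM// sqr_ge0.
Qed.

(** The infimum is only approached: some admissible scale lies below 2 K, hence the 4 K^2. *)
Lemma psi2_norm_le (u : T -> R) (K : R) : measurable_fun setT u -> 0 < K ->
  (psi2_norm P u <= K%:E)%E ->
  (\int[P]_w (expR ((4 * K ^+ 2)^-1 * u w ^+ 2))%:E <= 2%:E)%E.
Proof.
move=> mu K0 uK.
have lt2 : (psi2_norm P u < (2 * K)%:E)%E.
  by apply: le_lt_trans uK _; rewrite lte_fin; lra.
have [_ [t [t0 ut] <-]] := ereal_inf_lt lt2.
rewrite lte_fin => tK.
have ut' : (\int[P]_w (expR (t ^- 2 * u w ^+ 2))%:E <= 2%:E)%E.
  by under eq_integral do rewrite mulrC.
apply: (subgaussian_mono mu mu _ _ ut') => //.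
rewrite invr_ge0 mulr_ge0 ?sqr_ge0//= lef_pV2 ?posrE ?mulr_gt0 ?exprn_gt0//.
rewrite !expr2; nra.
Qed.

Lemma psi2_normv_le (p : nat) (X : T -> 'cV[R]_p) (K : R) :
  (forall j, measurable_fun setT (fun w => X w j 0)) -> 0 < K ->
  (psi2_normv P X <= K%:E)%E -> forall v, dotv v v <= 1 ->
  (\int[P]_w (expR ((4 * K ^+ 2)^-1 * dotv v (X w) ^+ 2))%:E <= 2%:E)%E.
Proof.
move=> mX K0 XK v v1; have [v0|v0] := eqVneq (dotv v v) 0.
  have -> : (fun w => (expR ((4 * K ^+ 2)^-1 * dotv v (X w) ^+ 2))%:E) = cst 1%:E.
    by apply/funext => w; rewrite (dotvv_eq0 v0) dotv0l expr0n mulr0 expR0.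
  by rewrite integral_cst//= probability_setT mule1 lee_fin ler1n.
have vp : 0 < dotv v v by rewrite lt_neqAle eq_sym v0 dotvv_ge0.
pose u := (Num.sqrt (dotv v v))^-1 *: v.
have uu : dotv u u = 1.
  by rewrite dotvZl dotvC dotvZl mulrA -expr2 exprVn sqr_sqrtr ?dotvv_ge0// mulVf.
have mu : measurable_fun setT (fun w => dotv u (X w)) by exact: measurable_dotv.
apply: (subgaussian_mono (measurable_dotv mX v) mu _ _ (psi2_norm_le mu K0 _)).
- by rewrite lexx andbT invr_ge0 mulr_ge0 ?sqr_ge0.
- move=> w; rewrite [in leRHS]dotvZl exprMn exprVn sqr_sqrtr ?dotvv_ge0//.
  by rewrite ler_peMl ?sqr_ge0// invf_ge1.
- apply: le_trans XK; apply: ereal_sup_ubound; exists u => /=.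
    by rewrite lqnorm2E uu sqrtr1.
  by congr (psi2_norm P _); apply/funext => w; rewrite dotvC.
Qed.

End psi2.

Section sample_laws.
Context {R : realType} {dY dE : measure_display}.
Context {Y : measurableType dY} {E : measurableType dE} {J n : nat}.
Variable S : experiment (R := R) Y E J n.
Hypothesis iidS : iid_sample S.
Variable L : Y -> R -> R.
Hypothesis mL : measurable_fun setT (fun z : Y * R => L z.1 z.2).

Definition covar (y : observation (R := R) Y) : 'cV[R]_(p S) := \col_j y.2 j.
Definition resp (y : observation (R := R) Y) : Y := y.1.

Lemma covar_draw i w : covar (draw (S := S) i w) = X_ S i w.
Proof. by apply/matrixP => j l; rewrite !mxE. Qed.

Lemma measurable_covar j : measurable_fun setT (fun y => covar y j 0).
Proof.
have -> : (fun y => covar y j 0) = (fun y : observation Y => y.2 j).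
  by apply/funext => y; rewrite mxE.
exact: measurable_obs_x.
Qed.

Lemma measurable_resp : measurable_fun setT resp.
Proof. exact: measurable_obs_y. Qed.

Lemma integral_draw i (h : observation (R := R) Y -> \bar R) :
  measurable_fun setT h ->
  (\int[Pr S]_w h (draw i w) = \int[law iidS]_y h y)%E.
Proof.
move=> mh; have iid := iid_draws_sample iidS.
rewrite integralE [RHS]integralE; congr (_ - _)%E.
  have H := (ge0_integral_draw iid i (measurable_funepos mh) (funepos_ge0 h)).
  by apply: etrans H; apply: eq_integral => w _; rewrite !funeposE.
have H := (ge0_integral_draw iid i (measurable_funeneg mh) (funeneg_ge0 h)).
by apply: etrans H; apply: eq_integral => w _; rewrite !funenegE.
Qed.

Lemma Rintegral_draw i (h : observation (R := R) Y -> R) : measurable_fun setT h ->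
  \int[Pr S]_w h (draw i w) = \int[law iidS]_y h y.
Proof.
move=> mh; rewrite /Rintegral (integral_draw i (h := fun y => (h y)%:E))//.
exact/measurable_EFinP.
Qed.

Lemma integrable_draw i (h : observation (R := R) Y -> R) : measurable_fun setT h ->
  (Pr S).-integrable setT (EFin \o (fun w => h (draw i w))) ->
  (law iidS).-integrable setT (EFin \o h).
Proof.
move=> mh /integrableP[_ hi]; apply/integrableP; split; first exact/measurable_EFinP.
rewrite -(integral_draw i (h := fun y => `|(h y)%:E|%E))//.
by apply: measurableT_comp => //; exact/measurable_EFinP.
Qed.

Definition lossb (b : 'cV[R]_(p S)) := lossv L covar resp b.

Lemma measurable_lossb b : measurable_fun setT (lossb b).
Proof. by apply: measurable_lossv => //; [exact: measurable_covar|exact: measurable_resp]. Qed.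

Lemma lossb_draw b i w : lossb b (draw i w) = L (y_ i w) (dotv b (X_ S i w)).
Proof. by rewrite /lossb /lossv covar_draw. Qed.

Lemma Bhat_comb (v : 'cV[R]_(K S)) w :
  Bhat S w *m v = \sum_k v k 0 *: bhat (e:=S) k w.
Proof.
apply/matrixP => j l; rewrite (ord1 l) mxE summxE; apply: eq_bigr => k _.
by rewrite !mxE mulrC.
Qed.

Lemma Bcv_comb m (v : 'cV[R]_(K S)) w :
  Bcv S m w *m v = \sum_k v k 0 *: bcv (e:=S) m k w.
Proof.
apply/matrixP => j l; rewrite (ord1 l) mxE summxE; apply: eq_bigr => k _.
by rewrite !mxE mulrC.
Qed.

Lemma Bstar_comb (v : 'cV[R]_(K S)) :
  Bstar S *m v = \sum_k v k 0 *: bstar (e:=S) k.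
Proof.
apply/matrixP => j l; rewrite (ord1 l) mxE summxE; apply: eq_bigr => k _.
by rewrite !mxE mulrC.
Qed.

Lemma riskE v w : risk L S v w = \int[law iidS]_y lossb (Bhat S w *m v) y.
Proof.
rewrite -(Rintegral_draw Defs.new (measurable_lossb _)).
by apply: eq_Rintegral => w' _; rewrite lossb_draw.
Qed.

Lemma risk_starE v : risk_star L S v = \int[law iidS]_y lossb (Bstar S *m v) y.
Proof.
rewrite -(Rintegral_draw Defs.new (measurable_lossb _)).
by apply: eq_Rintegral => w' _; rewrite lossb_draw.
Qed.

Lemma CVE w v : CV L S w v =
  \sum_(i < n) lossb (Bcv S (fold S i) w *m v) (draw (train i) w).
Proof.
rewrite /CV; under eq_bigr do rewrite big_mkcond/=.
rewrite exchange_big /=; apply: eq_bigr => i _.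
rewrite (bigD1 (fold S i))//= inE eqxx big1 ?addr0 ?lossb_draw//.
by move=> m; rewrite inE eq_sym => /negbTE ->.
Qed.

End sample_laws.

(** The modulus of the loss requires a positive parameter, whereas the rate may be 0; the bound at
    the rate is reached as a limit from the right. *)
Lemma le_of_near_ge (R : realFieldType) (x M T0 B : R) : 0 <= M -> 0 <= T0 -> T0 < B ->
  (forall t, 0 < t -> T0 <= t -> t <= B -> x <= M * t) -> x <= M * T0.
Proof.
move=> M0 T00 TB H; apply/ler_addgt0Pr => e e0.
pose f := Num.min (B - T0) (e / (M + 1)).
have M1 : 0 < M + 1 by lra.
have f0 : 0 < f by rewrite lt_min subr_gt0 TB divr_gt0.
have f1 : f <= B - T0 by rewrite ge_min lexx.
have f2 : f * (M + 1) <= e by rewrite -ler_pdivlMr// ge_min lexx orbT.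
have h1 : 0 < T0 + f by lra.
have h2 : T0 <= T0 + f by lra.
have h3 : T0 + f <= B by lra.
have := H _ h1 h2 h3; nra.
Qed.

(** * The good event *)

Section good_event.
Context {R : realType} {dY dE : measure_display}.
Context {Y : measurableType dY} {E : measurableType dE} {J n : nat}.
Variable S : experiment (R := R) Y E J n.
Hypothesis iidS : iid_sample S.
Variables (L : Y -> R -> R) (G : Y -> R) (th q C0 Kb a Ce : R).
Hypothesis mL : measurable_fun setT (fun z : Y * R => L z.1 z.2).
Hypothesis LG : loss_modulus L G.
Hypothesis mG : measurable_fun setT G.
Hypotheses (th0 : 0 < th) (q01 : 0 <= q <= 1) (C00 : 0 < C0) (Kb0 : 0 < Kb).
Hypotheses (a0 : 0 <= a) (Ce0 : 0 <= Ce).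
Hypothesis sgX : forall v, dotv v v <= 1 ->
  (\int[law iidS]_y (expR (th * dotv v (covar S y) ^+ 2))%:E <= 2%:E)%E.
Hypothesis sgG : (\int[law iidS]_y (expR (th * G (resp y) ^+ 2))%:E <= 2%:E)%E.
Hypothesis iL : forall b : 'cV[R]_(p S), (law iidS).-integrable setT (EFin \o lossb L b).

Let lam : R := ln (p S * K S)%:R.
Let t : R := lam / n%:R.
Let T := rate S q.
(** Bounds delta + sqrt(log p_u / n) in units of sqrt t: the root covers delta, and the 1 covers log
    p_u <= lam. *)
Let c := Num.sqrt (2 + 4 * a) + 1.
Let D := C0 * c.
(** Dominates the three mean squares needed by [emp_loss_close]: 1 for [G], Kb^2 for the pseudo-true
    predictor, and 5 for the error of each of the J folds, with 5 = 1 + 4 from the l2 and l1 parts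
    of the restricted bound. *)
Let A := (2 + a) / th * (5 * J%:R + 1 + Kb ^+ 2).

Hypotheses (J2 : (2 <= J)%N) (n0 : (0 < n)%N) (p0 : (0 < p S)%N) (K2 : (2 <= K S)%N).
Hypothesis bK : forall k, dotv (bstar (e:=S) k) (bstar (e:=S) k) <= Kb ^+ 2.
Hypothesis mest : measurable_estimators S.
Hypothesis bhat_rate : forall (k : 'I_(K S)) (delta : R), 0 < delta < 1 ->
  ((1 - 4 * expR (- (n%:R * delta ^+ 2)))%:E <=
    Pr S [set w | within_rates S C0 q delta k (bhat k w)])%E.
Hypothesis bcv_rate : forall (k : 'I_(K S)) (m : 'I_J) (delta : R), 0 < delta < 1 ->
  ((1 - 4 * expR (- ((n_train J n)%:R * delta ^+ 2)))%:E <=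
    Pr S [set w | within_rates S C0 q delta k (bcv m k w)])%E.

Definition weights_on (u : 'I_(K S) -> R) := (forall k, 0 <= u k) /\ \sum_k u k = 1.
Let comb (u : 'I_(K S) -> R) := \sum_k u k *: bstar (e:=S) k.

Hypothesis emp : forall sg, 0 < sg -> sg <= Kb ->
  (forall k, dotv (bstar (e:=S) k) (bstar (e:=S) k) <= sg ^+ 2) ->
  prob_ge (Pr S) (1 - 3 * expR (- a)) [set w | forall u, weights_on u ->
    `|deviation (law iidS) (draw (S:=S)) (fun y => lossb (S:=S) L (comb u) y - lossb (S:=S) L 0 y) w| <=
      Ce * (sg * Num.sqrt (n%:R * lam))].
Hypotheses (t2 : (2 + 4 * a) * t < 1) (T1 : T <= 1).

Let nR0 : 0 < n%:R :> R. Proof. by rewrite ltr0n. Qed.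

Lemma ln2_ge_half : 1 / 2 <= ln 2%:R :> R.
Proof.
rewrite -ler_expR lnK ?posrE//.
have := expR_ge1Dx (- (1 / 2) : R); rewrite expRN => h.
have : (1 - 1 / 2) * expR (1 / 2) <= 1 :> R.
  by rewrite -ler_pdivlMr ?expR_gt0// [_ / expR _]div1r.
lra.
Qed.

Let pK2 : (2 <= p S * K S)%N. Proof. exact: leq_trans K2 (leq_pmull _ p0). Qed.

Let ln2_lam : ln 2%:R <= lam.
Proof. by rewrite ler_ln ?posrE ?ltr0n ?ler_nat// (leq_trans _ pK2). Qed.

Let lam12 : 1 / 2 <= lam. Proof. exact: le_trans ln2_ge_half ln2_lam. Qed.

Let expR_lam : expR lam = (p S * K S)%:R.
Proof. by rewrite lnK// posrE ltr0n (leq_trans _ pK2). Qed.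

Let K_lam : #|'I_(K S)|%:R <= expR lam.
Proof. by rewrite card_ord expR_lam ler_nat leq_pmull. Qed.

Let t0 : 0 < t. Proof. by rewrite divr_gt0// (lt_le_trans _ lam12). Qed.

Let nt : n%:R * t = lam. Proof. by rewrite mulrCA divff ?mulr1 ?gt_eqF. Qed.

Let t12 : t <= 1 / 2. Proof. have := a0; have := t0; have := t2; nra. Qed.

Let c1 : 1 <= c. Proof. by rewrite lerDr sqrtr_ge0. Qed.

Let D0 : 0 < D. Proof. by rewrite mulr_gt0// (lt_le_trans ltr01 c1). Qed.

Let T0 : 0 <= T. Proof. by rewrite /T rateE mulr_ge0 ?sqrtr_ge0 ?powR_ge0. Qed.

Lemma measurable_within delta k (b : Om S -> 'cV[R]_(p S)) :
  (forall j, measurable_fun setT (fun w => b w j 0)) ->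
  measurable [set w | within_rates S C0 q delta k (b w)].
Proof.
move=> mb.
have ml r : measurable_fun setT (fun w => lqnorm r (b w - bstar k)).
  apply: (measurableT_comp (measurable_powR _)); apply: measurable_sum => j.
  apply: (measurableT_comp (measurable_powR _)).
  apply: measurableT_comp => //.
  under eq_fun do rewrite !mxE.
  by apply: measurable_funB => //; exact: measurable_cst.
have mle r x : measurable [set w | lqnorm r (b w - bstar k) <= x].
  rewrite -[X in measurable X]setTI.
  have := measurable_fun_ler (ml r) (@measurable_cst _ _ (Om S) R setT x).
  move=> /(_ measurableT [set true]) /=; apply.
  exact: I.
exact: (measurableI _ _ (mle 2 _) (mle 1 _)).
Qed.

Lemma measurable_bhat k j : measurable_fun setT (fun w => bhat (e:=S) k w j 0).
Proof.
have [mb _ _] := mest; have [my mx _ _] := iidS.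
move=> _ B mB; rewrite setTI; have := mb k j B mB; apply: smallest_sub.
  exact: sigma_algebra_measurable.
by move=> _ [[i [C mC ->]]|[i [l [C mC ->]]]]; rewrite -[X in measurable X]setTI;
  [exact: my|exact: mx].
Qed.

(** The 2 compensates for the training folds, which may hold only half of the sample: both sample
    sizes then give exponent at least lam + a, and exp lam pays for the models. *)
Let delta := Num.sqrt (2 * (lam + a) / n%:R).

Let delta2 : delta ^+ 2 = 2 * (lam + a) / n%:R.
Proof.
have := lam12; have := a0 => h1 h2.
by rewrite sqr_sqrtr// divr_ge0// mulr_ge0// addr_ge0//; lra.
Qed.

Let delta2t : delta ^+ 2 <= (2 + 4 * a) * t.
Proof.
rewrite delta2 /t mulrA ler_wpM2r ?invr_ge0//.
have := lam12; have := a0; nra.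
Qed.

Let delta01 : 0 < delta < 1.
Proof.
have := lam12; have := a0 => h1 h2.
have d0 : 0 < delta by rewrite sqrtr_gt0 divr_gt0// mulr_gt0//; lra.
rewrite d0 /= -(@ltr_pXn2r _ 2)// ?nnegrE ?(ltW d0)// expr1n.
exact: le_lt_trans delta2t t2.
Qed.

Let tau := delta + Num.sqrt (ln (p_u S)%:R / n%:R).

Let tau0 : 0 <= tau. Proof. by rewrite addr_ge0 ?sqrtr_ge0. Qed.

Let tauc : tau <= c * Num.sqrt t.
Proof.
have a4 : 0 <= 2 + 4 * a by have := a0; lra.
rewrite /tau /c mulrDl mul1r lerD//.
  rewrite -sqrtrM// -[leLHS]ger0_norm ?sqrtr_ge0// -sqrtr_sqr ler_sqrt//.
  by rewrite mulr_ge0// ltW.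
rewrite ler_sqrt ?(ltW t0)// ler_wpM2r ?invr_ge0//.
have pup : (p_u S <= p S)%N.
  by apply/bigmax_leqP => k _; rewrite -[leqRHS](card_ord (p S)) max_card.
have [pu0|pu0] := posnP (p_u S).
  by rewrite pu0 ln0//; have := lam12; lra.
have K0 : (0 < K S)%N by exact: leq_trans K2.
rewrite ler_ln ?posrE ?ltr0n ?ler_nat ?muln_gt0 ?p0//.
by apply: leq_trans pup _; rewrite leq_pmulr.
Qed.

Let close (b : 'cV[R]_(p S)) k := dotv (b - bstar k) (b - bstar k) <= (D * T) ^+ 2 /\
  norm1 (b - bstar k) ^+ 2 * t <= (D * T ^+ 2) ^+ 2.

Lemma within_close b k : within_rates S C0 q delta k b -> close b k.
Proof.
have d0 : 0 <= delta by case/andP: delta01 => /ltW.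
move=> [h2 h1]; rewrite rate2E// -/tau in h2; rewrite rate1E// -/tau lqnorm1E in h1.
rewrite /close /T rateE -/lam -/t; split.
  apply: lqnorm2_le; first exact: (mulr_ge0 (ltW D0) (mulr_ge0 (sqrtr_ge0 _) (powR_ge0 _ _))).
  exact: le_trans h2 (rate2_le S q01 t0 c1 C00 tau0 tauc).
apply: le_trans (rate1_le S q01 t0 c1 C00 tau0 tauc).
rewrite ler_wpM2r ?(ltW t0)// ler_pXn2r// nnegrE ?norm1_ge0//.
exact: le_trans (norm1_ge0 _) h1.
Qed.

Lemma prob_ge_close_bhat : prob_ge (Pr S) (1 - 4 * expR (- a))
  [set w | forall k, close (bhat (e:=S) k w) k].
Proof.
have h k : prob_ge (Pr S) (1 - 4 * expR (- (n%:R * delta ^+ 2)))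
    [set w | within_rates S C0 q delta k (bhat k w)].
  apply: prob_ge_measurable; last exact: bhat_rate.
  by apply: measurable_within => j; exact: measurable_bhat.
apply: (prob_geS _ (prob_ge_le _ (prob_ge_forall h))) => [w /= hw k|].
  exact: within_close.
have := lam12; have := a0 => h1 h2.
rewrite lerB// sumr_const -[X in X <= _]mulr_natl mulrCA ler_wpM2l//.
apply: (@le_trans _ _ (expR lam * expR (- (lam + a)))).
  rewrite ler_pM ?expR_ge0//.
  by rewrite ler_expR lerN2 delta2 mulrCA divff ?gt_eqF// mulr1; lra.
by rewrite -expRD ler_expR; lra.
Qed.

Lemma prob_ge_close_bcv : prob_ge (Pr S) (1 - 4 * J%:R * expR (- a))
  [set w | forall m k, close (bcv (e:=S) m k w) k].
Proof.
have h (mk : 'I_J * 'I_(K S)) :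
    prob_ge (Pr S) (1 - 4 * expR (- ((n_train J n)%:R * delta ^+ 2)))
    [set w | within_rates S C0 q delta mk.2 (bcv mk.1 mk.2 w)].
  apply: prob_ge_measurable; last exact: bcv_rate.
  by apply: measurable_within => j; have [_ + _] := mest; apply.
apply: (prob_geS _ (prob_ge_le _ (prob_ge_forall h))) => [w /= hw m k|].
  exact/within_close/(hw (m, k)).
have := lam12; have := a0 => h1 h2.
have ntr : n%:R <= 2 * (n_train J n)%:R :> R.
  have nJ : (2 * (n %/ J) <= n)%N.
    by rewrite mulnC; apply: leq_trans (leq_trunc_div n J); rewrite leq_mul2l J2 orbT.
  by rewrite -natrM ler_nat /n_train mulnBr mul2n -addnn -addnBA// leq_addr.
rewrite lerB// sumr_const card_prod card_ord -[X in X <= _]mulr_natl natrM.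
have -> : J%:R * #|'I_(K S)|%:R * (4 * expR (- ((n_train J n)%:R * delta ^+ 2))) =
  4 * J%:R * (#|'I_(K S)|%:R * expR (- ((n_train J n)%:R * delta ^+ 2))) by ring.
rewrite ler_wpM2l//.
apply: (@le_trans _ _ (expR lam * expR (- (lam + a)))).
  rewrite ler_pM ?expR_ge0// ler_expR lerN2.
  have nd : n%:R * delta ^+ 2 = 2 * (lam + a).
    by rewrite delta2 mulrCA divff ?gt_eqF// mulr1.
  have := ler_wpM2r (sqr_ge0 delta) ntr; rewrite nd; lra.
by rewrite -expRD ler_expR; lra.
Qed.

Let expn_lam : expR lam <= expR n%:R.
Proof. by rewrite ler_expR -nt; have := t12; have := nR0; nra. Qed.

Lemma prob_ge_upper : prob_ge (Pr S) (1 - expR (- a)) [set w | forall D0,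
  sample_sum (draw (S:=S)) (fun y => dotv D0 (covar S y) ^+ 2) w <=
    (2 + a) * n%:R / th * (dotv D0 D0 + 4 * (norm1 D0 ^+ 2 * t))].
Proof.
have lam0 : 0 < lam by apply: lt_le_trans lam12.
have r1 : 1 <= n%:R / (2 * lam).
  by rewrite ler_pdivlMr ?mulr_gt0// mul1r -nt; have := t12; have := nR0; nra.
have r0 : 0 <= n%:R / (2 * lam) by lra.
(* As 2 p <= exp(2 lam), this s keeps the number of tuples below exp n. Truncation at most halves a
   number that is at least 1, so 1 / s <= 4 t. *)
pose s := Num.truncn (n%:R / (2 * lam)).
have /andP[s1 s2] := truncn_itv r0.
have s0 : (0 < s)%N.
  rewrite lt0n; apply/eqP => s00; move: s2; rewrite -/s s00; lra.
have sp : ((p S * 2) ^ s)%:R <= expR n%:R :> R.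
  have h2 : (p S * 2)%:R <= expR (2 * lam).
    rewrite natrM mulrDl !mul1r expRD expR_lam; apply: ler_pM => //.
      by rewrite ler_nat leq_pmulr// (leq_trans _ K2).
    by rewrite ler_nat.
  rewrite natrX; apply: (@le_trans _ _ (expR (2 * lam) ^+ s)).
    by rewrite lerXn2r// nnegrE ?expR_ge0.
  rewrite -expRM_natl ler_expR; move: s1.
  by rewrite ler_pdivlMr ?mulr_gt0.
have := prob_ge_restricted_upper (iid_draws_sample iidS) (measurable_covar (S:=S)) th0 sgX
  n0 s0 a0 sp.
apply: prob_geS => w /= H D1; apply: le_trans (H D1) _.
rewrite ler_wpM2l ?divr_ge0 ?mulr_ge0 ?addr_ge0 ?(ltW th0)// lerD2l.
rewrite mulrCA ler_wpM2l ?sqr_ge0//.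
have sR0 : 0 < s%:R :> R by rewrite ltr0n.
rewrite -[s%:R^-1]mul1r ler_pdivrMr//.
have s3 : n%:R / (2 * lam) <= 2 * s%:R.
  have : 1 <= s%:R :> R by rewrite ler1n.
  by move: s2; rewrite -/s -natr1; lra.
move: s3; rewrite ler_pdivrMr ?mulr_gt0// => s3.
rewrite -(ler_pM2l nR0).
have -> : n%:R * (4 * t * s%:R) = 4 * (n%:R * t) * s%:R by ring.
by rewrite nt; lra.
Qed.

Let iid := iid_draws_sample iidS.
Let mX := measurable_covar (S:=S).
Let mGr : measurable_fun setT (fun y : observation (R := R) Y => G (resp y)).
Proof. exact: (measurableT_comp mG (@measurable_resp _ _ Y)). Qed.

Lemma prob_ge_sum_G : prob_ge (Pr S) (1 - expR (- a)) [set w |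
  sample_sum (draw (S:=S)) (fun y => G (resp y) ^+ 2) w <= (2 + a) * n%:R / th].
Proof.
have m1 (i : 'I_1) : measurable_fun setT (fun y : observation (R := R) Y =>
    Num.sqrt th * G (resp y)) by exact: measurable_funM.
have h1 (i : 'I_1) :
    (\int[law iidS]_y (expR ((Num.sqrt th * G (resp y)) ^+ 2))%:E <= 2%:E)%E.
  by under eq_integral do rewrite exprMn sqr_sqrtr ?(ltW th0)//.
have c1' : #|'I_1|%:R <= expR n%:R :> R by rewrite card_ord -expR0 ler_expR.
have := prob_ge_sum_sqr iid m1 h1 n0 a0 c1'.
apply: prob_geS => w /= /(_ ord0); rewrite /sample_sum.
under eq_bigr do rewrite exprMn sqr_sqrtr ?(ltW th0)//.
by rewrite -mulr_sumr ler_pdivlMr// mulrC.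
Qed.

Let Kn : #|'I_(K S)|%:R <= expR n%:R :> R.
Proof. exact: le_trans K_lam expn_lam. Qed.

Lemma prob_ge_sum_bstar : prob_ge (Pr S) (1 - expR (- a)) [set w | forall k,
  sample_sum (draw (S:=S)) (fun y => dotv (bstar (e:=S) k) (covar S y) ^+ 2) w <=
    (2 + a) * n%:R / th * Kb ^+ 2].
Proof.
have := prob_ge_sum_sqr_dotv iid mX th0 sgX (bstar (e:=S)) n0 a0 Kn.
apply: prob_geS => w /= H k; apply: le_trans (H k) _.
by rewrite ler_wpM2l// divr_ge0 ?mulr_ge0 ?addr_ge0 ?(ltW th0).
Qed.

Lemma prob_ge_emp : prob_ge (Pr S) (1 - 3 * expR (- a)) [set w | forall u, weights_on u ->
    `|deviation (law iidS) (draw (S:=S)) (fun y => lossb (S:=S) L (comb u) y -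
        lossb (S:=S) L 0 y) w| <= n%:R * (Ce * Num.sqrt (Kb `^ (2 - q)) * T)].
Proof.
have e0 := expR_ge0 (- a).
have H0 := sparsity_ge0 S q; have [q0 q1] := andP q01.
have bH k := bstar_sparsity q01 Kb0 (bK k).
(* If H = 0, all pseudo-true vectors vanish and so does the process; this case is apart because the
   scale [sg] must be positive. *)
have [Hz|Hz] := eqVneq (sparsity S q) 0.
  apply: (@prob_ge_le _ _ _ _ 1); first by lra.
  apply: prob_geT => w u uw.
  have b0 k : bstar (e:=S) k = 0.
    by apply: dotvv_eq0; apply/eqP; rewrite eq_le dotvv_ge0 andbT; have := bH k;
      rewrite Hz mulr0.
  have -> : comb u = 0 by rewrite /comb big1// => k _; rewrite b0 scaler0.
  rewrite /deviation /sample_sum; under eq_bigr do rewrite subrr.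
  under eq_Rintegral do rewrite subrr.
  rewrite big1// Rintegral_cstT mulr0 subr0 normr0.
  by rewrite !mulr_ge0 ?sqrtr_ge0.
have Hp : 0 < sparsity S q by rewrite lt_neqAle eq_sym Hz.
(* The root brings in the factor sqrt H of the rate; the minimum with [Kb] keeps [sg] in the range
   for which [Ce] was fixed. *)
pose sg := Num.min Kb (Num.sqrt (Kb `^ (2 - q) * sparsity S q)).
have KH0 : 0 < Kb `^ (2 - q) * sparsity S q by rewrite mulr_gt0// powR_gt0.
have sg0 : 0 < sg by rewrite lt_min Kb0 sqrtr_gt0.
have sgK : sg <= Kb by rewrite ge_min lexx.
have bsg k : dotv (bstar (e:=S) k) (bstar (e:=S) k) <= sg ^+ 2.
  rewrite /sg minEle; case: ifP => _; first exact: bK.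
  by rewrite sqr_sqrtr ?(ltW KH0)// bH.
apply: prob_geS (emp sg0 sgK bsg) => w /= H u uw; apply: le_trans (H u uw) _.
have -> : Num.sqrt (n%:R * lam) = n%:R * Num.sqrt t.
  rewrite -nt mulrA -expr2 sqrtrM ?sqr_ge0// sqrtr_sqr ger0_norm//.
have -> : Ce * (sg * (n%:R * Num.sqrt t)) = n%:R * (Ce * (sg * Num.sqrt t)) by ring.
rewrite ler_wpM2l// -[leRHS]mulrA ler_wpM2l//.
rewrite /T rateE -/lam -/t mulrA -sqrtrM ?powR_ge0//.
apply: ler_pM; rewrite ?(ltW sg0) ?sqrtr_ge0//.
  by rewrite ge_min lexx orbT.
(* Since t <= 1 and 1/2 - q/4 <= 1/2, sqrt t is at most the power of t in the rate. *)
rewrite -powR12_sqrt ?(ltW t0)//.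
apply: ger_powR; last by lra.
by rewrite t0 /=; have := t12; lra.
Qed.

(** Lies strictly above D T, as T <= 1, which leaves the room on the right asked for by
    [le_of_near_ge]. *)
Let B := D + 1.
Let M1 := (2 + Kb ^+ 2 + B) / th.
Let M2 := A * (3 + B).

Let B0 : 0 < B. Proof. by have := D0; rewrite /B; lra. Qed.
Let A0 : 0 <= A.
Proof.
apply: mulr_ge0; first by rewrite divr_ge0 ?addr_ge0 ?(ltW th0).
by apply: addr_ge0 (sqr_ge0 _); rewrite addr_ge0 ?mulr_ge0.
Qed.
Let DT0 : 0 <= D * T. Proof. by rewrite mulr_ge0 ?(ltW D0). Qed.
Let DTB : D * T < B. Proof. by have := D0; have := T1; have := T0; rewrite /B; nra. Qed.

Let M10 : 0 <= M1.
Proof.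
exact: divr_ge0 (addr_ge0 (addr_ge0 (ler0n _ 2) (sqr_ge0 _)) (ltW B0)) (ltW th0).
Qed.
Let M20 : 0 <= M2.
Proof. exact: mulr_ge0 A0 (addr_ge0 (ler0n _ 3) (ltW B0)). Qed.

Definition excess_const := (M1 + M2) * D + Ce * Num.sqrt (Kb `^ (2 - q)).

Lemma excess_const_ge0 : 0 <= excess_const.
Proof.
apply: addr_ge0; last exact: mulr_ge0 Ce0 (sqrtr_ge0 _).
exact: mulr_ge0 (addr_ge0 M10 M20) (ltW D0).
Qed.

Lemma comb_close (u : 'I_(K S) -> R) (b : 'I_(K S) -> 'cV[R]_(p S)) : weights_on u ->
  (forall k, close (b k) k) ->
  let Dl := \sum_k u k *: b k - comb u in
  dotv Dl Dl <= (D * T) ^+ 2 /\ norm1 Dl ^+ 2 * t <= (D * T ^+ 2) ^+ 2.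
Proof.
move=> [u0 u1] bc Dl.
have DlE : Dl = \sum_k u k *: (b k - bstar (e:=S) k).
  by rewrite /Dl /comb -sumrB; apply: eq_bigr => k _; rewrite scalerBr.
rewrite DlE; split.
  by apply: (dotvv_comb_le u0 u1) => k; have [] := bc k.
have st0 : 0 < Num.sqrt t by rewrite sqrtr_gt0.
have DTT : 0 <= D * T ^+ 2 by rewrite mulr_ge0 ?sqr_ge0 ?(ltW D0).
have sq x : 0 <= x -> (x ^+ 2 * t <= (D * T ^+ 2) ^+ 2) = (x <= D * T ^+ 2 / Num.sqrt t).
  move=> x0; rewrite -[t in LHS]sqr_sqrtr ?(ltW t0)// -exprMn.
  rewrite ler_pXn2r// ?nnegrE ?mulr_ge0 ?sqrtr_ge0//.
  by rewrite ler_pdivlMr.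
rewrite sq ?norm1_ge0//; apply: (norm1_comb_le u0 u1) => k.
by rewrite -sq ?norm1_ge0//; have [] := bc k.
Qed.

Lemma prob_ge_good : prob_ge (Pr S) (1 - (10 + 4 * J%:R) * expR (- a)) [set w |
  (forall v, simplex v -> `|risk L S v w - risk_star L S v| <= excess_const * T) /\
  exists c0, forall v, simplex v ->
    `|CV L S w v / n%:R - c0 - risk_star L S v| <= excess_const * T].
Proof.
have := prob_geI (prob_geI (prob_geI prob_ge_close_bhat prob_ge_close_bcv)
  (prob_geI prob_ge_upper prob_ge_sum_G)) (prob_geI prob_ge_sum_bstar prob_ge_emp).
have -> : 4 * expR (- a) + 4 * J%:R * expR (- a) + (expR (- a) + expR (- a)) +
  (expR (- a) + 3 * expR (- a)) = (10 + 4 * J%:R) * expR (- a) by ring.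
apply: prob_geS => w [[[Hb Hcv] [Hup HG]] [Hbs Hemp]].
have K20 : 0 <= Ce * Num.sqrt (Kb `^ (2 - q)) * T by rewrite !mulr_ge0 ?sqrtr_ge0.
have uw v : simplex v -> weights_on (fun k => v k 0).
  by move=> [v0 v1]; split=> // k; have /andP[] := v0 k.
have comb2 v : simplex v -> dotv (Bstar S *m v) (Bstar S *m v) <= Kb ^+ 2.
  by move=> /uw[u0 u1]; rewrite Bstar_comb; apply: (dotvv_comb_le u0 u1).
split=> [v vs|].
  rewrite (riskE iidS)// (risk_starE iidS)//.
  have [d2 _] := comb_close (uw v vs) Hb.
  have bE : Bstar S *m v = comb (fun k => v k 0) by exact: Bstar_comb.
  rewrite -Bhat_comb -bE in d2.
  apply: (@le_trans _ _ (M1 * (D * T))).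
    apply: (le_of_near_ge M10 DT0 DTB) => tt tt0 Dtt ttB.
    have d2' : dotv (Bhat S w *m v - Bstar S *m v) (Bhat S w *m v - Bstar S *m v)
        <= tt ^+ 2.
      by apply: le_trans d2 _; rewrite ler_pXn2r// nnegrE ltW.
    apply: le_trans (pop_loss_close LG th0 mX sgX (@measurable_resp _ _ Y) mGr sgG mL
      (iL _) tt0 d2') _.
    have -> : tt / th * (2 + dotv (Bstar S *m v) (Bstar S *m v) + tt) =
      (2 + dotv (Bstar S *m v) (Bstar S *m v) + tt) / th * tt by ring.
    rewrite ler_wpM2r ?(ltW tt0)// /M1 ler_wpM2r ?invr_ge0 ?(ltW th0)//.
    by have := comb2 v vs; lra.
  have : 0 <= M2 * (D * T) by exact: mulr_ge0.
  by rewrite /excess_const; lra.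
(* The centred empirical loss of the zero predictor; once it is removed, only the process of
   differences remains. *)
exists (sample_sum (draw (S:=S)) (lossb (S:=S) L 0) w / n%:R -
  \int[law iidS]_y lossb (S:=S) L 0 y) => v vs.
rewrite (risk_starE iidS)//; have [u0 u1] := uw v vs.
set b := Bstar S *m v.
have bE : b = comb (fun k => v k 0) by exact: Bstar_comb.
pose b' (i : 'I_n) := Bcv S (fold S i) w *m v.
pose zs (i : 'I_n) := draw (S:=S) (train i) w.
have nA : (2 + a) * n%:R / th = n%:R * ((2 + a) / th) by ring.
have ath0 : 0 <= (2 + a) / th by rewrite divr_ge0 ?addr_ge0 ?(ltW th0).
have J0 : 0 <= J%:R :> R by [].
have Kb20 : 0 <= Kb ^+ 2 by exact: sqr_ge0.
have hG : \sum_i G (resp (zs i)) ^+ 2 <= n%:R * A.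
  apply: le_trans HG _; rewrite nA ler_wpM2l// /A ler_peMr//; lra.
have hb : \sum_i dotv b (covar S (zs i)) ^+ 2 <= n%:R * A.
  apply: (@le_trans _ _ (\sum_k v k 0 *
      sample_sum (draw (S:=S)) (fun y => dotv (bstar (e:=S) k) (covar S y) ^+ 2) w)).
    under [leRHS]eq_bigr do rewrite /sample_sum mulr_sumr.
    rewrite [leRHS]exchange_big; apply: ler_sum => i _.
    by rewrite bE /comb dotv_comb; exact: (sqr_mean_le u0 u1).
  apply: le_trans (mean_le u0 u1 Hbs) _.
  rewrite nA -mulrA ler_wpM2l// /A ler_wpM2l//; lra.
have hD tt : 0 < tt -> D * T <= tt ->
    \sum_i dotv (b' i - b) (covar S (zs i)) ^+ 2 <= n%:R * (A * tt ^+ 2).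
  move=> tt0 Dtt; apply: (@le_trans _ _ (\sum_(m < J) \sum_i
      dotv (Bcv S m w *m v - b) (covar S (zs i)) ^+ 2)).
    rewrite exchange_big; apply: ler_sum => i _.
    by rewrite (bigD1 (fold S i))//= lerDl sumr_ge0// => m _; exact: sqr_ge0.
  have DT2 : (D * T) ^+ 2 <= tt ^+ 2 by rewrite ler_pXn2r// nnegrE ltW.
  (* As T <= 1, the l1 contribution, of order T^4, is below the l2 one, of order T^2. *)
  have DTT : (D * T ^+ 2) ^+ 2 <= (D * T) ^+ 2.
    have DTT0 : 0 <= D * T ^+ 2 := mulr_ge0 (ltW D0) (sqr_ge0 T).
    rewrite ler_pXn2r ?nnegrE//; apply: ler_wpM2l (ltW D0) _ _ _.
    by rewrite expr2 ler_piMr.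
  apply: (@le_trans _ _ (\sum_(m < J) n%:R * ((2 + a) / th) * (5 * tt ^+ 2))).
    apply: ler_sum => m _; have [d2 d1] := comb_close (uw v vs) (Hcv m).
    rewrite -Bcv_comb -bE in d2 d1.
    apply: le_trans (Hup _) _; rewrite nA.
    by apply: ler_wpM2l; [exact: mulr_ge0 (ler0n R n) ath0|lra].
  rewrite sumr_const card_ord -[_ *+ _]mulr_natl.
  have -> : J%:R * (n%:R * ((2 + a) / th) * (5 * tt ^+ 2)) =
    n%:R * ((2 + a) / th * (5 * J%:R) * tt ^+ 2) by ring.
  rewrite ler_wpM2l// ler_wpM2r ?sqr_ge0// /A ler_wpM2l//; lra.
have h1 : `|\sum_i lossb L (b' i) (zs i) - \sum_i lossb L b (zs i)| / n%:R <= M2 * (D * T).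
  apply: (le_of_near_ge M20 DT0 DTB) => tt tt0 Dtt ttB.
  rewrite ler_pdivrMr// [leRHS]mulrC.
  apply: le_trans (emp_loss_close LG tt0 (ler0n R n) hG hb (hD tt tt0 Dtt)) _.
  rewrite ler_wpM2l// /M2 mulrAC ler_wpM2r ?(ltW tt0)// ler_wpM2l//; lra.
have h2 := Hemp _ (uw v vs).
set Q := n%:R^-1 * deviation (law iidS) (draw (S:=S)) (fun y =>
    lossb (S:=S) L (comb (fun k => v k 0)) y - lossb (S:=S) L 0 y) w.
have h3 : `|Q| <= Ce * Num.sqrt (Kb `^ (2 - q)) * T.
  by rewrite normrM ger0_norm ?invr_ge0// ler_pdivrMl.
have -> : CV L S w v / n%:R -
    (sample_sum (draw (S:=S)) (lossb (S:=S) L 0) w / n%:R -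
     \int[law iidS]_y lossb (S:=S) L 0 y) - \int[law iidS]_y lossb L b y =
    (\sum_i lossb L (b' i) (zs i) - \sum_i lossb L b (zs i)) / n%:R + Q.
  have S1 : sample_sum (draw (S:=S)) (fun y => lossb L b y - lossb (S:=S) L 0 y) w =
      \sum_i lossb L b (zs i) - sample_sum (draw (S:=S)) (lossb (S:=S) L 0) w.
    by rewrite /sample_sum -sumrB.
  rewrite /Q /deviation -bE RintegralB// S1 CVE.
  by field; rewrite gt_eqF.
apply: le_trans (ler_normD _ _) _.
rewrite normrM [`|n%:R^-1|]ger0_norm ?invr_ge0//.
have : 0 <= M1 * (D * T) by exact: mulr_ge0.
by rewrite /excess_const; lra.
Qed.

End good_event.

(** [F v] exceeds the infimum of [F] by at most eta', while the denominator keeps at least xi / 2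
    because [F] falls below [F0] by at most eta <= xi / 2. *)
Lemma ratio_bound (R : realType) (V : Type) (D : set V) (F F0 : V -> R) (v : V)
    (bayes eta eta' m : R) : let xi := inf [set F0 u | u in D] - bayes in
  D v -> (forall u, D u -> m <= F0 u) -> 0 < xi -> 0 <= eta' ->
  eta <= xi / 2 -> (forall u, D u -> F0 u - eta <= F u) ->
  (forall u, D u -> F v <= F u + eta') ->
  `|(F v - bayes) / (inf [set F u | u in D] - bayes) - 1| <= 2 * eta' / xi.
Proof.
move=> xi Dv mF xi0 e0 exi F0F FvF.
set iF := inf [set F u | u in D].
have lbF0 u : D u -> inf [set F0 u | u in D] <= F0 u.
  move=> Du; apply: ge_inf; last by exists u.
  by exists m => _ [u' Du' <-]; exact: mF.
have lF u : D u -> inf [set F0 u | u in D] - eta <= F u.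
  by move=> Du; apply: le_trans (F0F u Du); rewrite lerD2r; exact: lbF0.
have iF1 : inf [set F0 u | u in D] - eta <= iF.
  apply: lb_le_inf; first by exists (F v), v.
  by move=> _ [u Du <-]; exact: lF.
have iF2 : iF <= F v.
  apply: ge_inf; last by exists v.
  by exists (inf [set F0 u | u in D] - eta) => _ [u Du <-]; exact: lF.
have iF3 : F v - eta' <= iF.
  apply: lb_le_inf; first by exists (F v), v.
  by move=> _ [u Du <-]; have := FvF u Du; lra.
have d0 : xi / 2 <= iF - bayes by rewrite /xi in exi *; lra.
have dp : 0 < iF - bayes by lra.
have -> : (F v - bayes) / (iF - bayes) - 1 = (F v - iF) / (iF - bayes).
  by field; rewrite gt_eqF.
rewrite ger0_norm; last by rewrite divr_ge0 ?(ltW dp)// subr_ge0.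
rewrite ler_pdivrMr// mulrAC ler_pdivlMr//; nra.
Qed.

(** No measurability is involved: the integral of a nonnegative function is a supremum over the
    simple functions below it. This serves for [risk_dev], a supremum over an uncountable
    simplex. *)
Lemma ge0_integral_mono d (T : measurableType d) (R : realType)
    (mu : {measure set T -> \bar R}) (f g : T -> \bar R) :
  (forall x, 0 <= f x)%E -> (forall x, f x <= g x)%E ->
  (\int[mu]_x f x <= \int[mu]_x g x)%E.
Proof.
move=> f0 fg; have g0 x : (0 <= g x)%E by exact: le_trans (f0 x) (fg x).
rewrite !ge0_integralTE//; apply: ereal_sup_le => _ [h hf <-]; exists h => // x.
exact: le_trans (hf x) (fg x).
Qed.

(** * Risk ratios *)

Section one_sample.
Context {R : realType} {dY dE : measure_display}.
Context {Y : measurableType dY} {E : measurableType dE} {J n : nat}.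
Variable S : experiment (R := R) Y E J n.
Hypothesis iidS : iid_sample S.
Variables (L : Y -> R -> R) (G : Y -> R) (th Kb : R).
Hypothesis mL : measurable_fun setT (fun z : Y * R => L z.1 z.2).
Hypothesis LG : loss_modulus L G.
Hypothesis mG : measurable_fun setT G.
Hypotheses (th0 : 0 < th) (Kb0 : 0 < Kb).
Hypothesis sgX : forall v, dotv v v <= 1 ->
  (\int[law iidS]_y (expR (th * dotv v (covar S y) ^+ 2))%:E <= 2%:E)%E.
Hypothesis sgG : (\int[law iidS]_y (expR (th * G (resp y) ^+ 2))%:E <= 2%:E)%E.
Hypothesis iL : forall b : 'cV[R]_(p S), (law iidS).-integrable setT (EFin \o lossb L b).
Hypothesis bK : forall k, dotv (bstar (e:=S) k) (bstar (e:=S) k) <= Kb ^+ 2.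
Hypothesis mest : measurable_estimators S.

Let close b b' t := @pop_loss_close _ _ _ L G LG _ _ (law iidS) th (p S) (covar S) (@resp _ _ Y)
  th0 (measurable_covar (S:=S)) sgX (@measurable_resp _ _ Y)
  (measurableT_comp mG (@measurable_resp _ _ Y)) sgG mL b b' t (iL b).

Lemma simplex_weights (v : 'cV[R]_(K S)) : simplex v -> weights_on (fun k => v k 0).
Proof. by move=> [v0 v1]; split=> // k; have /andP[] := v0 k. Qed.

Lemma Bstar_sqr_le v : simplex v -> dotv (Bstar S *m v) (Bstar S *m v) <= Kb ^+ 2.
Proof. by move=> /simplex_weights[u0 u1]; rewrite Bstar_comb; apply: (dotvv_comb_le u0 u1). Qed.

(** Makes the infimum in [xi] a true lower bound: the loss at 0 is compared with that at vectors of
    norm at most Kb. *)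
Lemma risk_star_bounded_below : exists m, forall v, simplex v -> m <= risk_star L S v.
Proof.
exists (\int[law iidS]_y lossb (S:=S) L 0 y - Kb / th * (2 + Kb)) => v vs.
rewrite (risk_starE iidS)//.
have := @close (Bstar S *m v) 0 Kb Kb0.
rewrite subr0 dotv0l addr0 => /(_ (Bstar_sqr_le vs)).
by rewrite ler_norml => /andP[]; lra.
Qed.

(** A real supremum is an upper bound only for a bounded set; the bound found here depends on the
    sample through the estimation errors. *)
Lemma risk_dev_ub v w : simplex v ->
  `|risk L S v w - risk_star L S v| <= risk_dev L S w.
Proof.
move=> vs; apply: sup_upper_bound; last by exists v.
split; first by exists `|risk L S v w - risk_star L S v|, v.
pose c := \sum_k dotv (bhat k w - bstar (e:=S) k) (bhat k w - bstar (e:=S) k).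
have c0 : 0 <= c by apply: sumr_ge0 => k _; exact: dotvv_ge0.
exists ((c + 1) / th * (2 + Kb ^+ 2 + (c + 1))) => _ [u us <-].
have [u0 u1] := simplex_weights us.
have dl : dotv (Bhat S w *m u - Bstar S *m u) (Bhat S w *m u - Bstar S *m u)
    <= (c + 1) ^+ 2.
  rewrite Bhat_comb Bstar_comb -sumrB; under eq_bigr do rewrite -scalerBr.
  apply: (@le_trans _ _ c); last by rewrite expr2; nra.
  apply: (dotvv_comb_le u0 u1) => k; rewrite /c (bigD1 k)//= lerDl.
  by apply: sumr_ge0 => k' _; exact: dotvv_ge0.
rewrite (riskE iidS)// (risk_starE iidS)//.
have c1 : 0 < c + 1 by lra.
apply: le_trans (close c1 dl) _.
rewrite ler_wpM2l ?divr_ge0 ?(ltW c1) ?(ltW th0)//.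
by have := Bstar_sqr_le us; lra.
Qed.

Lemma measurable_risk v : measurable_fun setT (risk L S v).
Proof.
pose f (x : Om S * observation (R := R) Y) := lossb L (Bhat S x.1 *m v) x.2.
have mf : measurable_fun setT f.
  have m1 : measurable_fun setT (fun x : Om S * observation (R := R) Y => resp x.2).
    exact: (measurableT_comp (@measurable_resp _ _ Y) measurable_snd).
  have m2 : measurable_fun setT (fun x : Om S * observation (R := R) Y =>
      dotv (Bhat S x.1 *m v) (covar S x.2)).
    apply: measurable_sum => j; apply: measurable_funM; last first.
      exact: (measurableT_comp (measurable_covar (S:=S) j) measurable_snd).
    rewrite (_ : (fun x => _) = (fun x : Om S * observation (R := R) Y =>
        \sum_k bhat (e:=S) k x.1 j 0 * v k 0)); last first.
      by apply/funext => x; rewrite mxE; apply: eq_bigr => k _; rewrite mxE.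
    apply: measurable_sum => k; apply: measurable_funM => //.
    exact: (measurableT_comp (measurable_bhat iidS mest k j) measurable_fst).
  exact: (measurableT_comp mL (measurable_fun_pair m1 m2)).
pose h x := (f x)%:E.
have mh : measurable_fun setT h by exact/measurable_EFinP.
have -> : risk L S v = fine \o (fun w => \int[law iidS]_y h^\+ (w, y) -
    \int[law iidS]_y h^\- (w, y))%E.
  apply/funext => w; rewrite (riskE iidS)// /Rintegral /= integralE.
  by congr (fine (_ - _)%E); apply: eq_integral => y _;
    rewrite ?funeposE ?funenegE.
apply: measurableT_comp => //; apply: emeasurable_funB.
  exact: (measurable_fun_fubini_tonelli_F _ (measurable_funepos mh)).
exact: (measurable_fun_fubini_tonelli_F _ (measurable_funeneg mh)).
Qed.

Variables (xi0 eta M e eps : R).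
Hypotheses (xi_gt0 : 0 < xi0) (eta0 : 0 <= eta) (M0 : 0 <= M).
Hypothesis good : prob_ge (Pr S) (1 - eps) [set w | forall v, simplex v ->
  `|risk L S v w - risk_star L S v| <= xi0 * eta].
Hypothesis UI : (\int[Pr S]_(w in [set w | (M < `|xi0^-1 * risk_dev L S w|)%R])
  `|xi0^-1 * risk_dev L S w|%:E <= e%:E)%E.

(** The normalized deviation is at most eta on the good event and at most M off it, except where it
    exceeds M, a part whose mean uniform integrability bounds by e. *)
Lemma risk_mean_close v : simplex v ->
  (Pr S).-integrable setT (EFin \o risk L S v) /\
  `|risk_mean L S v - risk_star L S v| <= xi0 * (eta + M * eps + e).
Proof.
move=> vs; have [B [mB Bgood PB]] := good.
pose r w := xi0^-1 * `|risk L S v w - risk_star L S v|.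
have r0 w : 0 <= r w by rewrite mulr_ge0// invr_ge0 ltW.
have mr : measurable_fun setT r.
  apply: measurable_funM => //; apply: measurableT_comp => //.
  by apply: measurable_funB => //; exact: measurable_risk.
pose U w := xi0^-1 * risk_dev L S w.
have rU w : r w <= `|U w|.
  apply: le_trans (ler_norm _); rewrite /r /U ler_wpM2l ?invr_ge0 ?(ltW xi_gt0)//.
  exact: risk_dev_ub.
have rB w : B w -> r w <= eta.
  move=> Bw; rewrite /r ler_pdivrMl//; exact: Bgood.
(* Truncating [r] instead of the supremum keeps the integrand measurable; the tail of [risk_dev]
   enters only as a pointwise majorant. *)
pose big w := if M < r w then r w else 0.
have mbig : measurable_fun setT big.
  by apply: measurable_fun_ifT => //; exact: measurable_fun_ltr.
have big0 w : 0 <= big w by rewrite /big; case: ifP.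
have Ebig : (\int[Pr S]_w (big w)%:E <= e%:E)%E.
  apply: le_trans UI; rewrite [leRHS]integral_mkcond.
  apply: ge0_integral_mono => w; first by rewrite lee_fin.
  rewrite patchE /big; case: ifPn => [Mr|_]; last first.
    by case: ifP => // _; rewrite lee_fin.
  rewrite mem_set /=; first by rewrite lee_fin.
  exact: lt_le_trans Mr (rU w).
have split_r w : r w <= eta + M * \1_(~` B) w + big w.
  rewrite indicE; have [Bw|Bw] := pselect (B w).
    rewrite memNset; last by move=> /(_ Bw).
    by have := rB w Bw; have := big0 w; rewrite mulr0; lra.
  rewrite mem_set// mulr1 /big; have := eta0; have := M0; case: ltP => h; lra.
have i1 : (Pr S).-integrable setT (EFin \o (fun w => \1_(~` B) w : R)).
  have mnB := measurableC mB.
  apply: (@ge0_integrable _ _ _ _ _ 1); first exact: measurable_indic.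
    by move=> w; rewrite indicE.
  by rewrite integral_indic// setIT probability_le1.
have i2 := ge0_integrable mbig big0 Ebig.
have ib := integrableD_EFin (integrableD_EFin (integrable_cst (Pr S) eta)
  (integrableZ_EFin M i1)) i2.
have ir : (Pr S).-integrable setT (EFin \o r).
  by apply: integrable_dominated mr _ ib => w; rewrite ger0_norm.
have Er : \int[Pr S]_w r w <= eta + M * eps + e.
  apply: le_trans (Rintegral_mono ir ib split_r) _.
  rewrite RintegralD//; last first.
    exact: (integrableD_EFin (integrable_cst (Pr S) eta) (integrableZ_EFin M i1)).
  rewrite RintegralD//; [|exact: (integrable_cst (Pr S) eta)|exact: integrableZ_EFin].
  rewrite Rintegral_cstT RintegralZl//; apply: lerD; last first.
    exact: Rintegral_le mbig big0 Ebig.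
  rewrite lerD2l ler_wpM2l// /Rintegral integral_indic//=; last exact: measurableC.
  rewrite setIT probability_setC//.
  rewrite -(fineK (fin_num_measure (Pr S) B mB)) in PB *.
  by move: PB; rewrite -EFinB /= lee_fin; lra.
have mrisk := measurable_risk v.
have idiff : (Pr S).-integrable setT (EFin \o (fun w => risk L S v w - risk_star L S v)).
  apply: integrable_dominated _ _ (integrableZ_EFin xi0 ir).
    by apply: measurable_funB => //; exact: measurable_cst.
  by move=> w; rewrite /r mulrA divff ?mul1r// gt_eqF.
have irisk : (Pr S).-integrable setT (EFin \o risk L S v).
  have := integrableD_EFin idiff (integrable_cst (Pr S) (risk_star L S v)).
  by under [X in _.-integrable _ (_ \o X)]eq_fun do rewrite subrK.
split=> //.
have -> : risk_mean L S v - risk_star L S v =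
    \int[Pr S]_w (risk L S v w - risk_star L S v).
  rewrite RintegralB//; last exact: (integrable_cst (Pr S)).
  by rewrite Rintegral_cstT.
apply: le_trans (le_normr_Rintegral measurableT idiff) _.
have -> : (\int[Pr S]_w `|risk L S v w - risk_star L S v|) = xi0 * \int[Pr S]_w r w.
  rewrite -RintegralZl//; apply: eq_Rintegral => w _.
  by rewrite /r mulrA divff ?mul1r// gt_eqF.
by rewrite ler_wpM2l// ltW.
Qed.

End one_sample.

(** In dimension 0 the unit sphere is empty and the supremum over it is -oo, not a real number. *)
Lemma psi2_normv_gt0_dim (R : realType) (d : measure_display) (T : measurableType d)
    (P : probability T R) (m : nat) (X : T -> 'cV[R]_m) (c : R) :
  psi2_normv P X = c%:E -> (0 < m)%N.
Proof.
case: m X => // X; rewrite /psi2_normv.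
rewrite (_ : [set v : 'cV[R]_0 | lqnorm 2 v = 1] = set0) ?image_set0 ?ereal_sup0//.
apply/seteqP; split => // v /=; rewrite lqnorm2E /dotv big_ord0 sqrtr0 => /eqP.
by rewrite eq_sym oner_eq0.
Qed.

Lemma ord_unique m (k l : 'I_m) : m = 1%N -> k = l.
Proof. by move=> m1; subst m; rewrite (ord1 k) (ord1 l). Qed.

Section consequences.
Context {R : realType} {dY dE : measure_display}.
Context {Y : measurableType dY} {E : measurableType dE} {J n : nat}.
Variable S : experiment (R := R) Y E J n.
Hypothesis iidS : iid_sample S.
Variables (L : Y -> R -> R) (th : R).
Hypothesis mL : measurable_fun setT (fun z : Y * R => L z.1 z.2).

Lemma subgaussian_law (K_x : R) : 0 < K_x -> 0 < th <= (4 * K_x ^+ 2)^-1 ->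
  psi2_normv (Pr S) (X_ S first) = K_x%:E ->
  forall v, dotv v v <= 1 ->
  (\int[law iidS]_y (expR (th * dotv v (covar S y) ^+ 2))%:E <= 2%:E)%E.
Proof.
move=> K0 /andP[th0 thK] XK v v1; have [_ mx _ _] := iidS.
have mX j : measurable_fun setT (fun w => X_ S first w j 0).
  by rewrite (_ : (fun w => _) = x_ first j)//; apply/funext => w; rewrite mxE.
have XK' : (psi2_normv (Pr S) (X_ S first) <= K_x%:E)%E by rewrite XK.
have h := psi2_normv_le mX K0 XK' v1.
rewrite -(ge0_integral_draw (iid_draws_sample iidS) first); last 2 first.
- apply/measurable_EFinP; apply: (measurableT_comp (@measurable_expR R)).
  apply: measurable_funM => //; apply: measurable_funX.
  exact: (measurable_dotv (measurable_covar (S:=S))).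
- by move=> y; rewrite lee_fin expR_ge0.
under eq_integral do rewrite covar_draw.
apply: (subgaussian_mono (measurable_dotv mX v) (measurable_dotv mX v) _ _ h) => //.
by rewrite thK ltW.
Qed.

Lemma subgaussian_resp (G : Y -> R) : measurable_fun setT G ->
  (\int[Pr S]_w (expR (th * G (y_ first w) ^+ 2))%:E <= 2%:E)%E ->
  (\int[law iidS]_y (expR (th * G (resp y) ^+ 2))%:E <= 2%:E)%E.
Proof.
move=> mG; rewrite -(ge0_integral_draw (iid_draws_sample iidS) first)//.
apply/measurable_EFinP; apply: (measurableT_comp (@measurable_expR R)).
apply: measurable_funM => //; apply: measurable_funX.
exact: (measurableT_comp mG (@measurable_resp _ _ Y)).
Qed.

Hypothesis pseudo : pseudo_true L S.

Lemma lossb_bstar_integrable k :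
  (law iidS).-integrable setT (EFin \o lossb L (bstar (e:=S) k)).
Proof.
have [_ ib _] := pseudo k.
apply: (integrable_draw iidS (i := first) (measurable_lossb mL _)).
by move: ib; congr (_.-integrable _ _); apply/funext => w /=; rewrite lossb_draw.
Qed.

Hypothesis iL : forall b : 'cV[R]_(p S), (law iidS).-integrable setT (EFin \o lossb L b).

Lemma pop_loss_bstar k b : supported (A (e:=S) k) b ->
  \int[law iidS]_y lossb L (bstar (e:=S) k) y <= \int[law iidS]_y lossb L b y.
Proof.
move=> sb; have [_ _ /(_ b sb)] := pseudo k.
have ib : (Pr S).-integrable setT (EFin \o (fun w => L (y_ first w) (dotv b (X_ S first w)))).
  have /integrableP[_ fin] := iL b; apply/integrableP; split.
    apply/measurable_EFinP; rewrite (_ : (fun w => _) = lossb L b \o draw (S:=S) first).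
      exact: (measurableT_comp (measurable_lossb mL b) (measurable_draw iidS first)).
    by apply/funext => w /=; rewrite lossb_draw.
  rewrite -(integral_draw iidS first (h := fun y => `|(lossb L b y)%:E|%E)) in fin.
    by under eq_integral do rewrite /= -lossb_draw.
  by apply: measurableT_comp => //; apply/measurable_EFinP; exact: measurable_lossb.
have hm : has_mean (Pr S) (fun w => L (y_ first w) (dotv b (X_ S first w))).
  by left; exact: (integral_funepos_lt_pinfty measurableT ib).
move=> /(_ hm); rewrite unlock.
have tr c : (\int[Pr S]_w (L (y_ first w) (dotv c (X_ S first w)))%:E =
    (\int[law iidS]_y lossb L c y)%:E)%E.
  rewrite -EFin_Rintegral// -(integral_draw iidS first (h := fun y => (lossb L c y)%:E)).
    by apply: eq_integral => w _; rewrite lossb_draw.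
  by apply/measurable_EFinP; exact: measurable_lossb.
by rewrite !tr lee_fin.
Qed.

Lemma simplex_single (v : 'cV[R]_(K S)) : K S = 1%N -> simplex v -> forall k, v k 0 = 1.
Proof.
move=> K1 [_ v1] k; rewrite -v1 (bigD1 k)//= big1 ?addr0// => l lk.
by rewrite (ord_unique l k K1) eqxx in lk.
Qed.

(** With a single model, the estimator is itself a competitor in the problem that the pseudo-true
    vector solves. *)
Lemma risk_single (r : R -> R -> R) v w : K S = 1%N -> estimators L r S ->
  simplex v -> risk_star L S v <= risk L S v w.
Proof.
move=> K1 est vs; have k0 : 'I_(K S) by rewrite K1; exact: ord0.
have v1 := simplex_single K1 vs.
have one (b : 'I_(K S) -> 'cV[R]_(p S)) : \sum_k v k 0 *: b k = b k0.
  rewrite (bigD1 k0)//= v1 scale1r big1 ?addr0// => l lk.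
  by rewrite (ord_unique l k0 K1) eqxx in lk.
rewrite (riskE iidS)// (risk_starE iidS)// Bhat_comb Bstar_comb !one.
by apply: pop_loss_bstar; have [] := est k0 w.
Qed.

Lemma models_gt0 : cv_weights L S -> (0 < K S)%N.
Proof.
move=> cw; have [[_ w1] _] := cw point; rewrite lt0n; apply/eqP => K0.
move: w1; rewrite big1 => [/eqP|k _]; first by rewrite eq_sym oner_eq0.
by have := ltn_ord k; rewrite {2}K0.
Qed.

End consequences.

Section ratios.
Context {R : realType} {dY dE : measure_display}.
Context {Y : measurableType dY} {E : measurableType dE} {J n : nat}.
Variable S : experiment (R := R) Y E J n.
Variables (L : Y -> R -> R) (m eta : R) (w : Om S).
Hypothesis lb : forall v, simplex v -> m <= risk_star L S v.
Hypothesis cw : cv_weights L S.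
Hypothesis xi0 : 0 < xi L S.
Hypotheses (n0 : (0 < n)%N) (eta0 : 0 <= eta).

Lemma risk_star_what : (exists c0, forall v, simplex v ->
    `|CV L S w v / n%:R - c0 - risk_star L S v| <= eta) ->
  forall v, simplex v -> risk_star L S (what w) <= risk_star L S v + 2 * eta.
Proof.
move=> [c0 H] v vs; have [ws wmin] := cw w.
have := H _ ws; have := H _ vs; rewrite !ler_norml => /andP[h1 h2] /andP[h3 h4].
have : CV L S w (what w) / n%:R <= CV L S w v / n%:R.
  by rewrite ler_wpM2r ?invr_ge0//; exact: wmin.
lra.
Qed.

Lemma risk_ratio_le : eta <= xi L S / 2 ->
  (forall v, simplex v -> `|risk L S v w - risk_star L S v| <= eta) ->
  (exists c0, forall v, simplex v ->
    `|CV L S w v / n%:R - c0 - risk_star L S v| <= eta) ->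
  `|risk_ratio L S w - 1| <= 8 * eta / xi L S.
Proof.
move=> exi H /risk_star_what H'; have [ws _] := cw w.
(* Passing from R to R* and back costs eta each way, and near-optimality of [what] for R* costs 2
   eta: 4 eta in all. *)
have -> : 8 * eta = 2 * (4 * eta) by ring.
apply: (ratio_bound ws lb xi0 _ exi) => [|u us|u us]; first by rewrite mulr_ge0.
  by have := H u us; rewrite ler_norml => /andP[]; lra.
have := H u us; have := H _ ws; rewrite !ler_norml => /andP[h1 h2] /andP[h3 h4].
have := H' u us; lra.
Qed.

Lemma risk_mean_ratio_le (eta2 : R) : 0 <= eta2 -> eta2 <= xi L S / 2 ->
  (forall v, simplex v -> `|risk_mean L S v - risk_star L S v| <= eta2) ->
  (exists c0, forall v, simplex v ->
    `|CV L S w v / n%:R - c0 - risk_star L S v| <= eta) ->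
  `|risk_mean_ratio L S w - 1| <= 4 * (eta + eta2) / xi L S.
Proof.
move=> e20 exi H /risk_star_what H'; have [ws _] := cw w.
have -> : 4 * (eta + eta2) = 2 * (2 * eta + 2 * eta2) by ring.
apply: (ratio_bound ws lb xi0 _ exi) => [|u us|u us].
- by have := eta0; lra.
- by have := H u us; move: (risk_mean L S u) (risk_star L S u) => x y;
    rewrite ler_norml => /andP[]; lra.
have := H' u us; have := H u us; have := H _ ws.
move: (risk_mean L S u) (risk_star L S u) (risk_mean L S _) (risk_star L S _).
by move=> x y z t; rewrite !ler_norml => /andP[h1 h2] /andP[h3 h4]; lra.
Qed.

(** On a one-point simplex F(what) is the infimum; since [F] dominates R*, the denominator stays
    positive and the ratio is exactly 1. *)
Lemma ratio_single (F : 'cV[R]_(K S) -> R) : K S = 1%N ->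
  (forall v, simplex v -> risk_star L S v <= F v) ->
  `|(F (what w) - risk_bayes L S) /
    (inf [set F v | v in simplex (m:=K S)] - risk_bayes L S) - 1| <= 0.
Proof.
move=> K1 H; have [ws _] := cw w.
rewrite -[leRHS](mul0r (xi L S)^-1) -[X in _ <= X / _](mulr0 2).
apply: (ratio_bound (eta := 0) ws lb xi0) => // [|u us|u us].
- by rewrite divr_ge0// ltW.
- by rewrite subr0; exact: H.
suff -> : u = what w by rewrite addr0.
apply/matrixP => k l; rewrite (ord1 l).
by rewrite (simplex_single K1 us) (simplex_single K1 ws).
Qed.

End ratios.

(** * The two types of loss *)

Section losses.
Context {R : realType} {dY dE : measure_display}.
Context {Y : measurableType dY} {E : measurableType dE} {J n : nat}.
Variable S : experiment (R := R) Y E J n.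
Hypothesis iidS : iid_sample S.
Variables (L : Y -> R -> R) (th Kb a : R).
Hypothesis mL : measurable_fun setT (fun z : Y * R => L z.1 z.2).
Hypotheses (th0 : 0 < th) (Kb0 : 0 < Kb) (a0 : 0 <= a).
Hypothesis sgX : forall v, dotv v v <= 1 ->
  (\int[law iidS]_y (expR (th * dotv v (covar S y) ^+ 2))%:E <= 2%:E)%E.

(** Shared conclusion of the two empirical process bounds, with a constant that does not depend on
    the scale [sg]. *)
Definition emp_bound (Ce : R) : Prop :=
  1 / 2 <= ln (p S * K S)%:R :> R -> #|'I_(K S)|%:R <= expR (ln (p S * K S)%:R) :> R ->
  (6 + 2 * a) * ln (p S * K S)%:R <= n%:R ->
  forall sg, 0 < sg -> sg <= Kb ->
  (forall k, dotv (bstar (e:=S) k) (bstar (e:=S) k) <= sg ^+ 2) ->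
  prob_ge (Pr S) (1 - 3 * expR (- a)) [set w | forall u, weights_on u ->
    `|deviation (law iidS) (draw (S:=S)) (fun y =>
        lossb (S:=S) L (\sum_k u k *: bstar (e:=S) k) y - lossb (S:=S) L 0 y) w| <=
      Ce * (sg * Num.sqrt (n%:R * ln (p S * K S)%:R))].

Lemma emp_bound_square (e : Y -> R) : (forall y m, L y m = 1 / 2 * (e y - m) ^+ 2) ->
  measurable_fun setT e ->
  (\int[law iidS]_y (expR (th * e (resp y) ^+ 2))%:E <= 2%:E)%E ->
  emp_bound (66 * (1 + Kb) * Num.sqrt (6 + 2 * a) / th).
Proof.
move=> LE me e2 lam12 Klam lamn sg sg0 sgK bsg; have ea := expR_ge0 (- a).
have := emp_process_square (iid_draws_sample iidS) th0 (measurable_covar (S:=S)) sgX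
  sg0 bsg a0 lam12 Klam LE (measurableT_comp me (@measurable_resp _ _ Y)) e2 lamn.
move=> H; apply: (prob_geS _ (prob_ge_le _ H)); last by lra.
move=> w /= h u [u0 u1]; apply: le_trans (h u u0 u1) _.
rewrite ler_wpM2r ?mulr_ge0 ?sqrtr_ge0 ?(ltW sg0)//.
rewrite ler_wpM2r ?invr_ge0 ?(ltW th0)// ler_wpM2r ?sqrtr_ge0//.
by rewrite ler_wpM2l// lerD2l.
Qed.

Lemma emp_bound_lipschitz (Lu : R) : 0 < Lu ->
  (forall y m1 m2, `|L y m1 - L y m2| <= Lu * `|m1 - m2|) ->
  (forall b : 'cV[R]_(p S), (law iidS).-integrable setT (EFin \o lossb L b)) ->
  emp_bound ((12 * expR a + 2) * Lu / Num.sqrt th).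
Proof.
move=> Lu0 LL iL lam12 Klam lamn sg sg0 sgK bsg.
have lamn' : ln (p S * K S)%:R <= n%:R :> R.
  by apply: le_trans lamn; have := a0; nra.
have := emp_process_lipschitz (iid_draws_sample iidS) th0 (measurable_covar (S:=S)) sgX
  (@measurable_resp _ _ Y) mL sg0 bsg a0 lam12 Klam Lu0 LL iL lamn'.
by apply: prob_geS => w /= h u [u0 u1]; exact: h.
Qed.

End losses.

Section modulus.
Context {R : realType} {dY : measure_display} {Y : measurableType dY}.
Variable L : Y -> R -> R.

(** With f = e y - b and g = a - b the difference is g (g / 2 - f); the product |g| |f| is split by
    the weighted arithmetic-geometric inequality, and f^2 <= 2 (e^2 + b^2). *)
Lemma square_modulus (e : Y -> R) :
  (forall y m, L y m = 1 / 2 * (e y - m) ^+ 2) -> loss_modulus L e.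
Proof.
move=> LE y a b t t0; rewrite !LE.
set f := e y - b; set g := a - b.
have -> : 1 / 2 * (e y - a) ^+ 2 - 1 / 2 * f ^+ 2 = g * (1 / 2 * g - f).
  by rewrite /f /g; field.
have amgm : `|g| * `|f| <= (t * f ^+ 2 + t^-1 * g ^+ 2) / 2.
  rewrite -[f ^+ 2]real_normK ?num_real// -[g ^+ 2]real_normK ?num_real//.
  have := sqr_ge0 (t * `|f| - `|g|).
  have -> : (t * `|f| ^+ 2 + t^-1 * `|g| ^+ 2) / 2 = `|g| * `|f| +
      t^-1 * (t * `|f| - `|g|) ^+ 2 / 2 by field; rewrite gt_eqF.
  by move=> h; rewrite lerDl divr_ge0// mulr_ge0// invr_ge0 ltW.
have n1 : `|g * (1 / 2 * g - f)| <= 1 / 2 * g ^+ 2 + `|g| * `|f|.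
  rewrite normrM -[g ^+ 2]real_normK ?num_real//.
  have : `|1 / 2 * g - f| <= 1 / 2 * `|g| + `|f|.
    by apply: le_trans (ler_normB _ _) _; rewrite normrM ger0_norm//.
  by move=> /(ler_wpM2l (normr_ge0 g)); rewrite expr2; lra.
have f2 : f ^+ 2 <= 2 * (e y ^+ 2 + b ^+ 2).
  by rewrite /f; have := sqr_ge0 (e y + b); rewrite !expr2; lra.
have tf : t * f ^+ 2 <= t * (2 * (e y ^+ 2 + b ^+ 2)) by rewrite ler_pM2l.
have tg : 0 <= t^-1 * g ^+ 2 by rewrite mulr_ge0 ?sqr_ge0// invr_ge0 ltW.
have g0 := sqr_ge0 g.
by apply: le_trans n1 _; rewrite mulrDr (mulrDl t^-1); lra.
Qed.

Lemma lipschitz_modulus (Lu : R) :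
  (forall y m1 m2, `|L y m1 - L y m2| <= Lu * `|m1 - m2|) ->
  loss_modulus L (fun=> Lu).
Proof.
move=> LL y a b t t0; apply: le_trans (LL y a b) _.
rewrite -[(a - b) ^+ 2]real_normK ?num_real//; set g := `|a - b|.
have h := sqr_ge0 (t * Lu - g / 2).
have -> : t * (Lu ^+ 2 + b ^+ 2) + (t^-1 + 1) * g ^+ 2 =
   Lu * g + t^-1 * (t * Lu - g / 2) ^+ 2 + t * b ^+ 2 + 3 / 4 * (t^-1 * g ^+ 2) + g ^+ 2.
  by field; rewrite gt_eqF.
have ti : 0 <= t^-1 by rewrite invr_ge0 (ltW t0).
have h1 := mulr_ge0 ti h; have h2 := mulr_ge0 (ltW t0) (sqr_ge0 b).
have h3 := mulr_ge0 ti (sqr_ge0 g); have := sqr_ge0 g; lra.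
Qed.

(** [e] inherits measurability from the loss, because L(y,0) - L(y,1) = e(y) - 1/2. *)
Lemma square_residual_measurable (e : Y -> R) :
  measurable_fun setT (fun z : Y * R => L z.1 z.2) ->
  (forall y m, L y m = 1 / 2 * (e y - m) ^+ 2) -> measurable_fun setT e.
Proof.
move=> mL LE.
have mc (x : R) : measurable_fun setT (fun y => L y x).
  have h : measurable_fun setT (fun y : Y => (y, x)).
    by apply: measurable_fun_pair => //; exact: measurable_cst.
  exact: (measurableT_comp mL h).
have -> : e = (fun y => 1 / 2 + L y 0 - L y 1).
  by apply/funext => y; rewrite !LE; field.
by apply: measurable_funB => //; apply: measurable_funD => //; exact: measurable_cst.
Qed.

(** Through this identity the sub-gaussian norm of the derivative at 0 becomes that of the response
    e(Y). *)
Lemma derive1_square (e : Y -> R) y :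
  (forall y m, L y m = 1 / 2 * (e y - m) ^+ 2) -> derive1 (L y) 0 = - e y.
Proof.
move=> LE; rewrite derive1E; apply: derive_val.
apply/is_derive1_caratheodory; exists (fun m => 1 / 2 * m - e y); split.
- by move=> m; rewrite !LE; field.
- by apply: cvgB; [apply: cvgMr; exact: cvg_id|exact: cvg_cst].
- by rewrite mulr0 add0r.
Qed.

End modulus.

Definition subgaussian_sample {R : realType} {dY dE : measure_display}
    {Y : measurableType dY} {E : measurableType dE} {J n : nat}
    (S : experiment (R := R) Y E J n) (L : Y -> R -> R) (K_x K_y : R) : Prop :=
  psi2_normv (Pr S) (X_ S first) = K_x%:E /\
  psi2_norm (Pr S) (fun w => derive1 (L (y_ first w)) 0) = K_y%:E.

Section loss_types.
Context {R : realType} {dY dE : measure_display}.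
Context {Y : measurableType dY} {E : measurableType dE}.
Variables (L : Y -> R -> R) (K_x K_y : R).
Hypothesis mL : measurable_fun setT (fun z : Y * R => L z.1 z.2).
Hypotheses (Kx0 : 0 < K_x) (Ky0 : 0 < K_y).

(** All that the final argument needs to know of the loss. [th], [G] and [Ce] are quantified before
    the experiment, which makes them constants in n. *)
Definition tame_loss (th : R) (G : Y -> R) : Prop :=
  [/\ 0 < th <= (4 * K_x ^+ 2)^-1, measurable_fun setT G, loss_modulus L G,
    (forall J n (S : experiment (R := R) Y E J n) (iidS : iid_sample S),
      subgaussian_sample S L K_x K_y ->
      (\int[law iidS]_y (expR (th * G (resp y) ^+ 2))%:E <= 2%:E)%E) &
    (forall Kb a, 0 < Kb -> 0 <= a -> exists2 Ce, 0 <= Ce &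
      forall J n (S : experiment (R := R) Y E J n) (iidS : iid_sample S),
      subgaussian_sample S L K_x K_y ->
      (forall b : 'cV[R]_(p S), (law iidS).-integrable setT (EFin \o lossb L b)) ->
      emp_bound iidS L Kb a Ce)].

Let inv4 (x : R) : 0 < x -> 0 < (4 * x ^+ 2)^-1.
Proof. by move=> x0; rewrite invr_gt0 mulr_gt0 ?exprn_gt0. Qed.

Lemma tame_square (e : Y -> R) : (forall y mu, L y mu = 1 / 2 * (e y - mu) ^+ 2) ->
  exists th G, tame_loss th G.
Proof.
move=> LE; have me := square_residual_measurable mL LE.
have Kx4 := inv4 Kx0; have Ky4 := inv4 Ky0.
pose th := Num.min (4 * K_x ^+ 2)^-1 (4 * K_y ^+ 2)^-1.
have th0 : 0 < th by rewrite lt_min Kx4 Ky4.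
have thx : 0 < th <= (4 * K_x ^+ 2)^-1 by rewrite th0 ge_min lexx.
have sge J n (S : experiment (R := R) Y E J n) (iidS : iid_sample S) :
    subgaussian_sample S L K_x K_y ->
    (\int[law iidS]_y (expR (th * e (resp y) ^+ 2))%:E <= 2%:E)%E.
  move=> [_ sgy]; apply: subgaussian_resp => //.
  have [my _ _ _] := iidS.
  have mey : measurable_fun setT (fun w => e (y_ (e:=S) first w)) by exact: measurableT_comp.
  have mney : measurable_fun setT (fun w => - e (y_ (e:=S) first w)).
    exact: measurableT_comp.
  have sgy' : (psi2_norm (Pr S) (fun w => (- e (y_ first w))%R) <= K_y%:E)%E.
    by rewrite -sgy; under [X in (_ <= psi2_norm _ X)%E]eq_fun do rewrite (derive1_square _ LE).
  apply: (subgaussian_mono mey mney _ _ (psi2_norm_le mney Ky0 sgy')) => [|w].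
    by rewrite (ltW th0) ge_min lexx orbT.
  by rewrite sqrrN.
exists th, e; split => //; first exact: square_modulus.
move=> Kb a Kb0 a0; exists (66 * (1 + Kb) * Num.sqrt (6 + 2 * a) / th).
  rewrite divr_ge0 ?(ltW th0)// mulr_ge0 ?sqrtr_ge0// mulr_ge0// addr_ge0//.
  exact: ltW.
move=> J n S iidS sg iL; apply: emp_bound_square => //; last exact: sge.
by case: sg => sgx _; exact: subgaussian_law sgx.
Qed.

Lemma tame_lipschitz (Lu : R) : 0 < Lu ->
  (forall y mu1 mu2, `|L y mu1 - L y mu2| <= Lu * `|mu1 - mu2|) ->
  exists th G, tame_loss th G.
Proof.
move=> Lu0 LL; have Kx4 := inv4 Kx0.
have Lu4 : 0 < (2 * Lu ^+ 2)^-1 by rewrite invr_gt0 mulr_gt0 ?exprn_gt0.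
pose th := Num.min (4 * K_x ^+ 2)^-1 (2 * Lu ^+ 2)^-1.
have th0 : 0 < th by rewrite lt_min Kx4 Lu4.
have thx : 0 < th <= (4 * K_x ^+ 2)^-1 by rewrite th0 ge_min lexx.
exists th, (fun=> Lu); split => //; first exact: lipschitz_modulus.
  move=> J n S iidS sg; rewrite integral_cst//= probability_setT mule1 lee_fin.
  (* For the constant function G = Lu the moment condition is exp(th Lu^2) <= 2, and ln 2 >= 1/2. *)
  have thL : th * Lu ^+ 2 <= 2^-1.
    have : th <= (2 * Lu ^+ 2)^-1 by rewrite ge_min lexx orbT.
    move=> /(ler_wpM2r (sqr_ge0 Lu)) /le_trans; apply.
    by rewrite invfM -mulrA mulVf ?mulr1// expf_neq0 ?gt_eqF.
  rewrite -[2%:R](@lnK R) ?posrE// ler_expR (le_trans thL)//.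
  by have := @ln2_ge_half R; lra.
move=> Kb a Kb0 a0; exists ((12 * expR a + 2) * Lu / Num.sqrt th).
  by rewrite divr_ge0 ?sqrtr_ge0// mulr_ge0 ?(ltW Lu0)// addr_ge0// mulr_ge0// expR_ge0.
move=> J n S iidS sg iL; apply: emp_bound_lipschitz => //.
by case: sg => sgx _; exact: subgaussian_law sgx.
Qed.

End loss_types.

(** * Tail bounds for the two ratios at one sample size *)

Section one_experiment.
Context {R : realType} {dY dE : measure_display}.
Context {Y : measurableType dY} {E : measurableType dE} {J n : nat}.
Variable S : experiment (R := R) Y E J n.
Variables (L : Y -> R -> R) (r : R -> R -> R) (G : Y -> R).
Variables (th q C0 Kb K_x K_y : R).
Hypothesis mL : measurable_fun setT (fun z : Y * R => L z.1 z.2).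
Hypotheses (Kx0 : 0 < K_x) (q01 : 0 <= q <= 1) (C00 : 0 < C0) (Kb0 : 0 < Kb).
Hypothesis tame : tame_loss (E := E) L K_x K_y th G.
Hypotheses (J2 : (2 <= J)%N) (adm : admissible J n) (iidS : iid_sample S).
Hypothesis sgS : subgaussian_sample S L K_x K_y.
Hypotheses (est : estimators L r S) (cw : cv_weights L S).
Hypotheses (mest : measurable_estimators S) (pseudo : pseudo_true L S).
Hypothesis bK : forall k, lqnorm 2 (bstar (e:=S) k) <= Kb.
Hypothesis bhat_rate : forall (k : 'I_(K S)) (delta : R), 0 < delta < 1 ->
  ((1 - 4 * expR (- (n%:R * delta ^+ 2)))%:E <=
    Pr S [set w | within_rates S C0 q delta k (bhat k w)])%E.
Hypothesis bcv_rate : forall (k : 'I_(K S)) (m : 'I_J) (delta : R), 0 < delta < 1 ->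
  ((1 - 4 * expR (- ((n_train J n)%:R * delta ^+ 2)))%:E <=
    Pr S [set w | within_rates S C0 q delta k (bcv m k w)])%E.
Hypothesis xi0 : 0 < xi L S.

Let th0 : 0 < th. Proof. by case: tame => /andP[]. Qed.
Let mG : measurable_fun setT G. Proof. by case: tame. Qed.
Let LG : loss_modulus L G. Proof. by case: tame. Qed.
Let sgG : (\int[law iidS]_y (expR (th * G (resp y) ^+ 2))%:E <= 2%:E)%E.
Proof. by case: tame => _ _ _ h _; exact: h. Qed.
Let sgX v : dotv v v <= 1 ->
  (\int[law iidS]_y (expR (th * dotv v (covar S y) ^+ 2))%:E <= 2%:E)%E.
Proof. by case: tame => h _ _ _ _; case: sgS => sgx _; exact: subgaussian_law sgx v. Qed.
Let K0 : (0 < K S)%N. Proof. exact: models_gt0 cw. Qed.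
Let p0 : (0 < p S)%N. Proof. by case: sgS => /psi2_normv_gt0_dim. Qed.
Let n0 : (0 < n)%N. Proof. by case: adm. Qed.
Let bK2 k : dotv (bstar (e:=S) k) (bstar (e:=S) k) <= Kb ^+ 2.
Proof. exact: lqnorm2_le (ltW Kb0) (bK k). Qed.

Lemma lossb_integrable (b : 'cV[R]_(p S)) :
  (law iidS).-integrable setT (EFin \o lossb L b).
Proof.
apply: (lossv_integrable LG th0 (measurable_covar (S:=S)) sgX (@measurable_resp _ _ Y)
  _ sgG mL b (lossb_bstar_integrable iidS mL pseudo (Ordinal K0))).
exact: (measurableT_comp mG (@measurable_resp _ _ Y)).
Qed.

Let risk_star_lb := risk_star_bounded_below mL LG mG th0 Kb0 sgX sgG lossb_integrable bK2.

Section tail.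
Variables (a Ce : R).
Hypotheses (a0 : 0 <= a) (Ce0 : 0 <= Ce) (emp : emp_bound iidS L Kb a Ce).
Hypotheses (t6 : (6 + 4 * a) * (ln (p S * K S)%:R / n%:R) < 1) (T1 : rate S q <= 1).

Let C := excess_const (J := J) th q C0 Kb a Ce.
Let CT := C * rate S q.

Let eps0 : 0 <= (10 + 4 * J%:R) * expR (- a).
Proof. by apply: mulr_ge0; [apply: addr_ge0 => //; apply: mulr_ge0|exact: expR_ge0]. Qed.

Let C0' : 0 <= C. Proof. exact: excess_const_ge0. Qed.

Let CT0 : 0 <= CT.
Proof. by rewrite mulr_ge0// rateE mulr_ge0 ?sqrtr_ge0 ?powR_ge0. Qed.

Lemma prob_ge_excess : (2 <= K S)%N ->
  prob_ge (Pr S) (1 - (10 + 4 * J%:R) * expR (- a)) [set w |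
    (forall v, simplex v -> `|risk L S v w - risk_star L S v| <= CT) /\
    (exists c0, forall v, simplex v -> `|CV L S w v / n%:R - c0 - risk_star L S v| <= CT)].
Proof.
move=> K2; have pK2 : (2 <= p S * K S)%N by exact: leq_trans K2 (leq_pmull _ p0).
have pK0 : 0 < (p S * K S)%:R :> R by rewrite ltr0n (leq_trans _ pK2).
have lam12 : 1 / 2 <= ln (p S * K S)%:R :> R.
  by apply: le_trans (@ln2_ge_half R) _; rewrite ler_ln ?posrE ?ler_nat// ltr0n.
have nR0 : 0 < n%:R :> R by rewrite ltr0n.
have t0 : 0 <= ln (p S * K S)%:R / n%:R :> R by rewrite divr_ge0 ?(le_trans _ lam12).
apply: (prob_ge_good mL LG mG th0 q01 C00 Kb0 a0 Ce0 sgX sgG lossb_integrable J2 n0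
  p0 K2 bK2 mest bhat_rate bcv_rate _ _ T1); last by have := t6; lra.
apply: emp => //.
  by rewrite lnK ?posrE// card_ord ler_nat leq_pmull.
(* The factor 6 + 4 a of the hypothesis dominates both this one, from Bernstein's exponent, and 2 +
   4 a, which makes delta less than 1. *)
have : (6 + 2 * a) * (ln (p S * K S)%:R / n%:R) <= 1.
  by have := t6; have := mulr_ge0 a0 t0; lra.
by rewrite mulrA ler_pdivrMr// mul1r.
Qed.

Lemma prob_ge_risk_ratio : C * ((xi L S)^-1 * rate S q) <= 1 / 2 ->
  prob_ge (Pr S) (1 - (10 + 4 * J%:R) * expR (- a))
    [set w | `|risk_ratio L S w - 1| <= (8 * C + 1) * ((xi L S)^-1 * rate S q)].
Proof.
have [m lb] := risk_star_lb.
move=> xiC; have T0 : 0 <= rate S q by rewrite rateE mulr_ge0 ?sqrtr_ge0 ?powR_ge0.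
have xT0 : 0 <= (xi L S)^-1 * rate S q by rewrite mulr_ge0// invr_ge0 ltW.
have [K1|K2] := leqP (K S) 1.
  have {}K1 : K S = 1%N by apply/eqP; rewrite eqn_leq K1 K0.
  apply: (@prob_ge_le _ _ _ _ 1); first by rewrite gerBl.
  apply: prob_geT.
  move=> w /=; apply: le_trans (_ : 0 <= _); last first.
    exact: mulr_ge0 (addr_ge0 (mulr_ge0 (ler0n _ 8) C0') ler01) xT0.
  apply: (ratio_single w lb cw xi0 (F := fun v => risk L S v w)) => // v vs.
  exact: (risk_single mL pseudo lossb_integrable w K1 est vs).
have xiCT : CT <= xi L S / 2.
  have : xi L S * (C * ((xi L S)^-1 * rate S q)) <= xi L S * (1 / 2) by rewrite ler_pM2l.
  by rewrite mulrCA mulVKf ?gt_eqF// mul1r.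
apply: prob_geS (prob_ge_excess K2) => w [h1 h2].
apply: le_trans (risk_ratio_le lb cw xi0 CT0 xiCT h1 h2) _.
have -> : 8 * CT / xi L S = 8 * C * ((xi L S)^-1 * rate S q) by rewrite /CT; ring.
by apply: ler_wpM2r => //; rewrite lerDl.
Qed.

(** The averaged risk is within 3 e of R* in units of xi: e from the good event, e from M times the
    failure probability, e from the tail. With e for the criterion, the ratio moves by at most 4 (e
    + 3 e) = 16 e, and e <= 1/6 keeps 3 e below 1/2. *)
Lemma prob_ge_risk_mean_ratio (e M : R) : 0 <= M -> e <= 1 / 6 ->
  C * ((xi L S)^-1 * rate S q) <= e -> M * ((10 + 4 * J%:R) * expR (- a)) <= e ->
  (\int[Pr S]_(w in [set w | (M < `|(xi L S)^-1 * risk_dev L S w|)%R])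
     `|(xi L S)^-1 * risk_dev L S w|%:E <= e%:E)%E ->
  prob_ge (Pr S) (1 - (10 + 4 * J%:R) * expR (- a))
    [set w | `|risk_mean_ratio L S w - 1| <= 16 * e].
Proof.
have [m lb] := risk_star_lb.
move=> M0 e6 xiC Me UI; have T0 : 0 <= rate S q by rewrite rateE mulr_ge0 ?sqrtr_ge0 ?powR_ge0.
have xT0 : 0 <= (xi L S)^-1 * rate S q by rewrite mulr_ge0// invr_ge0 ltW.
have e0 : 0 <= e by apply: le_trans xiC; rewrite mulr_ge0.
have [K1|K2] := leqP (K S) 1.
  have {}K1 : K S = 1%N by apply/eqP; rewrite eqn_leq K1 K0.
  apply: (@prob_ge_le _ _ _ _ 1); first by rewrite gerBl.
  apply: prob_geT.
  move=> w /=; apply: le_trans (_ : 0 <= _); last by rewrite mulr_ge0//.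
  apply: (ratio_single w lb cw xi0 (F := risk_mean L S)) => // v vs.
  (* Only integrability of the risk is wanted here, and it follows from the tail bound; the empty
     event, of probability at least 0, serves as the good one. *)
  have g1 : prob_ge (Pr S) (1 - 1) [set w | forall v, simplex v ->
      `|risk L S v w - risk_star L S v| <= xi L S * 0].
    by exists set0; split => //; rewrite subrr measure0.
  have [ir _] := risk_mean_close mL LG mG th0 sgX sgG lossb_integrable bK2 mest xi0
    (lexx 0) M0 g1 UI vs.
  rewrite -[leLHS](@Rintegral_cstT _ _ _ (Pr S)) /risk_mean.
  apply: (Rintegral_mono (integrable_cst _ _) ir).
  by move=> w'; exact: (risk_single mL pseudo lossb_integrable w' K1 est vs).
have CTe : CT <= xi L S * e.
  have : xi L S * (C * ((xi L S)^-1 * rate S q)) <= xi L S * e by rewrite ler_pM2l.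
  by rewrite mulrCA mulVKf ?gt_eqF.
have g1 : prob_ge (Pr S) (1 - (10 + 4 * J%:R) * expR (- a)) [set w | forall v, simplex v ->
      `|risk L S v w - risk_star L S v| <= xi L S * e].
  apply: prob_geS (prob_ge_excess K2) => w [h1 _] v vs.
  exact: le_trans (h1 v vs) CTe.
have cl v : simplex v -> `|risk_mean L S v - risk_star L S v| <= xi L S * (3 * e).
  move=> vs; have [_ /le_trans] := risk_mean_close mL LG mG th0 sgX sgG lossb_integrable
    bK2 mest xi0 e0 M0 g1 UI vs.
  by apply; rewrite ler_pM2l//; have := Me; lra.
have e30 : 0 <= xi L S * (3 * e) by rewrite !mulr_ge0 ?(ltW xi0).
have e32 : xi L S * (3 * e) <= xi L S / 2 by rewrite ler_pM2l//; lra.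
apply: prob_geS (prob_ge_excess K2) => w [_ h2] /=.
apply: le_trans (risk_mean_ratio_le lb cw xi0 CT0 e30 e32 cl h2) _.
rewrite ler_pdivrMr//; have := CTe; lra.
Qed.

End tail.
End one_experiment.

Theorem theorem6 (R : realType) (dY dE : measure_display)
    (Y : measurableType dY) (E : measurableType dE)
    (g : R -> E -> Y) (L : Y -> R -> R) (r : R -> R -> R) (J : nat)
    (S : forall n : nat, experiment (R := R) Y E J n)
    (q C0 K_x K_y kappa_l K_beta : R)
    (J_ge2 : (2 <= J)%N)
    (q01 : 0 <= q <= 1)
    (C0_gt0 : 0 < C0) (K_x_gt0 : 0 < K_x) (K_y_gt0 : 0 < K_y)
    (kappa_l_gt0 : 0 < kappa_l) (K_beta_gt0 : 0 < K_beta)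
    (* the loss *)
    (L_meas : measurable_fun setT (fun z : Y * R => L z.1 z.2))
    (L_convex : forall y, convex_function [set: R^o] (L y))
    (* the model, the estimators and the weights *)
    (sample : forall n, admissible J n -> iid_sample (S n))
    (response : forall n, admissible J n -> response_model g (S n))
    (beta_min : forall n, admissible J n -> beta_minimizes L (S n))
    (folds : forall n, admissible J n -> equal_folds (S n))
    (est : forall n, admissible J n -> estimators L r (S n))
    (est_cv : forall n, admissible J n -> cv_estimators L r (S n))
    (weights : forall n, admissible J n -> cv_weights L (S n))
    (est_meas : forall n, admissible J n -> measurable_estimators (S n))
    (pseudo : forall n, admissible J n -> pseudo_true L (S n))
    (* (i) *)
    (loss_type :
      (exists2 e : Y -> R, injective e &
         forall y mu, L y mu = 1 / 2 * (e y - mu) ^+ 2) \/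
      (exists2 Lu : R, 0 < Lu &
         forall y mu1 mu2, `|L y mu1 - L y mu2| <= Lu * `|mu1 - mu2|))
    (* (ii) *)
    (X_subgaussian : forall n, admissible J n ->
      psi2_normv (Pr (S n)) (X_ (S n) first) = K_x%:E)
    (dL_derivable : forall n, admissible J n ->
      {ae Pr (S n), forall w, derivable (L (y_ first w)) 0 1})
    (dL_subgaussian : forall n, admissible J n ->
      psi2_norm (Pr (S n)) (fun w => derive1 (L (y_ first w)) 0) = K_y%:E)
    (Sigma_min : forall n, admissible J n ->
      kappa_l <= lambda_min (covariance_mx (Pr (S n)) (X_ (S n) first)))
    (* (iii) *)
    (bstar_bound : forall n, admissible J n ->
      forall k, lqnorm 2 (bstar (e:=S n) k) <= K_beta)
    (bhat_rate : forall n, admissible J n ->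
      forall (k : 'I_(K (S n))) (delta : R), 0 < delta < 1 ->
        ((1 - 4 * expR (- (n%:R * delta ^+ 2)))%:E <=
          Pr (S n) [set w | within_rates (S n) C0 q delta k (bhat k w)])%E)
    (bcv_rate : forall n, admissible J n ->
      forall (k : 'I_(K (S n))) (m : 'I_J) (delta : R), 0 < delta < 1 ->
        ((1 - 4 * expR (- ((n_train J n)%:R * delta ^+ 2)))%:E <=
          Pr (S n) [set w | within_rates (S n) C0 q delta k (bcv m k w)])%E)
    (* (iv) *)
    (xi_gt0 : forall n, admissible J n -> 0 < xi L (S n))
    (logpK_o_n :
      (fun n => ln (p (S n) * K (S n))%:R / n%:R : R) @ to_infty J --> (0 : R))
    (rate_0 : (fun n => rate (S n) q) @ to_infty J --> (0 : R))
    (rate_xi_0 :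
      (fun n => (xi L (S n))^-1 * rate (S n) q) @ to_infty J --> (0 : R)) :
  is_Op (fun n => Pr (S n)) (to_infty J)
    (fun n w => risk_ratio L (S n) w - 1)
    (fun n => (xi L (S n))^-1 * rate (S n) q) /\
  (uniformly_integrable (fun n => Pr (S n)) (admissible J)
     (fun n w => (xi L (S n))^-1 * risk_dev L (S n) w) ->
   is_op1 (fun n => Pr (S n)) (to_infty J)
     (fun n w => risk_mean_ratio L (S n) w - 1)).

Proof.
have [th [G tame]] : exists th G, tame_loss (E := E) L K_x K_y th G.
  case: loss_type => [[e _ LE]|[Lu Lu0 LL]].
    exact: tame_square LE.
  exact: tame_lipschitz Lu0 LL.
have [th0 _ _ _ emp] := tame.
have {}th0 : 0 < th by case/andP: th0.
have sgS n (h : admissible J n) : subgaussian_sample (S n) L K_x K_y.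
  by split; [exact: X_subgaussian|exact: dL_subgaussian].
have tail (c : R) : 0 < c -> exists2 a, 0 <= a & (10 + 4 * J%:R) * expR (- a) <= c.
  move=> c0; have J0 : 0 < 10 + 4 * J%:R :> R.
    by apply: ltr_wpDr => //; apply: mulr_ge0.
  exists (Num.max 0 (- ln (c / (10 + 4 * J%:R)))); first by rewrite le_max lexx.
  rewrite mulrC -ler_pdivlMr// -[leRHS]lnK ?posrE ?divr_gt0// ler_expR lerNl.
  by rewrite le_max lexx orbT.
have FF : Filter (nbhs (to_infty J)) by exact: within_filter.
have near_lt (u : nat -> R) (c : R) : u @ to_infty J --> (0 : R) -> 0 < c ->
    \forall n \near to_infty J, u n < c.
  by move=> u0 c0; apply: (cvgr_lt 0).
have near_adm : \forall n \near to_infty J, admissible J n.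
  by rewrite /to_infty; exact: withinT.
have near_good (a c : R) : 0 <= a -> 0 < c -> \forall n \near to_infty J,
    [/\ admissible J n, (6 + 4 * a) * (ln (p (S n) * K (S n))%:R / n%:R) < 1,
        rate (S n) q <= 1 & (xi L (S n))^-1 * rate (S n) q <= c].
  move=> a0 c0; have a6 : 0 < 6 + 4 * a by lra.
  have h1 := near_lt _ _ logpK_o_n (divr_gt0 ltr01 a6).
  have h2 := near_lt _ _ rate_0 ltr01; have h3 := near_lt _ _ rate_xi_0 c0.
  have := @filterI _ _ FF _ _ near_adm (@filterI _ _ FF _ _ h1 (@filterI _ _ FF _ _ h2 h3)).
  apply: filterS => n [adm [{}h1 [{}h2 {}h3]]].
  split => //; [|exact: ltW|exact: ltW].
  by move: h1; rewrite ltr_pdivlMr// mulrC.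
have div_le (C c T : R) : 0 <= C -> 0 < c -> T <= c / (C + 1) -> C * T <= c.
  move=> C0' c0 /(ler_wpM2l C0') /le_trans; apply.
  rewrite mulrA ler_pdivrMr ?ltr_wpDl//; lra.
split.
- move=> e e0; have [a a0 ae] := tail e e0.
  have [Ce Ce0 empC] := emp K_beta a K_beta_gt0 a0.
  pose C := excess_const (J := J) th q C0 K_beta a Ce.
  have C0' : 0 <= C by exact: excess_const_ge0.
  (* The added 1 makes the constant positive even when [C] is 0. *)
  exists (8 * C + 1); first by apply: ltr_wpDl => //; apply: mulr_ge0.
  have half_gt0 : 0 < 1 / 2 :> R by [].
  have c0 : 0 < (1 / 2) / (C + 1) :> R by rewrite divr_gt0// ltr_wpDl//.
  apply: filterS (near_good a _ a0 c0) => n [adm t6 T1 xT].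
  apply: prob_ge_le (_ : 1 - e <= 1 - (10 + 4 * J%:R) * expR (- a)) _; first by rewrite lerD2l lerN2.
  have emp' := empC J n (S n) (sample n adm) (sgS n adm) (lossb_integrable L_meas K_x_gt0
    tame (sample n adm) (sgS n adm) (weights n adm) (pseudo n adm)).
  have xC := div_le _ _ _ C0' half_gt0 xT.
  exact: (prob_ge_risk_ratio L_meas K_x_gt0 q01 C0_gt0 K_beta_gt0 tame J_ge2 adm
    (sgS n adm) (est n adm) (weights n adm) (est_meas n adm) (pseudo n adm)
    (bstar_bound n adm) (bhat_rate n adm) (bcv_rate n adm) (xi_gt0 n adm) a0 Ce0 emp' t6 T1 xC).
move=> UI e e0 c c0; pose e1 := Num.min (c / 16) (1 / 6).
have e10 : 0 < e1 by rewrite lt_min !divr_gt0//.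
have [M UIM] := UI e1 e10; pose M' := Num.max 0 M.
have M'0 : 0 <= M' by rewrite le_max lexx.
(* The truncation level is fixed before [a]: the failure probability has to be small against 1 / M'
   as well as against e. *)
have e2 : 0 < Num.min e (e1 / (M' + 1)) by rewrite lt_min e0 divr_gt0// ltr_wpDl//.
have [a a0] := tail _ e2; rewrite le_min => /andP[ae aM].
have [Ce Ce0 empC] := emp K_beta a K_beta_gt0 a0.
pose C := excess_const (J := J) th q C0 K_beta a Ce.
have C0' : 0 <= C by exact: excess_const_ge0.
have ce0 : 0 < e1 / (C + 1) by rewrite divr_gt0// ltr_wpDl//.
apply: filterS (near_good a _ a0 ce0) => n [adm t6 T1 xT].
apply: prob_ge_le (_ : 1 - e <= 1 - (10 + 4 * J%:R) * expR (- a)) _; first by rewrite lerD2l lerN2.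
have emp' := empC J n (S n) (sample n adm) (sgS n adm) (lossb_integrable L_meas K_x_gt0
  tame (sample n adm) (sgS n adm) (weights n adm) (pseudo n adm)).
have xC := div_le _ _ _ C0' e10 xT.
have e16 : e1 <= 1 / 6 by rewrite ge_min lexx orbT.
have UIM' : (\int[Pr (S n)]_(w in [set w | (M' < `|(xi L (S n))^-1 * risk_dev L (S n) w|)%R])
    `|(xi L (S n))^-1 * risk_dev L (S n) w|%:E <= e1%:E)%E.
  apply: le_trans (UIM n adm); rewrite integral_mkcond [leRHS]integral_mkcond.
  apply: ge0_integral_mono => w; rewrite !patchE.
    by case: ifP.
  case: (boolP (w \in _)) => [/set_mem /= h|_]; last first.
    (* Outside its domain a restricted function takes the default value [point], which is 0 here. *)
    by rewrite -[point]/(0%E : \bar R); case: ifP.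
  by rewrite ifT// inE/=; apply: le_lt_trans h; rewrite le_max lexx orbT.
apply: prob_geS (prob_ge_risk_mean_ratio L_meas K_x_gt0 q01 C0_gt0 K_beta_gt0 tame J_ge2 adm
  (sgS n adm) (est n adm) (weights n adm) (est_meas n adm) (pseudo n adm)
  (bstar_bound n adm) (bhat_rate n adm) (bcv_rate n adm) (xi_gt0 n adm) a0 Ce0 emp' t6 T1
  M'0 e16 xC (div_le _ _ _ M'0 e10 aM) UIM') => w /=.
move=> /le_trans; apply; have : e1 <= c / 16 by rewrite ge_min lexx.
lra.
Qed.
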